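(* Let $N=\mathbb S^2$ or $N=\mathbb H^2$, with $\Gamma(s)=\sin s$ or $\Gamma(s)=\sinh s$ respectively, and $F(s)=\int_0^s\Gamma(s')\,ds'$. For any given $(\mu,k,c)\in\mathbb R^3$ none of which vanishes, the modified Ishimori system (MI) admits nontrivial $(\mu,k,c)$-equivariant standing wave solutions from $\mathbb R^{1+2}$ to $N$ which are weak solutions, given in the four cones $C_\pm^{h},C_\pm^{v}$ by $$u_\pm^{h,v}(t,x,y)=\big(\Gamma_s(s_\pm^{h,v}(|a|)),\ \Gamma(s_\pm^{h,v}(|a|))\cos(\beta_\pm^{h,v}(|a|)+k\alpha+\mu t),\ \Gamma(s_\pm^{h,v}(|a|))\sin(\beta_\pm^{h,v}(|a|)+k\alpha+\mu t)\big),$$ $$\phi_\pm^{h,v}(t,x,y)=c\alpha+b\log|a|-\int_0^{|a|}\frac{2k}{a'}F(s_\pm^{h,v}(a'))\,da',$$ where $|a|=\sqrt{|x^2-y^2|}$, $\alpha=\frac12\log\frac{|x+y|}{|x-y|}$, and $b$ is any constant satisfying $-4(k^2+bk)>c^2$. Moreover, $$s_\pm^{h,v}(0)=0,\qquad s_-^{h,v}(a)=s_+^{h,v}(a),\quad \beta_-^{h,v}(a)=\beta_+^{h,v}(a)\quad\forall a\ge0,$$ and $s_\pm^{h,v}(a)$ and $\beta_\pm^{h,v}(a)$ are smooth for $a>0$ and are locally $C^\kappa$ for $a\ge0$ with the exponent $\kappa=\sqrt{-(k^2+bk)-\frac{c^2}{4}}$.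
   Context: Notation. $\eta_\pm=\mathrm{diag}(\pm1,1,1)$ on $\mathbb R^3$ (coordinates $(u_0,u_1,u_2)$), $\langle u,v\rangle_\pm=u\cdot(\eta_\pm v)$, $u\wedge_\pm v=\eta_\pm(u\wedge v)$. Sign $+$ for $\mathbb S^2=\{u_0^2+u_1^2+u_2^2=1\}$, sign $-$ for $\mathbb H^2=\{u_0^2-u_1^2-u_2^2=1\}$ (component containing $(1,0,0)$). System (MI): $u_t=u\wedge_\pm(u_{xx}-u_{yy})+u_y\phi_x-u_x\phi_y$, $\ \phi_{xx}-\phi_{yy}=-2\langle u,u_x\wedge_\pm u_y\rangle_\pm$, for $u(t,x,y)\in N$, $\phi(t,x,y)\in\mathbb R$. Weak solution on $I\times\mathbb R^2$ (here $I=\mathbb R$): $u\in N$ a.e.; $u,\nabla u,\phi,u\wedge_\pm\nabla u,\phi\nabla u,\langle u,u_x\wedge_\pm u_y\rangle_\pm\in L^1_{loc}(I\times\mathbb R^2)$; and for all $\psi\in C_c^\infty(I\times\mathbb R^2,\mathbb R^3)$, $\rho\in C_c^\infty(I\times\mathbb R^2,\mathbb R)$, $$\int\langle u\wedge_\pm u_y,\psi_y\rangle_\pm-\langle u\wedge_\pm u_x,\psi_x\rangle_\pm+\langle u,\psi_t\rangle_\pm-\phi\big(\langle u_y,\psi_x\rangle_\pm-\langle u_x,\psi_y\rangle_\pm\big)\,dt\,dx\,dy=0,$$ $$\int(\rho_{xx}-\rho_{yy})\phi+2\rho\langle u,u_x\wedge_\pm u_y\rangle_\pm\,dt\,dx\,dy=0.$$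 Cones: $C^h_\pm=\{|x|>|y|,\ \pm x>0\}$, $C^v_\pm=\{|y|>|x|,\ \pm y>0\}$; a superscript/subscript on a function indicates its restriction to that cone. Hyperbolic coordinates: $x=a\cosh\alpha,y=a\sinh\alpha$ if $|x|>|y|$; $x=a\sinh\alpha,y=a\cosh\alpha$ if $|x|<|y|$. $(\mu,k,c)$-equivariance: for all $t_0,\alpha_0\in\mathbb R$, $(u,\phi)\circ f_{t_0,\alpha_0}=\tilde f_{\mu t_0+k\alpha_0,\,c\alpha_0}(u,\phi)$, where $f_{t_0,\alpha_0}(t,x,y)=(t+t_0,\ x\cosh\alpha_0+y\sinh\alpha_0,\ x\sinh\alpha_0+y\cosh\alpha_0)$ and $\tilde f_{\tau_0,\alpha_0}(u_0,u_1,u_2,\phi)=(u_0,\ u_1\cos\tau_0-u_2\sin\tau_0,\ u_1\sin\tau_0+u_2\cos\tau_0,\ \phi+\alpha_0)$. Nontrivial means $u$ is not identically $(1,0,0)$.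
   Formalization: The claim that β is locally C^κ for a ≥ 0 is replaced by: β(a) + (c/2) log a is locally C^κ for a ≥ 0; the equations force β' ~ -c/(2a) or worse at a = 0 wherever s is nonzero, so β itself cannot be continuous there when c ≠ 0. *)

(* Defs.v *)
From HB Require Import structures.
From mathcomp Require Import all_boot all_order all_algebra.
From mathcomp Require Import all_classical all_reals all_analysis.

Set Implicit Arguments.
Unset Strict Implicit.
Unset Printing Implicit Defensive.
Import Order.TTheory GRing.Theory Num.Theory.
Import numFieldNormedType.Exports.

Local Open Scope classical_set_scope.
Local Open Scope ring_scope.

Variant sign := plus | minus.

Variant axis := hor | ver.

Definition sgv (R : realType) (e : sign) : R := if e is plus then 1 else -1.

Definition cosh (R : realType) (s : R) : R := (expR s + expR (- s)) / 2.
Definition sinh (R : realType) (s : R) : R := (expR s - expR (- s)) / 2.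

Definition vec3 (R : realType) (a b c : R) : 'rV[R]_3 := \row_i [:: a; b; c]`_i.

Definition eta (R : realType) (e : sign) : 'M[R]_3 :=
  diag_mx (vec3 (sgv R e) 1 1).

Definition inner (R : realType) (e : sign) (u v : 'rV[R]_3) : R :=
  (u *m (v *m eta R e)^T) 0 0.

Definition cross (R : realType) (u v : 'rV[R]_3) : 'rV[R]_3 :=
  vec3 (u 0 1 * v 0 2%:R - u 0 2%:R * v 0 1)
       (u 0 2%:R * v 0 0 - u 0 0 * v 0 2%:R)
       (u 0 0 * v 0 1 - u 0 1 * v 0 0).

Definition wedge (R : realType) (e : sign) (u v : 'rV[R]_3) : 'rV[R]_3 :=
  cross u v *m eta R e.

(* [target plus] is the sphere S^2, [target minus] the sheet of the hyperboloid
   through (1, 0, 0), i.e. H^2. *)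
Definition target (R : realType) (e : sign) : set 'rV[R]_3 :=
  match e with
  | plus => [set u | u 0 0 ^+ 2 + u 0 1 ^+ 2 + u 0 2%:R ^+ 2 = 1]
  | minus => [set u | u 0 0 ^+ 2 - u 0 1 ^+ 2 - u 0 2%:R ^+ 2 = 1 /\ 0 < u 0 0]
  end.

Definition Gamma (R : realType) (e : sign) : R -> R :=
  if e is plus then @sin R else @sinh R.

(* The integral from 0 to s is oriented, s may be negative. *)
Definition Fint (R : realType) (e : sign) (s : R) : R :=
  if 0 <= s then \int[lebesgue_measure]_(r in `[0, s]) Gamma e r
  else - \int[lebesgue_measure]_(r in `[s, 0]) Gamma e r.

Definition mu3 (R : realType) :
    {measure set (measurableTypeR R * measurableTypeR R * measurableTypeR R)
             -> \bar R} :=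
  ((@lebesgue_measure R \x @lebesgue_measure R) \x @lebesgue_measure R)%E.
Arguments mu3 R : clear implicits.

(* Points of space-time R x R^2 are written (t, x, y). *)
Definition et (R : realType) : R * R * R := (1, 0, 0).
Definition ex (R : realType) : R * R * R := (0, 1, 0).
Definition ey (R : realType) : R * R * R := (0, 0, 1).

(* All iterated directional derivatives exist and are continuous, i.e. f is of
   class C^oo. *)
Definition smooth3 (R : realType) (V : normedModType R) (f : R * R * R -> V) :=
  forall l : seq (R * R * R),
    let g := foldr (fun v (h : R * R * R -> V) p => 'D_v h p) f l in
    continuous g /\ forall p v, derivable g p v.

Definition test_function (R : realType) (V : normedModType R)
    (f : R * R * R -> V) : Prop :=
  smooth3 f /\
  exists2 K : set (R * R * R), compact K & forall p, ~ K p -> f p = 0.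

Definition L1loc (R : realType) (f : R * R * R -> R) : Prop :=
  forall K : set (R * R * R), compact K ->
    (mu3 R).-integrable K (EFin \o f).

Definition L1loc_vec (R : realType) (f : R * R * R -> 'rV[R]_3) : Prop :=
  forall i : 'I_3, L1loc (fun p => f p 0 i).

Definition weak_derivative (R : realType) (v : R * R * R)
    (f g : R * R * R -> 'rV[R]_3) : Prop :=
  forall (i : 'I_3) (rho : R * R * R -> R), test_function rho ->
    (\int[mu3 R]_p (f p 0 i * 'D_v rho p)%:E =
     - \int[mu3 R]_p (g p 0 i * rho p)%:E)%E.

Definition weak_solution (R : realType) (e : sign)
    (u : R * R * R -> 'rV[R]_3) (phi : R * R * R -> R) : Prop :=
  {ae mu3 R, forall p, target e (u p)} /\ L1loc_vec u /\ L1loc phi /\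
  exists ux uy : R * R * R -> 'rV[R]_3,
    [/\ weak_derivative (ex R) u ux /\ weak_derivative (ey R) u uy,
        [/\ L1loc_vec ux, L1loc_vec uy,
            L1loc_vec (fun p => wedge e (u p) (ux p)) &
            L1loc_vec (fun p => wedge e (u p) (uy p))],
        [/\ L1loc_vec (fun p => phi p *: ux p),
            L1loc_vec (fun p => phi p *: uy p) &
            L1loc (fun p => inner e (u p) (wedge e (ux p) (uy p)))],
        forall psi : R * R * R -> 'rV[R]_3, test_function psi ->
          (\int[mu3 R]_p
             (inner e (wedge e (u p) (uy p)) ('D_(ey R) psi p)
              - inner e (wedge e (u p) (ux p)) ('D_(ex R) psi p)
              + inner e (u p) ('D_(et R) psi p)
              - phi p * (inner e (uy p) ('D_(ex R) psi p)
                         - inner e (ux p) ('D_(ey R) psi p)))%:E = 0)%E &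
        forall rho : R * R * R -> R, test_function rho ->
          (\int[mu3 R]_p
             (('D_(ex R) ('D_(ex R) rho) p - 'D_(ey R) ('D_(ey R) rho) p) * phi p
              + 2 * rho p * inner e (u p) (wedge e (ux p) (uy p)))%:E = 0)%E].

Definition boost (R : realType) (t0 al0 : R) (p : R * R * R) : R * R * R :=
  let: (t, x, y) := p in
  (t + t0, x * cosh al0 + y * sinh al0, x * sinh al0 + y * cosh al0).

Definition rot (R : realType) (tau : R) (u : 'rV[R]_3) : 'rV[R]_3 :=
  vec3 (u 0 0) (u 0 1 * cos tau - u 0 2%:R * sin tau)
       (u 0 1 * sin tau + u 0 2%:R * cos tau).

(* The identities are between locally integrable functions, hence almost
   everywhere.  They cannot hold at the points (t, 0, 0) when c != 0: these are
   fixed by boost 0 al0, which would force phi = phi + c * al0 there. *)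
Definition equivariant (R : realType) (mu k c : R)
    (u : R * R * R -> 'rV[R]_3) (phi : R * R * R -> R) : Prop :=
  forall t0 al0 : R, {ae mu3 R, forall p,
    u (boost t0 al0 p) = rot (mu * t0 + k * al0) (u p) /\
    phi (boost t0 al0 p) = phi p + c * al0}.

(* Almost everywhere again, so that changing the constant map (1, 0, 0) on a
   null set does not make it nontrivial. *)
Definition nontrivial (R : realType) (u : R * R * R -> 'rV[R]_3) : Prop :=
  ~ {ae mu3 R, forall p, u p = vec3 1 0 0}.

Definition cone (R : realType) (X : axis) (e : sign) : set (R * R) :=
  match X with
  | hor => [set z | `|z.2| < `|z.1| /\ 0 < sgv R e * z.1]
  | ver => [set z | `|z.1| < `|z.2| /\ 0 < sgv R e * z.2]
  end.

Definition hyp_radius (R : realType) (x y : R) : R :=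
  Num.sqrt `|x ^+ 2 - y ^+ 2|.

Definition hyp_angle (R : realType) (x y : R) : R :=
  2^-1 * ln (`|x + y| / `|x - y|).

Definition smooth_pos (R : realType) (f : R -> R) : Prop :=
  forall (n : nat) (a : R), 0 < a -> derivable (derive1n n f) a 1.

(* Class C^kappa_loc on [0, +oo[, i.e. C^{m, kappa - m}_loc with m the integer
   part of kappa: g j is the j-th derivative of f on ]0, +oo[, extended
   continuously to 0, and the last one is Hoelder of exponent kappa - m on
   every [0, A].  For an integer kappa the exponent is 0 and this is C^m. *)
Definition locally_Ckappa (R : realType) (kappa : R) (f : R -> R) : Prop :=
  let m := Num.truncn kappa in
  exists g : nat -> R -> R,
    [/\ forall a, 0 <= a -> g 0%N a = f a,
        forall j (a : R), (j < m)%N -> 0 < a -> is_derive a 1 (g j) (g j.+1 a),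
        forall j, (j <= m)%N -> {within `[0, +oo[, continuous (g j)} &
        forall A : R, exists C : R, forall a a' : R,
          0 <= a <= A -> 0 <= a' <= A ->
          `|g m a - g m a'| <= C * `|a - a'| `^ (kappa - m%:R)].

(* beta is of class C^kappa on [0, +oo[ up to the logarithm -(c / 2) ln a.  For
   the solutions at hand the e_s-component of the equation (e_s, e_theta polar
   frame of the target) is (a Gamma(s)^2 beta')' = - c F(s)', and s(0) = 0
   leaves only beta' = - c F(s) / (a Gamma(s)^2), equivalent to - c / (2 a) as
   a -> 0: for c != 0 the phase itself has no limit at 0, and only its
   difference with the logarithm can be regular there. *)
Definition locally_Ckappa_mod_log (R : realType) (kappa c : R)
    (beta : R -> R) : Prop :=
  exists2 B : R -> R, locally_Ckappa kappa B &
    forall a : R, 0 < a -> beta a = B a - c / 2 * ln a.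

(* Main.v *)
Require Import Defs.
From HB Require Import structures.
From mathcomp Require Import all_boot all_order all_algebra.
From mathcomp Require Import all_classical all_reals all_analysis.
From mathcomp Require Import measurable_realfun ring lra.
Set Implicit Arguments.
Unset Strict Implicit.
Unset Printing Implicit Defensive.
Import Order.TTheory GRing.Theory Num.Theory.
Import numFieldNormedType.Exports.
Local Open Scope classical_set_scope.
Local Open Scope ring_scope.

(** The symmetry reduces the system to an ordinary differential equation in the
    logarithm of the hyperbolic radius, and the weak formulation across the
    light cone is checked on null lines.

    Reduction.  Let xi = x + y and zt = x - y be the null coordinates, tau =
    ln a = (ln |xi| + ln |zt|) / 2 and alpha = (ln |xi| - ln |zt|) / 2, and let
    sg be the sign of xi * zt, which is 1 on the horizontal and -1 on the
    vertical cones.  Write F for the integral of Gamma vanishing at 0 and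
    Q = 1 / (1 + Gamma') = F / Gamma^2.  In terms of tau the system becomes
      phi = c alpha + b tau + Ph,    Ph' = - 2 k F(s),
      beta' = - c Q(s),
      s'' = sg mu e^(2 tau) Gamma(s) + Gamma(s) g(s),
    where g(0) = kappa^2 > 0 is the condition imposed on b.  The equation for
    beta is the first integral, regular at s = 0, of a component of the system;
    since Q is 1/2 at s = 0, beta contains the logarithm - (c / 2) tau.

    Existence ([small_solution]).  As tau tends to -oo the equation for s is a
    perturbation of s'' = kappa^2 s, and a fixed point argument ([volterra])
    gives solutions equivalent to d e^(kappa tau) = d a^kappa.  Where
    sg mu < 0 the term sg mu e^(2 tau) Gamma(s) is a restoring force, and an
    energy estimate keeps the solution small for all tau if d is small.  In the
    remaining two cones s = 0 is taken; nontriviality only needs one cone.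

    Regularity ([profile_regular_s], [profile_regular_beta]).  The functions
    that occur generate an algebra stable under d/dtau, in which those
    vanishing with s and s' form a stable ideal of functions O(e^(kappa tau)).
    The j-th derivative in a of a function with derivative in that ideal is
    therefore O(a^(kappa - j)), whence the class C^kappa.

    Weak formulation ([ansatz_weak_solution]).  Off the light cone xi zt = 0
    the system is an identity between the fields ([balance0], [balance1],
    [balance2]).  At the light cone the null derivatives of u are of size
    |xi|^(kappa / 2 - 1) or |zt|^(kappa / 2 - 1) up to logarithms, hence locally
    integrable, while u and each flux have a limit there along almost every null
    line on which they are integrated.  So integration by parts on null lines
    ([ibp_P], [ibp_M]) leaves no contribution of the light cone.  In
    the second equation the operator is a product of two null derivatives, and
    each of the logarithms in c alpha + b tau is constant along one of the two
    families of null lines ([ibp_P_const], [ibp_M_const]). *)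

(** * One-variable calculus *)

Section Calculus.
Context {R : realType}.
Implicit Types (f g : R -> R) (x a b : R).

(** Derivation rules stated for lambda-abstractions, so that the tactic [der]
    below can apply them by syntax alone. *)
Lemma dC x a : is_derive x 1 (fun _ => a) 0.
Proof. exact: is_derive_cst. Qed.
Lemma dI x : is_derive x 1 (fun y => y) 1.
Proof. exact: is_derive_id. Qed.
Lemma dD f g x a b : is_derive x 1 f a -> is_derive x 1 g b ->
  is_derive x 1 (fun y => f y + g y) (a + b).
Proof. exact: is_deriveD. Qed.
Lemma dN f x a : is_derive x 1 f a -> is_derive x 1 (fun y => - f y) (- a).
Proof. exact: is_deriveN. Qed.
Lemma dM f g x a b : is_derive x 1 f a -> is_derive x 1 g b ->
  is_derive x 1 (fun y => f y * g y) (f x * b + g x * a).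
Proof. move=> h1 h2; exact: is_deriveM. Qed.
Lemma dV f x a : f x != 0 -> is_derive x 1 f a ->
  is_derive x 1 (fun y => (f y)^-1) (- (f x) ^- 2 * a).
Proof. move=> h1 h2; exact: is_deriveV. Qed.
Lemma dX f x a n : is_derive x 1 f a ->
  is_derive x 1 (fun y => f y ^+ n.+1) (n.+1%:R * f x ^+ n * a).
Proof.
move=> h; rewrite (_ : (fun y => _) = f ^+ n.+1); last first.
  by apply/funext => y; rewrite exprfctE.
exact: is_derive_eq.
Qed.
Lemma is_derive_chain f g x a b : is_derive (g x) 1 f a -> is_derive x 1 g b ->
  is_derive x 1 (fun y => f (g y)) (a * b).
Proof. move=> h1 h2; exact: is_derive1_comp. Qed.
Lemma dexp f x a : is_derive x 1 f a ->
  is_derive x 1 (fun y => expR (f y)) (expR (f x) * a).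
Proof. by move=> h; apply: is_derive_chain h; exact: is_derive_expR. Qed.
Lemma dsin f x a : is_derive x 1 f a ->
  is_derive x 1 (fun y => sin (f y)) (cos (f x) * a).
Proof. by move=> h; apply: is_derive_chain h; exact: is_derive_sin. Qed.
Lemma dcos f x a : is_derive x 1 f a ->
  is_derive x 1 (fun y => cos (f y)) (- sin (f x) * a).
Proof. by move=> h; apply: is_derive_chain h; exact: is_derive_cos. Qed.
Lemma dln f x a : 0 < f x -> is_derive x 1 f a ->
  is_derive x 1 (fun y => ln (f y)) ((f x)^-1 * a).
Proof. by move=> f0 h; apply: is_derive_chain h; exact: is_derive1_ln. Qed.

Lemma near_gt x a : a < x -> \forall y \near x, a < y.
Proof. move=> h; exact: lt_nbhsr. Qed.
Lemma near_lt x a : x < a -> \forall y \near x, y < a.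
Proof. move=> h; exact: lt_nbhsl. Qed.

Lemma dlnabs f x a : f x != 0 -> is_derive x 1 f a ->
  is_derive x 1 (fun y => ln `|f y|) ((f x)^-1 * a).
Proof.
move=> x0 h; apply: (is_derive_chain (f := fun y : R => ln `|y|) (g := f)).
have [xp|xn|xz] := ltrgt0P (f x); last by rewrite xz eqxx in x0.
- apply: (near_eq_is_derive (f := @ln R)); last exact: is_derive1_ln.
  by near=> y; rewrite gtr0_norm//; near: y; exact: near_gt.
- apply: (near_eq_is_derive (f := fun y => ln (- y))).
    by near=> y; rewrite ltr0_norm//; near: y; exact: near_lt.
  have := dln (f := fun y => - y) (x := f x); rewrite oppr_gt0 => /(_ _ xn (dN (dI _))).
  by move=> h'; rewrite -[(f x)^-1]opprK -invrN -mulrN1; exact: h'.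
Unshelve. all: by end_near. Qed.

Lemma is_derive_continuous f x a : is_derive x 1 f a -> {for x, continuous f}.
Proof.
by move=> h; apply: differentiable_continuous; apply/derivable1_diffP.
Qed.

Lemma nondecreasing_deriv f (df : R -> R) a b : a <= b ->
  (forall x, a <= x <= b -> is_derive x 1 f (df x)) ->
  (forall x, a <= x <= b -> 0 <= df x) -> f a <= f b.
Proof.
move=> ab hd hp.
have [c /[!in_itv]/= cab E] : exists2 c, c \in `[a, b] & f b - f a = df c * (b - a).
  apply: MVT_segment => //.
    by move=> x /[!in_itv]/= /andP[h1 h2]; apply: hd; rewrite !ltW.
  apply: derivable_within_continuous => x /[!in_itv]/= h.
  by have [] := hd _ h.
by rewrite -subr_ge0 E mulr_ge0 ?hp// subr_ge0.
Qed.

Lemma eq_deriv f g (df : R -> R) a b : a <= b ->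
  (forall x, a <= x <= b -> is_derive x 1 f (df x)) ->
  (forall x, a <= x <= b -> is_derive x 1 g (df x)) ->
  f b - f a = g b - g a.
Proof.
move=> ab hf hg.
have h1 : f a - g a <= f b - g b.
  apply: (nondecreasing_deriv (f := fun x => f x - g x) (df := fun=> 0)) => // x h.
  by apply: is_derive_eq; [apply: dD; [exact: hf|apply: dN; exact: hg]|rewrite subrr].
have h2 : g a - f a <= g b - f b.
  apply: (nondecreasing_deriv (f := fun x => g x - f x) (df := fun=> 0)) => // x h.
  by apply: is_derive_eq; [apply: dD; [exact: hg|apply: dN; exact: hf]|rewrite subrr].
lra.
Qed.

Section Antiderivative.
Variable f : R -> R.
Hypothesis cf : continuous f.
Notation leb := (@lebesgue_measure R).

(** The primitive on [- n, +oo[, normalised to vanish at 0 so that different n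
    agree. *)
Let P (n : nat) (x : R) : R := \int[leb]_(t in `[- n%:R, x]) f t -
  \int[leb]_(t in `[- n%:R, 0]) f t.

Let P_derive n x : - n%:R < x -> is_derive x 1 (P n) (f x).
Proof.
move=> nx; rewrite /P.
pose G (y : R) : R := \int[leb]_(t in `[- n%:R, y]) f t.
have [d1 d2] : derivable G x 1 /\ derive1 G x = f x.
  apply: (@continuous_FTC1_closed _ f (- n%:R) x (x + 1)) => //.
  - by rewrite ltrDl.
  - apply: continuous_compact_integrable; first exact: segment_compact.
    exact: continuous_subspaceT.
  - exact: cf.
apply: is_derive_eq; first apply: dD.
  apply: DeriveDef; first exact: d1.
  by rewrite -derive1E; exact: d2.
by rewrite addr0.
Qed.

Let P_agree n m x : (0 < n)%N -> (0 < m)%N -> - n%:R < x -> - m%:R < x -> P n x = P m x.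
Proof.
move=> n0 m0 nx mx.
have zn : - n%:R < 0 :> R by rewrite oppr_lt0 ltr0n.
have zm : - m%:R < 0 :> R by rewrite oppr_lt0 ltr0n.
have P0 k : P k 0 = 0 by rewrite /P subrr.
have [x0|x0] := leP 0 x.
  have := @eq_deriv (P n) (P m) f 0 x x0; rewrite !P0 !subr0; apply => y /andP[h1 h2];
  apply: P_derive; lra.
have := @eq_deriv (P n) (P m) f x 0 (ltW x0); rewrite !P0 !sub0r => h.
apply: oppr_inj; apply: h => y /andP[h1 h2]; apply: P_derive; lra.
Qed.

Lemma antiderivative : exists F : R -> R, forall x, is_derive x 1 F (f x).
Proof.
exists (fun x => P (Num.truncn `|x|).+1 x) => x.
have bd (y : R) : - (Num.truncn `|y|).+1%:R < y.
  have := truncnS_gt `|y|; have := ler_norm (- y); rewrite normrN; lra.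
pose N := (Num.truncn (`|x| + 1)).+1.
have hN : - N%:R < x.
  by have := truncnS_gt (`|x| + 1); rewrite -/N;
  have := ler_norm (- x); rewrite normrN; lra.
apply: (near_eq_is_derive (f := P N)); last exact: P_derive.
near=> y; apply: P_agree => //; near: y; exact: near_gt.
Unshelve. all: by end_near. Qed.

(** For any primitive P0 of f the function P0 + h increases, P0 - h decreases,
    and the second stays below the first; subtracting from P0 the infimum of P0 +
    h leaves a primitive between - h and h. This stands for the integral of f from
    -oo. *)
Lemma antiderivative_at_minus_infinity (h dh : R -> R) :
  (forall x, 0 <= h x) -> (forall x, is_derive x 1 h (dh x)) ->
  (forall x, `|f x| <= dh x) ->
  exists F : R -> R, (forall x, is_derive x 1 F (f x)) /\ forall x, `|F x| <= h x.
Proof.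
move=> h0 hd fh; have [P0 dP] := antiderivative.
have inc a b : a <= b -> P0 a + h a <= P0 b + h b.
  move=> ab; apply: (nondecreasing_deriv (f := fun x => P0 x + h x)
    (df := fun x => f x + dh x)) => // x _.
  have := fh x; rewrite ler_norml => /andP[]; lra.
have dec a b : a <= b -> P0 b - h b <= P0 a - h a.
  move=> ab; rewrite -lerN2.
  apply: (nondecreasing_deriv (f := fun x => - (P0 x - h x))
    (df := fun x => - (f x - dh x))) => // x _.
  have := fh x; rewrite ler_norml => /andP[]; lra.
have low x y : P0 x - h x <= P0 y + h y.
  have [xy|/ltW yx] := leP x y.
    by have := inc _ _ xy; have := h0 x; lra.
  by have := dec _ _ yx; have := h0 y; lra.
pose A := [set P0 y + h y | y in [set: R]].
have hA : has_inf A.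
  split; first by exists (P0 0 + h 0), 0.
  by exists (P0 0 - h 0) => _ [y _ <-].
exists (fun x => P0 x - inf A); split.
  by move=> x; rewrite -[f x]addr0; exact: dD.
move=> x; have h1 : inf A <= P0 x + h x by apply: ge_inf; [case: hA|exists x].
have h2 : P0 x - h x <= inf A by apply: lb_le_inf; [case: hA|move=> _ [y _ <-]].
rewrite ler_norml; apply/andP; lra.
Qed.
End Antiderivative.

(** The contraction principle for the norm sup |v| / E. The iterates of 0
    converge pointwise at a geometric rate proportional to E; as E is locally
    bounded, the limit is continuous. *)
Lemma weighted_fixed_point (T : (R -> R) -> (R -> R)) (E : R -> R) (M : R) :
  (forall x, 0 < E x) -> continuous E ->
  let B := [set v : R -> R | continuous v /\ forall x, `|v x| <= M * E x] in
  0 <= M -> 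
  (forall v, B v -> B (T v)) ->
  (forall v w D, B v -> B w -> 0 <= D -> (forall x, `|v x - w x| <= D * E x) ->
     forall x, `|T v x - T w x| <= D / 2 * E x) ->
  exists2 v, B v & T v = v.
Proof.
move=> E0 cE B M0 TB Tc.
pose vn n := iter n T (fun=> 0).
have Bn n : B (vn n).
  elim: n => [|n IH]; last exact: TB.
  by split => [x|x]; [exact: cvg_cst|rewrite normr0 mulr_ge0// ltW].
have step n x : `|vn n.+1 x - vn n x| <= M * 2^-1 ^+ n * E x.
  elim: n x => [|n IH] x.
    by rewrite expr0 mulr1 subr0; case: (Bn 1%N).
  rewrite exprSr mulrA; apply: (Tc (vn n.+1) (vn n)) => //.
  by rewrite mulr_ge0// exprn_ge0// invr_ge0.
have tele n m x : `|vn (n + m)%N x - vn n x| <= 2 * M * 2^-1 ^+ n * (1 - 2^-1 ^+ m) * E x.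
  elim: m => [|m IH]; first by rewrite addn0 subrr normr0 expr0 subrr mulr0 mul0r.
  rewrite addnS (_ : _ - _ = (vn (n + m).+1 x - vn (n + m)%N x) + (vn (n + m)%N x - vn n x)); last by ring.
  apply: (le_trans (ler_normD _ _)).
  apply: (le_trans (lerD (step _ _) IH)).
  by rewrite exprD exprS le_eqVlt; apply/orP; left; apply/eqP; field.
have tele2 n m x : (n <= m)%N -> `|vn m x - vn n x| <= 2 * M * E x * 2^-1 ^+ n.
  move=> nm; rewrite -(subnKC nm); apply: (le_trans (tele _ _ _)).
  have h1 : 0 <= 2 * M * 2^-1 ^+ n * E x by rewrite !mulr_ge0// ?exprn_ge0// ?invr_ge0// ltW.
  have h2 : 0 <= (2^-1 : R) ^+ (m - n) by rewrite exprn_ge0// invr_ge0.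
  nra.
have geo K : (fun n => K * 2^-1 ^+ n : R) @ \oo --> (0 : R).
  rewrite -[X in _ --> X](mulr0 K); apply: cvgMr; apply: cvg_expr.
  by rewrite ger0_norm ?invr_ge0//; lra.
have cv x : cvgn (fun n => vn n x).
  apply/cauchy_cvgP/cauchyP => e e0.
  have /cvgrPdist_lt/(_ _ e0) [n _ hn] := geo (2 * M * E x).
  exists (vn n x); exists n => // m /= nm.
  rewrite /ball /= distrC; apply: (le_lt_trans (tele2 _ _ _ nm)).
  by have := hn n (leqnn n); rewrite sub0r normrN => /(le_lt_trans (ler_norm _)).
pose v x := limn (fun n => vn n x).
have lim n x : `|v x - vn n x| <= 2 * M * E x * 2^-1 ^+ n.
  have h : (fun m => `|vn m x - vn n x|) @ \oo --> `|v x - vn n x|.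
    by apply: cvg_norm; apply: cvgB; [exact: cv|exact: cvg_cst].
  by apply: (ler_cvg_to h (@cvg_cst _ _ _ _ _)); exists n => // m /= nm; exact: tele2.
have vE x : `|v x| <= M * E x.
  have h : (fun m => `|vn m x|) @ \oo --> `|v x| by apply: cvg_norm; exact: cv.
  by apply: (ler_cvg_to h (@cvg_cst _ _ _ _ _)); apply: nearW => n; case: (Bn n).
have vc : continuous v.
  move=> x; apply/cvgrPdist_lt => e e0.
  have e3 : 0 < e / 3 by lra.
  have /cvgrPdist_lt/(_ _ e3) [n _ hn] := geo (2 * M * (E x + 1)).
  have := hn n (leqnn n); rewrite sub0r normrN => /(le_lt_trans (ler_norm _)) {}hn.
  have g0 : 0 <= (2^-1 : R) ^+ n by rewrite exprn_ge0// invr_ge0.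
  have /cvgrPdist_lt/(_ _ e3) c1 := (Bn n).1 x.
  have /cvgrPdist_lt/(_ _ ltr01) c2 := cE x.
  near=> y.
  have h1 := lim n x; have h2 := lim n y.
  have h3 : `|vn n x - vn n y| < e / 3 by near: y.
  have h4 : `|E x - E y| < 1 by near: y.
  have h5 : E y <= E x + 1 by move: h4; rewrite ltr_norml => /andP[]; lra.
  have h6 : 2 * M * E y * 2^-1 ^+ n <= 2 * M * (E x + 1) * 2^-1 ^+ n.
    by rewrite ler_wpM2r// ler_wpM2l// mulr_ge0.
  have h7 : 2 * M * E x * 2^-1 ^+ n <= 2 * M * (E x + 1) * 2^-1 ^+ n.
    by rewrite ler_wpM2r// ler_wpM2l ?mulr_ge0//; lra.
  rewrite (_ : v x - v y = (v x - vn n x) + (vn n x - vn n y) - (v y - vn n y)); last by ring.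
  by have := ler_normB ((v x - vn n x) + (vn n x - vn n y)) (v y - vn n y);
    have := ler_normD (v x - vn n x) (vn n x - vn n y); lra.
have Bv : B v by [].
exists v => //; apply/funext => x; apply/eqP; rewrite -subr_eq0 -normr_le0.
have bd n : `|T v x - v x| <= 2 * M * E x * 2^-1 ^+ n.
  have h1 := Tc v (vn n) (2 * M * 2^-1 ^+ n) Bv (Bn n).
  have h2 : `|T v x - vn n.+1 x| <= 2 * M * 2^-1 ^+ n / 2 * E x.
    apply: h1 => [|y]; first by rewrite !mulr_ge0// exprn_ge0// invr_ge0.
    by rewrite mulrAC; exact: lim.
  have h3 := lim n.+1 x; rewrite exprS in h3.
  rewrite (_ : _ - v x = (T v x - vn n.+1 x) - (v x - vn n.+1 x)); last by ring.
  apply: (le_trans (ler_normB _ _)); apply: (le_trans (lerD h2 h3)).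
  by rewrite le_eqVlt; apply/orP; left; apply/eqP; field.
have h : (fun n : nat => `|T v x - v x|) @ \oo --> `|T v x - v x| by exact: cvg_cst.
by apply: (ler_cvg_to h (geo (2 * M * E x))); exact: nearW.
Unshelve. all: by end_near. Qed.

End Calculus.

(** [der] differentiates an explicit expression, taking the derivatives of its
    atoms from the context, and leaves the equality of the two derivatives. *)
Ltac der1 := first [ eassumption
  | match goal with H : forall _, _ |- _ => notypeclasses refine (H _) end
  | notypeclasses refine (dC _ _)
  | notypeclasses refine (dI _) | notypeclasses refine (dD _ _)
  | notypeclasses refine (dN _) | notypeclasses refine (dM _ _)
  | notypeclasses refine (dX _ _) | notypeclasses refine (dexp _)
  | notypeclasses refine (dsin _) | notypeclasses refine (dcos _) ].
Ltac der := notypeclasses refine (is_derive_eq _ _); [ repeat der1 | cbv beta ].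

Ltac pos := repeat first [ done | apply: mulr_ge0 | apply: exprn_ge0 | apply: expR_ge0
  | apply: normr_ge0 | rewrite invr_ge0
  | match goal with H : is_true (0 < ?x) |- is_true (0 <= ?x) => exact: ltW end
  | rewrite subr_ge0; done | apply: addr_ge0 ].

Section BoundedOn.
Context {R : realType} {T : Type} (D : set T).
Implicit Types f g : T -> R.

Definition bounded_on f := exists L : R, forall p, D p -> `|f p| <= L.

Lemma bounded_cst (a : R) : bounded_on (fun _ => a).
Proof. by exists `|a|. Qed.
Lemma bounded_add f g : bounded_on f -> bounded_on g -> bounded_on (fun p => f p + g p).
Proof.
move=> [L1 h1] [L2 h2]; exists (L1 + L2) => s s1.
by apply: (le_trans (ler_normD _ _)); rewrite lerD ?h1 ?h2.
Qed.
Lemma bounded_opp f : bounded_on f -> bounded_on (fun p => - f p).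
Proof. by move=> [L1 h1]; exists L1 => s s1; rewrite normrN h1. Qed.
Lemma bounded_mul f g : bounded_on f -> bounded_on g -> bounded_on (fun p => f p * g p).
Proof.
move=> [L1 h1] [L2 h2]; exists (L1 * L2) => s s1.
by rewrite normrM; apply: ler_pM => //; rewrite ?h1 ?h2.
Qed.
Lemma bounded_exp f n : bounded_on f -> bounded_on (fun p => f p ^+ n).
Proof.
move=> [L1 h1]; exists (L1 ^+ n) => s s1.
by rewrite normrX; apply: lerXn2r; rewrite ?nnegrE ?h1// (le_trans (normr_ge0 _) (h1 _ s1)).
Qed.
Lemma bounded_ge0 f : bounded_on f -> exists2 L : R, 0 <= L & forall p, D p -> `|f p| <= L.
Proof.
move=> [L h]; exists `|L| => // p Dp; exact: le_trans (h p Dp) (ler_norm _).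
Qed.
End BoundedOn.

Ltac bounded1 := first [ assumption | notypeclasses refine (bounded_cst _ _)
  | notypeclasses refine (bounded_add _ _) | notypeclasses refine (bounded_opp _)
  | notypeclasses refine (bounded_mul _ _) | notypeclasses refine (bounded_exp _ _) ].
Ltac bounded := repeat bounded1.

(** * A Volterra equation on the line *)

Section ComparisonAtMinusInfinity.
Context {R : realType}.

(** F + h and h - F are nondecreasing, and nearly nonnegative at points close
    to -oo since h2 is small there. *)
Lemma antiderivative_comparison (F f h dh h2 : R -> R) :
  (forall x : R, is_derive x 1 F (f x)) -> (forall x : R, is_derive x 1 h (dh x)) ->
  (forall x, `|f x| <= dh x) -> (forall x, 0 <= h x) -> (forall x, `|F x| <= h2 x) ->
  (forall x e : R, 0 < e -> exists2 y, y <= x & h2 y <= e) ->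
  forall x, `|F x| <= h x.
Proof.
move=> dF dh' fh h0 Fh2 h20 x; apply/ler_addgt0Pr => e e0.
have [y yx hy] := h20 x e e0.
have := Fh2 y; rewrite ler_norml => /andP[F1 F2].
have hy0 := h0 y.
have i1 : F y + h y <= F x + h x.
  apply: (nondecreasing_deriv (f := fun z => F z + h z) (df := fun z => f z + dh z)) => // z _.
  by have := fh z; rewrite ler_norml => /andP[]; lra.
have i2 : h y - F y <= h x - F x.
  apply: (nondecreasing_deriv (f := fun z => h z - F z) (df := fun z => dh z - f z)) => // z _.
  by have := fh z; rewrite ler_norml => /andP[]; lra.
rewrite ler_norml; apply/andP; lra.
Qed.
End ComparisonAtMinusInfinity.

Section Volterra.
Context {R : realType}.
Variables (kap nu L : R).
Hypotheses (nu0 : 0 < nu) (nu1 : nu <= 1) (L0 : 0 < L).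

Implicit Types (t x y D d : R).

Definition wt (t : R) := expR (2 * nu * t) + expR (2 * t).
Definition lam := L / (2 * nu ^+ 2).
(** The weight is built for two successive integrations from -oo: L wt Wt <=
    nu Wt', and then nu (Wt - 1) <= Wt' / 2. The gain 1/2 makes the Volterra
    operator below a contraction on the whole line. *)
Definition Wt (t : R) := expR (lam * wt t).
Let dwt (t : R) := 2 * nu * expR (2 * nu * t) + 2 * expR (2 * t).

Lemma lam_gt0 : 0 < lam.
Proof. by rewrite /lam divr_gt0// mulr_gt0// exprn_gt0. Qed.
Let lamE : lam * (2 * nu ^+ 2) = L.
Proof. by rewrite /lam divfK// mulf_neq0// expf_neq0// gt_eqF. Qed.
Lemma wt_gt0 t : 0 < wt t.
Proof. by rewrite addr_gt0// expR_gt0. Qed.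
Let dwt_ge t : 2 * nu * wt t <= dwt t.
Proof. have := nu1; rewrite /dwt /wt; have := expR_gt0 (2 * t); nra. Qed.
Lemma Wt_ge1 t : 1 <= Wt t.
Proof. by rewrite /Wt -expR0 ler_expR mulr_ge0// ltW// ?lam_gt0// wt_gt0. Qed.
Let Wt_gt0 t : 0 < Wt t. Proof. exact: expR_gt0. Qed.
Let dW t : is_derive t 1 Wt (lam * dwt t * Wt t).
Proof. by rewrite /Wt /wt; der; rewrite /dwt; ring. Qed.
Let Wt_le t : Wt t - 1 <= lam * wt t * Wt t.
Proof.
have h := expR_ge1Dx (- (lam * wt t)); have W0 := Wt_gt0 t.
have := ler_wpM2r (ltW W0) h; rewrite {2}/Wt -expRD addNr expR0; lra.
Qed.
Lemma continuous_Wt : continuous Wt.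
Proof. by move=> t; exact: is_derive_continuous (dW t). Qed.

Lemma wt_small (x e : R) : 0 < e -> exists2 y, y <= x & wt y <= e.
Proof.
move=> e0; pose z := Num.min 0 (ln (e / 2) / (2 * nu)).
exists (Num.min x z); first by rewrite ge_min lexx.
set y := Num.min x z.
have y0 : y <= 0 by rewrite /y /z !ge_min lexx ?orbT.
have y1 : y <= ln (e / 2) / (2 * nu) by rewrite /y /z !ge_min lexx ?orbT.
have nn : 0 < 2 * nu by rewrite mulr_gt0.
have y2 : 2 * nu * y <= ln (e / 2) by rewrite mulrC -ler_pdivlMr.
have a1 : expR (2 * nu * y) <= e / 2.
  by rewrite -[leRHS](@lnK R) ?ler_expR// posrE; lra.
have a2 : expR (2 * y) <= expR (2 * nu * y) by have := nu1; rewrite ler_expR; nra.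
rewrite /wt; lra.
Qed.

Lemma Wt_small (C x e : R) : 0 <= C -> 0 < e -> exists2 y, y <= x & C * (Wt y - 1) <= e.
Proof.
move=> C0 e0; have l0 := lam_gt0.
pose d := Num.min (e / (2 * (C + 1))) 2^-1.
have C1 : 0 < 2 * (C + 1) by lra.
have d0 : 0 < d by rewrite lt_min divr_gt0//=; lra.
have d1 : d <= e / (2 * (C + 1)) by rewrite ge_min lexx.
have d2 : d <= 2^-1 by rewrite ge_min lexx orbT.
have [y yx hy] := wt_small x (divr_gt0 d0 l0).
exists y => //; have := Wt_le y.
have : lam * wt y <= d by rewrite mulrC -ler_pdivlMr.
have := Wt_gt0 y; have W1 := Wt_ge1 y.
move=> W0 h1 h2; rewrite ler_pdivlMr// in d1.
have W2 : Wt y <= 2 by nra.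
nra.
Qed.

Let f0 (D t : R) := L * wt t * D * Wt t.

Let bound1 D t : 0 <= D -> expR (2 * kap * t) * f0 D t <=
  nu * D * expR (2 * kap * t) * (lam * dwt t * Wt t).
Proof.
move=> D0; rewrite /f0 -lamE.
have h := dwt_ge t; have l0 := lam_gt0.
have : 0 <= nu * D * lam * Wt t * expR (2 * kap * t) * (dwt t - 2 * nu * wt t).
  have n0 := nu0; have W0 := Wt_gt0 t; pos.
lra.
Qed.

Let bound2 D t : 0 <= D -> nu * D * (Wt t - 1) <= D / 2 * (lam * dwt t * Wt t).
Proof.
move=> D0; apply: (@le_trans _ _ (nu * D * (lam * wt t * Wt t))).
  by rewrite ler_wpM2l// ?mulr_ge0// ltW.
have h := dwt_ge t; have l0 := lam_gt0.
have : 0 <= D * lam * Wt t * (dwt t - 2 * nu * wt t).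
  have n0 := nu0; have W0 := Wt_gt0 t; pos.
lra.
Qed.

Definition solves (f w u : R -> R) := forall t : R,
  is_derive t 1 w (- 2 * kap * w t + f t) /\ is_derive t 1 u (w t).

Let dh1 D t : is_derive t 1 (fun t => nu * D * expR (2 * kap * t) * (Wt t - 1))
   (nu * D * expR (2 * kap * t) * (lam * dwt t * Wt t) +
    2 * kap * (nu * D * expR (2 * kap * t) * (Wt t - 1))).
Proof. by der; ring. Qed.

Let dh2 D t : is_derive t 1 (fun t => D / 2 * (Wt t - 1)) (D / 2 * (lam * dwt t * Wt t)).
Proof. by der; ring. Qed.

Hypothesis kap0 : 0 < kap.

Let bound1' D (f : R -> R) t : 0 <= D -> `|f t| <= f0 D t ->
  `|expR (2 * kap * t) * f t| <= nu * D * expR (2 * kap * t) * (lam * dwt t * Wt t) +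
    2 * kap * (nu * D * expR (2 * kap * t) * (Wt t - 1)).
Proof.
move=> D0 hf; rewrite normrM (gtr0_norm (expR_gt0 _)).
have : 0 <= 2 * kap * (nu * D * expR (2 * kap * t) * (Wt t - 1)).
  have n0 := nu0; have k0 := kap0; have W1 := Wt_ge1 t; pos.
have := bound1 t D0; have := ler_wpM2l (expR_ge0 (2 * kap * t)) hf.
lra.
Qed.

(** Variation of constants: e^(2 kap t) w is the primitive of e^(2 kap t) f
    from -oo, and u is that of w. *)
Lemma solve_linear (f : R -> R) (D : R) : 0 <= D -> continuous f ->
  (forall t, `|f t| <= L * wt t * D * Wt t) ->
  exists w u, [/\ solves f w u, forall t, `|w t| <= nu * D * (Wt t - 1)
    & forall t, `|u t| <= D / 2 * (Wt t - 1)].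
Proof.
move=> D0 cf hf.
have cf1 : continuous (fun t => expR (2 * kap * t) * f t).
  move=> t; apply: cvgM; last exact: cf.
  apply: is_derive_continuous (_ : is_derive t 1 _ (expR (2 * kap * t) * (2 * kap))).
  by der; ring.
have nD t : 0 <= nu * D * expR (2 * kap * t) * (Wt t - 1).
  have n0 := nu0; have k0 := kap0; have W1 := Wt_ge1 t; pos.
have [W [dW' bW]] := antiderivative_at_minus_infinity cf1 nD (dh1 D)
  (fun t => bound1' D0 (hf t)).
pose w t := expR (- 2 * kap * t) * W t.
have bw t : `|w t| <= nu * D * (Wt t - 1).
  rewrite normrM (gtr0_norm (expR_gt0 _)).
  have := ler_wpM2l (expR_ge0 (- 2 * kap * t)) (bW t).
  have E : expR (- 2 * kap * t) * expR (2 * kap * t) = 1.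
    by rewrite -expRD (_ : _ + _ = 0) ?expR0//; ring.
  move=> /le_trans; apply; rewrite le_eqVlt; apply/orP; left; apply/eqP.
  by ring: E.
have dw (t : R) : is_derive t 1 w (- 2 * kap * w t + f t).
  rewrite /w; der.
  have E : expR (- 2 * kap * t) * expR (2 * kap * t) = 1.
    by rewrite -expRD (_ : _ + _ = 0) ?expR0//; ring.
  ring: E.
have cw : continuous w by move=> t; exact: is_derive_continuous (dw t).
have D20 t : 0 <= D / 2 * (Wt t - 1).
  have W1 := Wt_ge1 t; pos.
have [u [du bu]] := antiderivative_at_minus_infinity cw D20 (dh2 D)
  (fun t => le_trans (bw t) (bound2 t D0)).
by exists w, u; split.
Qed.

(** Any solution vanishing at -oo at the rate of Wt - 1 obeys the bounds of
    the one constructed above. Applied to a difference of two solutions this is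
    the contraction estimate. *)
Lemma solve_linear_bound (f w u : R -> R) (D C : R) : 0 <= D -> 0 <= C ->
  solves f w u -> (forall t, `|f t| <= L * wt t * D * Wt t) ->
  (forall t, `|w t| <= C * (Wt t - 1)) -> (forall t, `|u t| <= C * (Wt t - 1)) ->
  (forall t, `|w t| <= nu * D * (Wt t - 1)) /\ (forall t, `|u t| <= D / 2 * (Wt t - 1)).
Proof.
move=> D0 C0 S hf bw bu.
pose W t := expR (2 * kap * t) * w t.
have dw (t : R) := (S t).1; have du (t : R) := (S t).2.
have dW' (t : R) : is_derive t 1 W (expR (2 * kap * t) * f t) by rewrite /W; der; ring.
have nD t : 0 <= nu * D * expR (2 * kap * t) * (Wt t - 1).
  have n0 := nu0; have k0 := kap0; have W1 := Wt_ge1 t; pos.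
have bW := antiderivative_comparison dW' (dh1 D) (fun t => bound1' D0 (hf t)) nD
  (h2 := fun t => expR (2 * kap * t) * (C * (Wt t - 1))).
have bw' t : `|w t| <= nu * D * (Wt t - 1).
  have : `|W t| <= nu * D * expR (2 * kap * t) * (Wt t - 1).
    apply: bW => [x|x ep ep0].
      by rewrite normrM (gtr0_norm (expR_gt0 _)) ler_wpM2l// expR_ge0.
    have [y yx hy] := Wt_small (Num.min x 0) C0 ep0.
    exists y; first by apply: (le_trans yx); rewrite ge_min lexx.
    have : y <= 0 by apply: (le_trans yx); rewrite ge_min lexx orbT.
    move=> y0; have e1 : expR (2 * kap * y) <= 1.
      by rewrite -expR0 ler_expR mulr_ge0_le0// mulr_ge0// ltW.
    have p : 0 <= C * (Wt y - 1) by have W1 := Wt_ge1 y; pos.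
    by have := expR_ge0 (2 * kap * y); nra.
  rewrite normrM (gtr0_norm (expR_gt0 _)).
  rewrite (_ : nu * D * _ * _ = expR (2 * kap * t) * (nu * D * (Wt t - 1))); last by ring.
  by rewrite ler_pM2l// expR_gt0.
split => // t; apply: (antiderivative_comparison du (dh2 D) _ _ bu) => [x|x|x ep ep0].
- exact: le_trans (bw' x) (bound2 x D0).
- have W1 := Wt_ge1 x; pos.
- exact: Wt_small.
Qed.

Variable N : R -> R -> R.
Hypothesis N0 : forall t, N t 0 = 0.
Hypothesis cN : forall v, continuous v -> continuous (fun t => N t (v t)).
Hypothesis NL : forall t x y, `|N t x - N t y| <= L * wt t * `|x - y|.

(** The equation v'' + 2 kap v' = N t v with limit d at -oo is the fixed point
    problem v = d + u, where u solves the linear problem with right-hand side N t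
    v. *)
Lemma volterra (d : R) : 0 <= d -> exists v w : R -> R,
  [/\ forall t : R, is_derive t 1 v (w t),
      forall t : R, is_derive t 1 w (- 2 * kap * w t + N t (v t)),
      forall t, `|v t - d| <= d * (Wt t - 1) &
      forall t, `|w t| <= 2 * nu * d * (Wt t - 1)].
Proof.
move=> d0; have M0 : 0 <= 2 * d by lra.
pose B := [set v : R -> R | continuous v /\ forall x, `|v x| <= 2 * d * Wt x].
have NB v D t : `|v t| <= D * Wt t -> `|N t (v t)| <= L * wt t * D * Wt t.
  move=> h; have := NL t (v t) 0; rewrite N0 !subr0 => /le_trans; apply.
  by rewrite -[leRHS]mulrA; apply: ler_wpM2l => //; rewrite mulr_ge0// ltW// wt_gt0.
have ex v : exists wu : (R -> R) * (R -> R), B v ->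
    [/\ solves (fun t => N t (v t)) wu.1 wu.2,
     forall t, `|wu.1 t| <= nu * (2 * d) * (Wt t - 1) &
     forall t, `|wu.2 t| <= (2 * d) / 2 * (Wt t - 1)].
  have [[cv bv]|nB] := pselect (B v); last by exists (v, v).
  have [w [u [h1 h2 h3]]] := solve_linear M0 (cN cv) (fun t => NB v _ t (bv t)).
  by exists (w, u).
have [S HS] := choice ex.
pose T v := fun t => d + (S v).2 t.
have [v Bv Tv] : exists2 v, B v & T v = v.
  apply: (weighted_fixed_point (E := Wt)) => //.
  - exact: continuous_Wt.
  - move=> v Bv; have [h1 h2 h3] := HS v Bv; split.
      move=> t; apply: is_derive_continuous (_ : is_derive t 1 _ ((S v).1 t)).
      by have h := (h1 t).2; rewrite /T; der; rewrite add0r.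
    move=> t; rewrite /T; apply: (le_trans (ler_normD _ _)).
    rewrite (ger0_norm d0); have := h3 t; have := Wt_ge1 t; nra.
  - move=> v1 v2 D B1 B2 D0 hD t.
    have [h1 h2 h3] := HS v1 B1; have [k1 k2 k3] := HS v2 B2.
    rewrite /T (_ : _ - _ = (S v1).2 t - (S v2).2 t); last by ring.
    have Wp x : 0 <= Wt x - 1 by rewrite subr_ge0 Wt_ge1.
    have n0 := nu0.
    have nd0 : 0 <= nu * d by apply: mulr_ge0 => //; exact: ltW.
    have C0 : 0 <= 2 * d + 4 * (nu * d) by lra.
    have [||||_ h] := @solve_linear_bound (fun t => N t (v1 t) - N t (v2 t))
      (fun t => (S v1).1 t - (S v2).1 t) (fun t => (S v1).2 t - (S v2).2 t) D
      (2 * d + 4 * (nu * d)) D0 C0.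
    + by move=> x; have [p1 p2] := h1 x; have [q1 q2] := k1 x; split; der; ring.
    + move=> x; apply: (le_trans (NL _ _ _)).
      by rewrite -[leRHS]mulrA; apply: ler_wpM2l => //; rewrite mulr_ge0// ltW// wt_gt0.
    + move=> x; apply: (le_trans (ler_normB _ _)).
      by have := h2 x; have := k2 x; have := Wp x; nra.
    + move=> x; apply: (le_trans (ler_normB _ _)).
      by have := h3 x; have := k3 x; have := Wp x; nra.
    by apply: (le_trans (h t)); rewrite ler_wpM2l ?mulr_ge0 ?invr_ge0//; have := Wt_gt0 t; lra.
have [h1 h2 h3] := HS v Bv.
exists v, (S v).1; split.
- by move=> t; rewrite -{1}Tv /T; have h := (h1 t).2; der; rewrite add0r.
- by move=> t; have [] := h1 t.
- move=> t; have -> : v t - d = (S v).2 t by rewrite -{1}Tv /T; ring.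
  have := h3 t; lra.
- move=> t; have := h2 t; lra.
Qed.

End Volterra.

(** * The functions Gamma, Gamma' and F of the two targets *)

Section Target.
Context {R : realType} (e : sign).
Implicit Types s t x y : R.

Definition dGamma s : R := if e is plus then cos s else cosh s.
Definition FF s : R := sgv R e * (1 - dGamma s).
(** F / Gamma^2, in a form that is regular at 0. *)
Definition QQ s : R := (1 + dGamma s)^-1.

Lemma sgvM : sgv R e * sgv R e = 1.
Proof. by case: e => /=; ring. Qed.

Lemma is_derive_Gamma s : is_derive s 1 (Gamma e) (dGamma s).
Proof.
rewrite /Gamma /dGamma; case: e; first exact: is_derive_sin.
by rewrite /sinh /cosh; der; ring.
Qed.

Lemma is_derive_dGamma s : is_derive s 1 dGamma (- sgv R e * Gamma e s).
Proof.
rewrite /Gamma /dGamma; case: e => /=.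
  by rewrite mulN1r; exact: is_derive_cos.
by rewrite /sinh /cosh; der; ring.
Qed.

Lemma derive1_Gamma s : derive1 (Gamma e) s = dGamma s.
Proof. by rewrite derive1E; apply: derive_val; exact: is_derive_Gamma. Qed.

Lemma Gamma_sqr s : Gamma e s * Gamma e s = sgv R e * (1 - dGamma s ^+ 2).
Proof.
rewrite /Gamma /dGamma; case: e => /=.
  by rewrite mul1r -(cos2Dsin2 s) addrC addKr.
have E : expR s * expR (- s) = 1 by rewrite expRxMexpNx_1.
by rewrite /sinh /cosh; field: E.
Qed.

Lemma Gamma0 : Gamma e (0 : R) = 0.
Proof. by case: e; rewrite /Gamma ?sin0// /sinh oppr0 subrr mul0r. Qed.

Lemma dGamma0 : dGamma 0 = 1.
Proof. by rewrite /dGamma; case: e; rewrite ?cos0// /cosh oppr0 expR0; lra. Qed.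

Lemma GammaN s : Gamma e (- s) = - Gamma e s.
Proof. by case: e; rewrite /Gamma ?sinN// /sinh opprK; lra. Qed.

Lemma is_derive_FF s : is_derive s 1 FF (Gamma e s).
Proof.
have h := is_derive_dGamma s.
rewrite /FF; der; have E := sgvM; ring: E.
Qed.

Lemma dGammaE s : dGamma s = 1 - sgv R e * FF s.
Proof. by rewrite /FF mulrA sgvM; ring. Qed.

Lemma Gamma_sqrF s : Gamma e s * Gamma e s = FF s * (1 + dGamma s).
Proof. by rewrite Gamma_sqr /FF; ring. Qed.

(** Crude bounds, which keep 1 + Gamma' away from 0 and the nonlinear terms
    Lipschitz on [-1, 1]. *)
Lemma dGamma_bounds s : `|s| <= 1 -> 2^-1 <= dGamma s <= 3.
Proof.
move=> s1; rewrite /dGamma; case: e; last first.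
  have E : expR s * expR (- s) = 1 by rewrite expRxMexpNx_1.
  have p1 := expR_gt0 s; have p2 := expR_gt0 (- s).
  have up x : `|x| <= 1 -> expR x <= 4.
    move=> x1; have h := expR_ge1Dx (- (x / 2)).
    have e2 : expR x = expR (x / 2) ^+ 2 by rewrite expr2 -expRD; congr expR; lra.
    have e3 : expR (x / 2) * expR (- (x / 2)) = 1 by rewrite expRxMexpNx_1.
    have p3 := expR_gt0 (x / 2); have p4 := expR_gt0 (- (x / 2)).
    have h2 : 2^-1 <= expR (- (x / 2)) by move: x1; rewrite ler_norml => /andP[]; lra.
    have h3 : expR (x / 2) <= 2 by nra.
    rewrite e2 expr2; nra.
  have u1 := up _ s1; have u2 := up (- s); rewrite normrN in u2.
  rewrite /cosh; apply/andP; split; last first.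
    have := u2 s1; nra.
  nra.
apply/andP; split; last by apply: (le_trans (cos_le1 _)); lra.
wlog s0 : s s1 / 0 <= s.
  have [s0|s0] := leP 0 s => h; first exact: h.
  by rewrite -cosN; apply: h; rewrite ?normrN// oppr_ge0 ltW.
rewrite ger0_norm// in s1.
have dc (x : R) : is_derive x 1 (@cos R) (- sin x) by exact: is_derive_cos.
have ds (x : R) : is_derive x 1 (@sin R) (cos x) by exact: is_derive_sin.
have sx x : 0 <= x -> sin x <= x.
  move=> x0; have := @nondecreasing_deriv R (fun y => y - sin y) (fun y => 1 - cos y) 0 x x0.
  rewrite sin0 subrr subr_ge0; apply => y _; rewrite subr_ge0; exact: cos_le1.
have h : cos 0 + 2^-1 * 0 ^+ 2 <= cos s + 2^-1 * s ^+ 2.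
  apply: (nondecreasing_deriv (f := fun y => cos y + 2^-1 * y ^+ 2) (df := fun y => y - sin y)) => //.
    by move=> y _; der; field.
  by move=> y /andP[y0 _]; rewrite subr_ge0 sx.
rewrite cos0 expr0n /= mulr0 addr0 in h; nra.
Qed.

Lemma dGamma1_gt0 s : `|s| <= 1 -> 0 < 1 + dGamma s.
Proof. by move=> /dGamma_bounds/andP[]; lra. Qed.

Lemma lip_deriv (f df : R -> R) (L x y r : R) : `|x| <= r -> `|y| <= r ->
  (forall s, `|s| <= r -> is_derive s 1 f (df s)) ->
  (forall s, `|s| <= r -> `|df s| <= L) -> `|f x - f y| <= L * `|x - y|.
Proof.
move=> xr yr hd hb; wlog xy : x y xr yr / y <= x.
  by have [h|/ltW h] := leP y x => H; [exact: H|rewrite distrC (distrC x); exact: H].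
rewrite (ger0_norm (_ : 0 <= x - y)) ?subr_ge0//.
have inr s : y <= s <= x -> `|s| <= r.
  move=> /andP[h1 h2]; move: xr yr; rewrite !ler_norml => /andP[? ?] /andP[? ?]; apply/andP; lra.
have i1 : L * y - f y <= L * x - f x.
  apply: (nondecreasing_deriv (f := fun s => L * s - f s) (df := fun s => L - df s)) => // s /inr sr.
    by have h := hd _ sr; der; ring.
  by have := hb _ sr; rewrite ler_norml => /andP[]; lra.
have i2 : L * y + f y <= L * x + f x.
  apply: (nondecreasing_deriv (f := fun s => L * s + f s) (df := fun s => L + df s)) => // s /inr sr.
    by have h := hd _ sr; der; ring.
  by have := hb _ sr; rewrite ler_norml => /andP[]; lra.
rewrite ler_norml; apply/andP; lra.
Qed.

Lemma Gamma_lip x y : `|x| <= 1 -> `|y| <= 1 -> `|Gamma e x - Gamma e y| <= 3 * `|x - y|.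
Proof.
move=> h1 h2; apply: (lip_deriv h1 h2) => s hs; first exact: is_derive_Gamma.
by have /andP[? ?] := dGamma_bounds hs; rewrite ger0_norm//; lra.
Qed.

Lemma Gamma_le s : `|s| <= 1 -> `|Gamma e s| <= 3 * `|s|.
Proof.
by move=> s1; have := @Gamma_lip s 0 s1; rewrite Gamma0 !subr0 normr0; exact.
Qed.

Lemma Gamma_ge s : 0 <= s <= 1 -> s / 2 <= Gamma e s.
Proof.
move=> /andP[s0 s1].
have := @nondecreasing_deriv R (fun y => Gamma e y - y / 2) (fun y => dGamma y - 2^-1) 0 s s0.
rewrite Gamma0 mul0r subrr subr_ge0; apply => y /andP[y0 y1].
  by have h := is_derive_Gamma y; der; ring.
have /andP[h _] : 2^-1 <= dGamma y <= 3.
  by apply: dGamma_bounds; rewrite ger0_norm//; lra.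
by rewrite subr_ge0.
Qed.

Lemma FF_bounds s : `|s| <= 1 -> 0 <= FF s <= 9 * s ^+ 2.
Proof.
move=> s1; have /andP[b1 b2] := dGamma_bounds s1.
have := Gamma_sqrF s; have := Gamma_le s1 => h1 h2.
have h3 : Gamma e s * Gamma e s <= 9 * s ^+ 2.
  have E1 : `|Gamma e s| ^+ 2 = Gamma e s ^+ 2 by rewrite real_normK ?num_real.
  have E2 : `|s| ^+ 2 = s ^+ 2 by rewrite real_normK ?num_real.
  rewrite -expr2 -E1 -E2; have := normr_ge0 (Gamma e s); have := normr_ge0 s; nra.
have h4 : 0 <= Gamma e s * Gamma e s by rewrite -expr2 sqr_ge0.
apply/andP; split; nra.
Qed.

Lemma is_derive_QQ s : `|s| <= 1 -> is_derive s 1 QQ (sgv R e * Gamma e s * QQ s ^+ 2).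
Proof.
move=> s1; have h := is_derive_dGamma s.
have h2 : is_derive s 1 (fun s => 1 + dGamma s) (- sgv R e * Gamma e s) by der; ring.
have n0 : 1 + dGamma s != 0 by rewrite gt_eqF// dGamma1_gt0.
have h3 := dV (f := fun s => 1 + dGamma s) n0 h2.
rewrite /QQ; apply: (is_derive_eq h3) => /=; rewrite exprVn; ring.
Qed.

Lemma QQ_bounds s : `|s| <= 1 -> 0 <= QQ s <= 1.
Proof.
move=> s1; have /andP[b1 b2] := dGamma_bounds s1.
rewrite /QQ invr_ge0 invf_le1 ?dGamma1_gt0//; apply/andP; lra.
Qed.

Section Reaction.
Variables (k b c : R).
Definition kap2 : R := - (k ^+ 2 + b * k) - c ^+ 2 / 4.
(** The profile equation is s'' = sg mu e^(2 tau) Gamma(s) + Gamma(s) g(s),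
    and g(0) = kap2 is the square of the decay rate of its solutions at -oo. *)
Definition gg s : R := - (k ^+ 2 * dGamma s - 2 * k ^+ 2 * FF s + k * b) - c ^+ 2 * QQ s ^+ 2.
(** What remains of Gamma g after its linear part at 0. *)
Definition HH s : R := Gamma e s * gg s - kap2 * s.
(** The cofactor of F in the derivative of HH. *)
Let ww s : R := - sgv R e * gg s + k ^+ 2 * (sgv R e + 2)
   - c ^+ 2 * sgv R e * (QQ s / 2) * (QQ s + 2^-1)
   + (1 + dGamma s) * (k ^+ 2 * (sgv R e + 2) - 2 * c ^+ 2 * sgv R e * QQ s ^+ 3).

Lemma is_derive_gg s : `|s| <= 1 -> is_derive s 1 gg
  (Gamma e s * (k ^+ 2 * (sgv R e + 2) - 2 * c ^+ 2 * sgv R e * QQ s ^+ 3)).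
Proof.
move=> s1; have h1 := is_derive_dGamma s; have h2 := is_derive_FF s; have h3 := is_derive_QQ s1.
by rewrite /gg; der; ring.
Qed.

Lemma is_derive_HH s : `|s| <= 1 -> is_derive s 1 HH (FF s * ww s).
Proof.
move=> s1; have h1 := is_derive_Gamma s; have h2 := is_derive_gg s1.
rewrite /HH; der.
have n0 : 1 + dGamma s != 0 by rewrite gt_eqF// dGamma1_gt0.
have G2 := Gamma_sqr s; rewrite /ww /gg /kap2 /FF /QQ; move: n0 G2; move: (Gamma e s) (dGamma s) => G C n0.
case: e => /= G2; by field: G2.
Qed.

Lemma HH0 : HH 0 = 0.
Proof. by rewrite /HH Gamma0 mul0r mulr0 subrr. Qed.

(** The derivative of HH is a multiple of F, which is quadratic at 0. *)
Lemma HH_lip : exists2 L : R, 0 <= L & forall r x y : R, r <= 1 -> `|x| <= r -> `|y| <= r ->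
  `|HH x - HH y| <= L * r ^+ 2 * `|x - y|.
Proof.
pose bd := @bounded_on R R [set s | `|s| <= 1].
have bdG : bd dGamma.
  by exists 3 => s /dGamma_bounds/andP[? ?]; rewrite ger0_norm//; lra.
have bdQ : bd QQ by exists 1 => s /QQ_bounds/andP[? ?]; rewrite ger0_norm//.
have bdF : bd FF by rewrite /bd /FF; bounded.
have bdg : bd gg.
  by rewrite /bd /gg; bounded.
have [L hL] : bd ww.
  by rewrite /bd /ww; bounded.
have L0 : 0 <= L by apply: (le_trans (normr_ge0 (ww 0))); apply: hL; rewrite /= normr0.
exists (9 * L); first by rewrite mulr_ge0.
move=> r x y r1 xr yr; apply: (lip_deriv xr yr) => s sr.
  by apply: is_derive_HH; exact: le_trans sr r1.
have s1 : `|s| <= 1 by exact: le_trans sr r1.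
have /andP[F0 F1] := FF_bounds s1.
rewrite normrM (ger0_norm F0).
have h : s ^+ 2 <= r ^+ 2.
  by rewrite -[s ^+ 2]real_normK ?num_real//; apply: lerXn2r; rewrite ?nnegrE ?(le_trans (normr_ge0 _) sr).
have := hL _ s1; have := normr_ge0 (ww s); nra.
Qed.
End Reaction.
End Target.

(** * Small solutions of the profile equation *)

Section Clamp.
Context {R : realType}.
Implicit Types r x y : R.
(** The projection of x to [- r, r], jointly continuous in r and x by its
    form. *)
Definition clamp r x : R := (`|x + r| - `|x - r|) / 2.

Lemma clamp_le r x : 0 <= r -> `|clamp r x| <= r.
Proof.
move=> r0; rewrite /clamp ler_norml.
have h1 := ler_dist_dist (x + r) (x - r).
have E : x + r - (x - r) = 2 * r by ring.
have r2 : 0 <= 2 * r by lra.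
rewrite E (ger0_norm r2) in h1.
by move: h1; rewrite ler_norml => /andP[h1 h2]; apply/andP; lra.
Qed.
Lemma clamp_id r x : `|x| <= r -> clamp r x = x.
Proof.
rewrite ler_norml => /andP[h1 h2]; rewrite /clamp ger0_norm; last lra.
by rewrite ler0_norm; lra.
Qed.
Lemma clamp_lip r x y : `|clamp r x - clamp r y| <= `|x - y|.
Proof.
have h1 := ler_dist_dist (x + r) (y + r); have h2 := ler_dist_dist (x - r) (y - r).
have E1 : x + r - (y + r) = x - y by ring.
have E2 : x - r - (y - r) = x - y by ring.
rewrite E1 in h1; rewrite E2 in h2; rewrite /clamp.
move: h1 h2; rewrite !ler_norml => /andP[? ?] /andP[? ?]; apply/andP; lra.
Qed.
Lemma clamp0 r : clamp r 0 = 0.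
Proof. by rewrite /clamp add0r sub0r normrN subrr mul0r. Qed.
Lemma clampN r x : clamp r (- x) = - clamp r x.
Proof.
by rewrite /clamp -normrN opprD opprK -[`|- x - r|]normrN opprB opprK addrC -mulNr opprB addrC (addrC r x).
Qed.
Lemma continuous_clamp (r x : R -> R) : continuous r -> continuous x ->
  continuous (fun t => clamp (r t) (x t)).
Proof.
move=> cr cx t; rewrite /clamp; apply: cvgMl; apply: cvgB; apply: cvg_norm.
  by apply: cvgD; [exact: cx|exact: cr].
by apply: cvgB; [exact: cx|exact: cr].
Qed.
End Clamp.

Lemma sqr_le_norm {R : realType} (x y : R) : `|x| <= y -> x ^+ 2 <= y ^+ 2.
Proof.
move=> xy; rewrite -[leLHS]real_normK ?num_real//.
by apply: lerXn2r; rewrite ?nnegrE// (le_trans _ xy).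
Qed.

(** The friction - X^2 Y^2 has the good sign, and the product of X Y by s is
    bounded by Young's inequality. *)
Lemma work_bound {R : realType} (m X Y G s F C : R) : 0 < m -> 0 < X -> X <= 1 -> 0 <= C ->
  `|G| <= C * `|s| -> s ^+ 2 / 4 <= F ->
  X * X * Y * (G - Y) <= C * (1 + 2 / m) * X * ((X * Y) ^+ 2 / 2 + m * F).
Proof.
move=> m0 p p1 C0 g1 f1.
have n1 : `|s| ^+ 2 = s ^+ 2 by rewrite real_normK ?num_real.
have n2 : `|X * Y| ^+ 2 = (X * Y) ^+ 2 by rewrite real_normK ?num_real.
have s1 : X * X * Y * (G - Y) <= X * (`|X * Y| * (C * `|s|)).
  have q2 : (X * Y) * G <= `|X * Y| * (C * `|s|).
    by apply: (le_trans (ler_norm _)); rewrite normrM; exact: ler_wpM2l.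
  have q1 : 0 <= (X * Y) ^+ 2 by exact: sqr_ge0.
  by have := ler_wpM2l (ltW p) q2; nra.
apply: (le_trans s1); rewrite [leRHS]mulrAC [leRHS]mulrC.
apply: ler_wpM2l; first exact: ltW.
move: n1 n2 f1; set a := `|X * Y|; set y := `|s| => n1 n2 f1.
have ss : a * y <= a ^+ 2 / 2 + y ^+ 2 / 2 by move: (sqr_ge0 (a - y)); nra.
have mi : m * (2 / m) = 2 by rewrite mulrCA mulfV ?mulr1// gt_eqF.
have i0 : 0 <= 2 / m by rewrite divr_ge0// ltW.
have key : a * y <= (1 + 2 / m) * ((X * Y) ^+ 2 / 2 + m * F).
  rewrite -n2; have a2 := sqr_ge0 a; have s2 := sqr_ge0 y.
  have -> : (1 + 2 / m) * (a ^+ 2 / 2 + m * F) = a ^+ 2 / 2 + m * F + (2 / m) * (a ^+ 2 / 2) + m * (2 / m) * F by ring.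
  rewrite mi; have t1 : 0 <= 2 / m * (a ^+ 2 / 2) by rewrite mulr_ge0// divr_ge0.
  have t2 : 0 <= m * F by rewrite mulr_ge0 ?(ltW m0)//; move: f1 s2; rewrite -n1; lra.
  by move: ss t1 t2 f1; rewrite -n1; lra.
by rewrite mulrCA -[leRHS]mulrA; exact: ler_wpM2l.
Qed.

(** Along a trajectory the energy e^(- 2 t) S'^2 / 2 + m F(S) grows only by
    the work of the force V and loses by friction; after the weight e^(- 2 t) this
    work is O(e^(- t)) times the energy, an integrable rate. *)
Lemma restoring_energy {R : realType} (m C : R) (S Sd V Gt F : R -> R) : 0 < m -> 0 <= C ->
  (forall t : R, is_derive t 1 S (Sd t)) ->
  (forall t : R, 0 <= t -> is_derive t 1 Sd (- m * expR (2 * t) * Gt (S t) + V (S t))) ->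
  (forall s, `|V s| <= C * `|s|) ->
  (forall s : R, is_derive s 1 F (Gt s)) -> (forall s, s ^+ 2 / 4 <= F s) ->
  forall t, 0 <= t -> Sd t ^+ 2 * expR (- 2 * t) / 2 + m * F (S t) <=
    (Sd 0 ^+ 2 / 2 + m * F (S 0)) * expR (C * (1 + 2 / m)).
Proof.
move=> m0 C0 dS dSd bV dF bF.
pose A := C * (1 + 2 / m); pose E t := Sd t ^+ 2 * expR (- 2 * t) / 2 + m * F (S t).
have A0 : 0 <= A by rewrite mulr_ge0// addr_ge0// divr_ge0// ltW.
have exp2 (t : R) : expR (- 2 * t) * expR (2 * t) = 1.
  by rewrite -expRD (_ : _ + _ = 0) ?expR0//; ring.
(* The work of - m e^(2 t) Gt cancels, and the weight e^(- 2 t) contributes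
   the friction. *)
have dE (t : R) : 0 <= t -> is_derive t 1 E (expR (- 2 * t) * Sd t * (V (S t) - Sd t)).
  move=> t0; have h1 := dSd t t0; have h2 := is_derive_chain (dF (S t)) (dS t).
  by rewrite /E; der; have E' := exp2 t; field: E'.
have Ebd t : 0 <= t -> expR (- 2 * t) * Sd t * (V (S t) - Sd t) <= A * expR (- t) * E t.
  move=> t0; have e1 : expR (- 2 * t) = expR (- t) * expR (- t) by rewrite -expRD; congr expR; ring.
  have p1 : expR (- t) <= 1 by rewrite -expR0 ler_expR oppr_le0.
  have := work_bound (Sd t) m0 (expR_gt0 (- t)) p1 C0 (bV (S t)) (bF (S t)).
  by rewrite /E e1 => /le_trans; apply; rewrite le_eqVlt; apply/orP; left; apply/eqP; rewrite /A; ring.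
have E0 t : 0 <= E t.
  apply: addr_ge0; first by rewrite divr_ge0// mulr_ge0 ?sqr_ge0 ?expR_ge0.
  apply: mulr_ge0; first exact: ltW.
  by apply: le_trans (bF _); rewrite divr_ge0 ?sqr_ge0.
pose Z t := E t * expR (A * expR (- t)).
move=> t t0; apply: (@le_trans _ _ (Z t)).
  by rewrite -[leLHS]/(E t) /Z ler_peMr// -expR0 ler_expR mulr_ge0// expR_ge0.
have -> : (Sd 0 ^+ 2 / 2 + m * F (S 0)) * expR (C * (1 + 2 / m)) = Z 0.
  by rewrite /Z /E mulr0 oppr0 expR0 !mulr1.
rewrite -lerN2; apply: (nondecreasing_deriv (f := fun t => - Z t)
  (df := fun t => expR (A * expR (- t)) * (A * expR (- t) * E t - expR (- 2 * t) * Sd t * (V (S t) - Sd t)))) => //.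
  by move=> y /andP[y0 _]; have h := dE y y0; rewrite /Z; der; ring.
by move=> y /andP[y0 _]; rewrite mulr_ge0 ?expR_ge0// subr_ge0; exact: Ebd.
Qed.

Section SmallSolution.
Context {R : realType} (e : sign).
Variables (k b c m : R).
Hypothesis m0 : 0 < m.
Hypothesis K0 : 0 < kap2 k b c.
Implicit Types s t x y : R.

Let kap : R := Num.sqrt (kap2 k b c).
Let kap_gt0 : 0 < kap. Proof. by rewrite sqrtr_gt0. Qed.
Let kapE : kap * kap = kap2 k b c.
Proof. by rewrite -expr2 sqr_sqrtr// ltW. Qed.
Notation H := (HH e k b c).

(** A globally Lipschitz function that agrees with Gamma on [-1, 1]. *)
Let Gt s : R := Gamma e (clamp 1 s) + (s - clamp 1 s).

Let Gt_id s : `|s| <= 1 -> Gt s = Gamma e s.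
Proof. by move=> s1; rewrite /Gt clamp_id// subrr addr0. Qed.

Let Gt_lip x y : `|Gt x - Gt y| <= 5 * `|x - y|.
Proof.
have h1 := @Gamma_lip R e (clamp 1 x) (clamp 1 y) (clamp_le _ ler01) (clamp_le _ ler01).
have h2 := clamp_lip 1 x y.
rewrite /Gt (_ : _ - _ = (Gamma e (clamp 1 x) - Gamma e (clamp 1 y)) + ((x - y) - (clamp 1 x - clamp 1 y))); last by ring.
apply: (le_trans (ler_normD _ _)); have := ler_normB (x - y) (clamp 1 x - clamp 1 y); lra.
Qed.

Let Gt0 : Gt 0 = 0. Proof. by rewrite /Gt clamp0 Gamma0 subrr addr0. Qed.
Let GtN s : Gt (- s) = - Gt s.
Proof. by rewrite /Gt clampN GammaN; ring. Qed.

Let continuous_Gamma : continuous (@Gamma R e).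
Proof. by move=> s; apply: is_derive_continuous (is_derive_Gamma e s). Qed.

Let continuous_cst_fun (a : R) : continuous (fun _ : R => a).
Proof. by move=> t; exact: cvg_cst. Qed.
Let continuous_id_fun : continuous (fun x : R => x).
Proof. by move=> t; exact: cvg_id. Qed.

Let continuous_Gt : continuous Gt.
Proof.
have cc : continuous (fun s => clamp 1 s) by exact: continuous_clamp.
move=> s; apply: cvgD.
  by apply: (@continuous_comp _ _ _ (clamp 1) (@Gamma R e)); [exact: cc|exact: continuous_Gamma].
by apply: cvgB; [exact: cvg_id|exact: cc].
Qed.

Let Gt_ge s : 0 <= s -> s / 2 <= Gt s.
Proof.
move=> s0; have [s1|s1] := leP s 1.
  by rewrite Gt_id ?ger0_norm//; apply: Gamma_ge; rewrite s0.
have c1 : clamp 1 s = 1 by rewrite /clamp !ger0_norm; lra.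
by rewrite /Gt c1; have := @Gamma_ge R e 1; rewrite ler01 lexx => /(_ isT); lra.
Qed.

(** On the half line s / 2 <= Gt s <= 5 s, and Gt is odd. *)
Let energy_density : exists2 F : R -> R, (forall s, is_derive s 1 F (Gt s)) &
  forall s, s ^+ 2 / 4 <= F s <= 5 / 2 * s ^+ 2.
Proof.
have [F0 dF0] := antiderivative continuous_Gt.
pose F s := F0 s - F0 0.
have dF s : is_derive s 1 F (Gt s) by rewrite /F; der; ring.
have z : F 0 = 0 by rewrite /F subrr.
have half (G : R -> R) : G 0 = 0 -> (forall s, is_derive s 1 G (Gt s)) ->
    forall s, 0 <= s -> s ^+ 2 / 4 <= G s <= 5 / 2 * s ^+ 2.
  move=> G0 dG s s0.
  have i1 : G 0 - 0 ^+ 2 / 4 <= G s - s ^+ 2 / 4.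
    apply: (nondecreasing_deriv (f := fun s => G s - s ^+ 2 / 4) (df := fun s => Gt s - s / 2)) => //.
      by move=> y _; der; field.
    by move=> y /andP[y0 _]; rewrite subr_ge0 Gt_ge.
  have i2 : 5 / 2 * 0 ^+ 2 - G 0 <= 5 / 2 * s ^+ 2 - G s.
    apply: (nondecreasing_deriv (f := fun s => 5 / 2 * s ^+ 2 - G s) (df := fun s => 5 * s - Gt s)) => //.
      by move=> y _; der; field.
    move=> y /andP[y0 _]; rewrite subr_ge0; have := Gt_lip y 0.
    by rewrite Gt0 !subr0 (ger0_norm y0); apply: le_trans; exact: ler_norm.
  by rewrite G0 expr0n /= in i1 i2; apply/andP; lra.
exists F => // s; have [s0|/ltW s0] := leP 0 s; first exact: half.
have dFm y : is_derive y 1 (fun s => F (- s)) (Gt y).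
  have h1 : is_derive (- y) 1 F (Gt (- y)) by [].
  have h2 : is_derive y 1 (fun s : R => - s) (-1) by der.
  have h := is_derive_chain h1 h2; rewrite GtN mulrN1 opprK in h; exact: h.
have := half (fun s => F (- s)) _ dFm (- s); rewrite oppr0 opprK sqrrN; apply => //.
by rewrite oppr_ge0.
Qed.

(** The minimum of 1 and e^(kap t), a level below which the solution is going
    to stay. *)
Let rho t : R := (1 + expR (kap * t) - `|1 - expR (kap * t)|) / 2.
Let rho_pos t : 0 <= t -> rho t = 1.
Proof.
move=> t0; have h : 1 <= expR (kap * t) by rewrite -expR0 ler_expR mulr_ge0// ltW.
by rewrite /rho ler0_norm; lra.
Qed.
Let rho_neg t : t <= 0 -> rho t = expR (kap * t).
Proof.
move=> t0; have h : expR (kap * t) <= 1 by rewrite -expR0 ler_expR mulr_ge0_le0// ltW.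
by rewrite /rho ger0_norm; lra.
Qed.
Let rho_ge0 t : 0 <= rho t.
Proof.
by have [/rho_pos->|/ltW/rho_neg->] := leP 0 t; rewrite ?ler01 ?expR_ge0.
Qed.
Let rho_le1 t : rho t <= 1.
Proof.
have [/rho_pos->//|/ltW t0] := leP 0 t.
by rewrite rho_neg// -expR0 ler_expR mulr_ge0_le0// ltW.
Qed.

Let continuous_expM (a : R) : continuous (fun t => expR (a * t)).
Proof.
move=> t; apply: is_derive_continuous (_ : is_derive t 1 _ (expR (a * t) * a)).
by der; ring.
Qed.

Let continuous_rho : continuous rho.
Proof.
move=> t; rewrite /rho; apply: cvgMl; apply: cvgB.
  by apply: cvgD; [exact: cvg_cst|exact: continuous_expM].
by apply: cvg_norm; apply: cvgB; [exact: cvg_cst|exact: continuous_expM].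
Qed.

Let nu : R := Num.min 1 kap.
Let nu_gt0 : 0 < nu. Proof. by rewrite lt_min ltr01 kap_gt0. Qed.
Let nu_le1 : nu <= 1. Proof. by rewrite ge_min lexx. Qed.
Let nu_lek : nu <= kap. Proof. by rewrite ge_min lexx orbT. Qed.

Let rho_nu t : rho t ^+ 2 <= expR (2 * nu * t).
Proof.
have [t0|/ltW t0] := leP 0 t.
  by rewrite rho_pos// expr1n -expR0 ler_expR; have n0 := ltW nu_gt0; pos.
rewrite rho_neg// expr2 -expRD ler_expR.
have : (kap - nu) * t <= 0 by rewrite mulr_ge0_le0// subr_ge0.
lra.
Qed.

(** The right-hand side of the equation for v = e^(- kap t) S. Truncating the
    argument of HH at the level rho gives a Lipschitz constant O(e^(2 nu t)),
    which is integrable at -oo. *)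
Let N t v : R := expR (- kap * t) * (- m * expR (2 * t) * Gt (expR (kap * t) * v)
   + H (clamp (rho t) (expR (kap * t) * v))).

Let expK t : expR (- kap * t) * expR (kap * t) = 1.
Proof. by rewrite -expRD mulNr addNr expR0. Qed.

Let continuous_HH (f : R -> R) : continuous f -> (forall t, `|f t| <= 1) ->
  continuous (fun t => H (f t)).
Proof.
move=> cf f1 t; apply: (@continuous_comp _ _ _ f H); first exact: cf.
have h := @is_derive_HH R e k b c _ (f1 t); exact: is_derive_continuous h.
Qed.

Let continuous_N v : continuous v -> continuous (fun t => N t (v t)).
Proof.
move=> cv.
have cs : continuous (fun t => expR (kap * t) * v t).
  by move=> t; apply: cvgM; [exact: continuous_expM|exact: cv].
move=> t; apply: cvgM; first exact: continuous_expM.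
apply: cvgD.
  apply: cvgM; first by apply: cvgMr; exact: continuous_expM.
  by apply: (@continuous_comp _ _ _ (fun t => expR (kap * t) * v t) Gt); [exact: cs|exact: continuous_Gt].
apply: (continuous_HH (continuous_clamp continuous_rho cs)) => u.
exact: le_trans (clamp_le _ (rho_ge0 _)) (rho_le1 _).
Qed.

Let N0 t : N t 0 = 0.
Proof. by rewrite /N mulr0 Gt0 clamp0 HH0 mulr0 addr0 mulr0. Qed.

(** For t <= 0 the solution of the truncated equation is of size d e^(kap t),
    below the truncation levels. For t >= 0 the term - m e^(2 t) Gamma(S) is a
    restoring force and [restoring_energy] keeps the energy O(d^2). Hence |S| <= 1
    once d is small, and the truncations are inactive. *)
Lemma small_solution : exists S Sd : R -> R, exists d : R,
  [/\ 0 < d, forall t, is_derive t 1 S (Sd t) /\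
    is_derive t 1 Sd (- m * expR (2 * t) * Gamma e (S t) + Gamma e (S t) * gg e k b c (S t)),
    forall t, `|S t| <= 1 &
    [/\ exists C, forall t, `|S t| <= C * expR (kap * t),
      forall T, exists C, forall t, t <= T -> `|Sd t| <= C * expR (kap * t),
      (fun t => expR (- kap * t) * S t) @ -oo --> d &
      (fun t => expR (- kap * t) * Sd t) @ -oo --> kap * d]].
Proof.
have [L1 L10 HL] := HH_lip e k b c.
pose L := 5 * m + L1 + 1.
have L0 : 0 < L by rewrite /L; have := m0; lra.
have NL t x y : `|N t x - N t y| <= L * wt nu t * `|x - y|.
  set X := expR (kap * t) * x; set Y := expR (kap * t) * y.
  have XY : `|X - Y| = expR (kap * t) * `|x - y|.
    by rewrite /X /Y -mulrBr normrM gtr0_norm// expR_gt0.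
  have h1 := Gt_lip X Y.
  have h2 := HL _ _ _ (rho_le1 t) (clamp_le X (rho_ge0 t)) (clamp_le Y (rho_ge0 t)).
  have h3 := clamp_lip (rho t) X Y.
  rewrite /N -/X -/Y (_ : _ - _ = expR (- kap * t) * ((- m * expR (2 * t)) * (Gt X - Gt Y)
    + (H (clamp (rho t) X) - H (clamp (rho t) Y)))); last by ring.
  rewrite normrM (gtr0_norm (expR_gt0 _)).
  have E0 := expR_gt0 (2 * t); have E1 := expR_gt0 (- kap * t).
  have h4 : `|(- m * expR (2 * t)) * (Gt X - Gt Y) + (H (clamp (rho t) X) - H (clamp (rho t) Y))|
     <= (5 * m * expR (2 * t) + L1 * rho t ^+ 2) * `|X - Y|.
    apply: (le_trans (ler_normD _ _)); rewrite [leRHS]mulrDl; apply: lerD.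
      rewrite normrM mulNr normrN (gtr0_norm (mulr_gt0 m0 E0)).
      have : m * expR (2 * t) * `|Gt X - Gt Y| <= m * expR (2 * t) * (5 * `|X - Y|).
        by apply: ler_wpM2l => //; rewrite mulr_ge0// ltW.
      by move/le_trans; apply; rewrite le_eqVlt; apply/orP; left; apply/eqP; ring.
    by apply: (le_trans h2); apply: ler_wpM2l => //; rewrite mulr_ge0// sqr_ge0.
  have h5 := ler_wpM2l (ltW E1) h4; apply: (le_trans h5).
  rewrite XY.
  have -> : expR (- kap * t) * ((5 * m * expR (2 * t) + L1 * rho t ^+ 2) * (expR (kap * t) * `|x - y|))
    = (5 * m * expR (2 * t) + L1 * rho t ^+ 2) * `|x - y|.
    by have E := expK t; ring: E.
  apply: ler_wpM2r => //; rewrite /L /wt.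
  have h6 := rho_nu t; have := expR_gt0 (2 * nu * t); have := m0.
  have : L1 * rho t ^+ 2 <= L1 * expR (2 * nu * t) by apply: ler_wpM2l.
  move=> a1 a2 a3.
  have : 0 <= m * expR (2 * nu * t) by rewrite mulr_ge0// ltW.
  have : 0 <= L1 * expR (2 * t) by rewrite mulr_ge0// ltW.
  lra.
pose W := Wt nu L.
have W1 t : 1 <= W t by exact: Wt_ge1.
have volt := volterra nu_gt0 nu_le1 L0 kap_gt0 N0 continuous_N NL.
have [F dF bF] := energy_density.
(* C1 bounds the forces other than the restoring one and d^2 K the energy at
   time 0. The last condition on d turns the bound d^2 K e^A on the energy into
   S^2 <= 1. *)
pose C1 := kap ^+ 2 + L1.
have C10 : 0 <= C1 by rewrite addr_ge0// sqr_ge0.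
pose A := C1 * (1 + 2 / m).
pose K := ((kap + 2 * nu) * W 0) ^+ 2 / 2 + m * (5 / 2 * W 0 ^+ 2).
have W00 : 0 < W 0 by have := W1 0; lra.
have K_gt0 : 0 < K.
  rewrite /K addr_gt0//; last by rewrite !mulr_gt0// ?exprn_gt0// invr_gt0.
  by rewrite divr_gt0// exprn_gt0// mulr_gt0// addr_gt0// mulr_gt0.
pose Q := 4 / m * K * expR A.
have Q0 : 0 < Q by rewrite /Q !mulr_gt0// ?invr_gt0// expR_gt0.
pose d := Num.min (W 0)^-1 (Num.min 1 Q^-1).
have d0 : 0 < d by rewrite !lt_min !invr_gt0 W00 ltr01 Q0.
have dW : d * W 0 <= 1 by rewrite -ler_pdivlMr// div1r ge_min lexx.
have d1 : d <= 1 by rewrite !ge_min lexx orbT.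
have dQ : d * Q <= 1 by rewrite -ler_pdivlMr// div1r !ge_min lexx !orbT.
have dQ2 : d ^+ 2 * Q <= 1.
  rewrite expr2 -mulrA; have := mulr_ge0 (ltW d0) (ltW Q0); nra.
have [v [w [dv dw bv bw]]] := volt d (ltW d0).
rewrite -/W in bv bw.
pose S t := expR (kap * t) * v t.
pose Sd t := expR (kap * t) * (kap * v t + w t).
have dS t : is_derive t 1 S (Sd t) by rewrite /S /Sd; der; ring.
have dSd0 t : is_derive t 1 Sd (kap ^+ 2 * S t - m * expR (2 * t) * Gt (S t) + H (clamp (rho t) (S t))).
  rewrite /Sd /S; der; rewrite /N; have E := expK t; ring: E.
have Wmono t : t <= 0 -> W t <= W 0.
  move=> t0; rewrite /W /Wt ler_expR ler_wpM2l//; first by rewrite ltW// lam_gt0.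
  by rewrite /wt; apply: lerD; rewrite ler_expR mulr0 mulr_ge0_le0// mulr_ge0// ltW.
have bv0 t : t <= 0 -> `|v t| <= d * W 0.
  move=> t0; have := bv t; have := Wmono t t0; have := ler_normD (v t - d) d.
  rewrite subrK (ger0_norm (ltW d0)); move: d0; nra.
have bw0 t : t <= 0 -> `|w t| <= 2 * nu * d * W 0.
  move=> t0; apply: (le_trans (bw t)); apply: ler_wpM2l; first by rewrite !mulr_ge0// ltW.
  have := Wmono t t0; rewrite -/W; lra.
have S_neg t : t <= 0 -> `|S t| <= d * W 0 * expR (kap * t).
  move=> t0; rewrite /S normrM (gtr0_norm (expR_gt0 _)) mulrC ler_pM2r ?expR_gt0//; exact: bv0.
have Sd_neg t : t <= 0 -> `|Sd t| <= (kap + 2 * nu) * d * W 0 * expR (kap * t).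
  move=> t0; rewrite /Sd normrM (gtr0_norm (expR_gt0 _)) mulrC ler_pM2r ?expR_gt0//.
  apply: (le_trans (ler_normD _ _)); rewrite normrM (gtr0_norm kap_gt0).
  have := bv0 t t0; have := bw0 t t0; have := kap_gt0; nra.
pose G1 s := kap ^+ 2 * s + H (clamp 1 s).
have bG1 s : `|G1 s| <= C1 * `|s|.
  apply: (le_trans (ler_normD _ _)); rewrite normrM (ger0_norm (sqr_ge0 _)) /C1 mulrDl lerD2l.
  have := HL 1 (clamp 1 s) 0 (lexx _) (clamp_le _ ler01); rewrite normr0 ler01 => /(_ isT).
  rewrite HH0 !subr0 expr1n mulr1 => /le_trans; apply; apply: ler_wpM2l => //.
  by have := clamp_lip 1 s 0; rewrite clamp0 !subr0.
have dSd_pos t : 0 <= t -> is_derive t 1 Sd (- m * expR (2 * t) * Gt (S t) + G1 (S t)).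
  by move=> t0; have h := dSd0 t; apply: (is_derive_eq h); rewrite /G1 rho_pos//; ring.
pose E t := Sd t ^+ 2 * expR (- 2 * t) / 2 + m * F (S t).
have kin t : 0 <= Sd t ^+ 2 * expR (- 2 * t) / 2.
  by rewrite divr_ge0// mulr_ge0 ?sqr_ge0 ?expR_ge0.
have mF0 t : 0 <= m * F (S t).
  have /andP[h _] := bF (S t); apply: mulr_ge0; first exact: ltW.
  by apply: le_trans h; rewrite divr_ge0 ?sqr_ge0.
have E0bd : E 0 <= d ^+ 2 * K.
  have h1 := S_neg 0 (lexx _); have h2 := Sd_neg 0 (lexx _).
  rewrite mulr0 expR0 !mulr1 in h1 h2.
  have q1 : S 0 ^+ 2 <= (d * W 0) ^+ 2.
    exact: sqr_le_norm.
  have q2 : Sd 0 ^+ 2 <= ((kap + 2 * nu) * d * W 0) ^+ 2.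
    exact: sqr_le_norm.
  have /andP[_ q3] := bF (S 0).
  rewrite /E mulr0 expR0 mulr1 /K.
  have := ler_wpM2l (ltW m0) q3; have := ler_wpM2l (ltW m0) q1; move: q2; lra.
have Ebound t : 0 <= t -> E t <= d ^+ 2 * K * expR A.
  move=> t0; have bF1 s : s ^+ 2 / 4 <= F s by have /andP[] := bF s.
  apply: (le_trans (restoring_energy m0 C10 dS dSd_pos bG1 dF bF1 t0)).
  apply: ler_wpM2r; first exact: expR_ge0.
  by move: E0bd; rewrite /E mulr0 expR0 mulr1.
have S_le1 t : `|S t| <= 1.
  have [t0|/ltW t0] := leP 0 t; last first.
    apply: (le_trans (S_neg t t0)).
    have : expR (kap * t) <= 1 by rewrite -expR0 ler_expR mulr_ge0_le0// ltW.
    have := expR_gt0 (kap * t); have := mulr_gt0 d0 W00; move: dW; nra.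
  have h1 := Ebound t t0; have /andP[h2 _] := bF (S t).
  have h3 : m * F (S t) <= E t.
    by rewrite /E lerDr.
  have h4 : S t ^+ 2 <= d ^+ 2 * Q.
    rewrite /Q; have mi : m * m^-1 = 1 by rewrite mulfV// gt_eqF.
    have i0 : 0 < m^-1 by rewrite invr_gt0.
    have : F (S t) <= m^-1 * (d ^+ 2 * K * expR A).
      have : m^-1 * (m * F (S t)) <= m^-1 * (d ^+ 2 * K * expR A).
        by apply: ler_wpM2l; [exact: ltW|exact: le_trans h3 h1].
      by rewrite mulrA (mulrC _ m) mi mul1r.
    by move: h2; lra.
  by rewrite -(@ler_pXn2r _ 2)// ?nnegrE// expr1n real_normK ?num_real//; move: h4 dQ2; lra.
have clid t : clamp (rho t) (S t) = S t.
  apply: clamp_id; have [t0|/ltW t0] := leP 0 t; first by rewrite rho_pos.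
  rewrite rho_neg//; apply: (le_trans (S_neg t t0)); rewrite ler_piMl ?expR_ge0//.
have dSd t : is_derive t 1 Sd (- m * expR (2 * t) * Gamma e (S t) + Gamma e (S t) * gg e k b c (S t)).
  by have h := dSd0 t; apply: (is_derive_eq h); rewrite clid Gt_id// /HH -kapE; ring.
have Wlim (C : R) : 0 <= C -> forall g : R -> R, (forall t, `|g t| <= C * (W t - 1)) -> g @ -oo --> 0.
  move=> C0 g hg; apply/cvgrPdist_le => ep ep0.
  have [y y0 hy] := Wt_small nu_gt0 nu_le1 L0 0 C0 ep0.
  exists y; split; first exact: num_real.
  move=> t ty; rewrite sub0r normrN; apply: (le_trans (hg t)); apply: (le_trans _ hy).
  apply: ler_wpM2l => //; rewrite lerD2r /Wt ler_expR ler_wpM2l//; first by rewrite ltW// lam_gt0.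
  by apply: lerD; rewrite ler_expR ler_wpM2l// ?mulr_ge0// ltW.
exists S, Sd, d; split => //; split.
- exists 1 => t; rewrite mul1r; have [t0|/ltW t0] := leP 0 t.
    by apply: (le_trans (S_le1 t)); rewrite -expR0 ler_expR mulr_ge0// ltW.
  by apply: (le_trans (S_neg t t0)); rewrite ler_piMl ?expR_ge0.
- move=> T.
  pose M := d ^+ 2 * K * expR A.
  have M0 : 0 <= M by rewrite !mulr_ge0// ?sqr_ge0// ?expR_ge0// ltW.
  exists ((kap + 2 * nu) * d * W 0 + (2 * M + 1) * expR `|T|) => t tT.
  have p1 : 0 <= (kap + 2 * nu) * d * W 0 by have := ltW nu_gt0; have := ltW kap_gt0 => *; pos.
  have p2 : 0 <= (2 * M + 1) * expR `|T| by rewrite mulr_ge0 ?expR_ge0//; move: M0; lra.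
  have pe := expR_gt0 (kap * t).
  have [t0|/ltW t0] := leP 0 t; last first.
    by apply: (le_trans (Sd_neg t t0)); rewrite ler_pM2r// lerDl.
  have e1 : 1 <= expR (kap * t) by rewrite -expR0 ler_expR mulr_ge0// ltW.
  have h1 : (expR (- t) * `|Sd t|) ^+ 2 <= 2 * M.
    have := Ebound t t0; rewrite -/M /E.
    have -> : (expR (- t) * `|Sd t|) ^+ 2 = Sd t ^+ 2 * expR (- 2 * t).
      rewrite exprMn real_normK ?num_real// mulrC; congr (_ * _).
        by rewrite (expr2 (expR (- t))) -expRD; congr expR; ring.
    by have := mF0 t; lra.
  have h2 : expR (- t) * `|Sd t| <= 2 * M + 1.
    have := mulr_ge0 (expR_ge0 (- t)) (normr_ge0 (Sd t)); move: h1 M0; nra.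
  have h3 : `|Sd t| <= (2 * M + 1) * expR t.
    have E1 : expR (- t) * expR t = 1 by rewrite -expRD addNr expR0.
    rewrite -(@ler_pM2l _ (expR (- t)))// ?expR_gt0// mulrCA E1 mulr1//.
  have h4 : expR t <= expR `|T| by rewrite ler_expR; apply: (le_trans tT); exact: ler_norm.
  apply: (le_trans h3); apply: (@le_trans _ _ ((2 * M + 1) * expR `|T|)).
    by apply: ler_wpM2l => //; move: M0; lra.
  by move: p1 p2 e1; nra.
- have -> : (fun t => expR (- kap * t) * S t) = (fun t => (v t - d) + d).
    by apply/funext => t; rewrite /S; have E1 := expK t; ring: E1.
  rewrite -[X in _ --> X]add0r; apply: cvgD; last exact: cvg_cst.
  by apply: (Wlim d (ltW d0)); exact: bv.
- have -> : (fun t => expR (- kap * t) * Sd t) = (fun t => (kap * (v t - d) + w t) + kap * d).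
    by apply/funext => t; rewrite /Sd; have E1 := expK t; ring: E1.
  rewrite -[X in _ --> X]add0r; apply: cvgD; last exact: cvg_cst.
  apply: (Wlim (kap * d + 2 * nu * d)); first by rewrite addr_ge0// !mulr_ge0// ltW.
  move=> t; apply: (le_trans (ler_normD _ _)); rewrite normrM (gtr0_norm kap_gt0).
  have := bv t; have := bw t; have := kap_gt0; rewrite -/W; nra.
Qed.
End SmallSolution.

(** * Regularity at the vertex of the cones *)

(** If f(a) = G_0(ln a), the j-th derivative of f is a^(- j) G_j(ln a) with
    G_(j+1) = G_j' - j G_j. When all the G_j are O(e^(kap t)) at -oo, it is
    O(a^(kap - j)), and f is of class C^kap at 0 as a^kap is. *)
Section EulerDerivatives.
Context {R : realType}.
Implicit Types (a t : R) (j : nat).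
Variable G : nat -> R -> R.
Hypothesis dG : forall j t, is_derive t 1 (G j) (G j.+1 t + j%:R * G j t).

Let gr j a : R := G j (ln a) * (a ^+ j)^-1.

Let dgr j a : 0 < a -> is_derive a 1 (gr j) (gr j.+1 a).
Proof.
move=> a0; have an : a != 0 by rewrite gt_eqF.
have h1 : is_derive a 1 (@ln R) a^-1 by exact: is_derive1_ln.
have h2 := is_derive_chain (dG j (ln a)) h1.
case: j h2 => [|j] h2.
  have -> : gr 0 = fun a => G 0 (ln a).
    by apply/funext => x; rewrite /gr expr0 invr1 mulr1.
  by apply: (is_derive_eq h2); rewrite /gr expr1 mul0r addr0.
have h3 : is_derive a 1 (fun a : R => a ^+ j.+1) (j.+1%:R * a ^+ j * 1) by der.
have nz : a ^+ j.+1 != 0 by rewrite expf_neq0.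
have h4 := dV (f := fun a => a ^+ j.+1) nz h3.
have h5 := dM h2 h4; apply: (is_derive_eq h5) => /=.
rewrite /gr !exprS; have nz2 : a ^+ j != 0 by rewrite expf_neq0.
by field; rewrite an nz2.
Qed.

Variable f : R -> R.
Hypothesis fG : forall a, 0 < a -> f a = G 0 (ln a).

Let derive1n_gr j a : 0 < a -> derive1n j f a = gr j a.
Proof.
elim: j a => [|j IH] a a0.
  by rewrite derive1n0 fG// /gr expr0 invr1 mulr1.
rewrite derive1nS derive1E; apply: derive_val.
apply: (near_eq_is_derive (f := gr j)); last exact: dgr.
near=> x; rewrite IH//; near: x; exact: near_gt.
Unshelve. all: by end_near. Qed.

Lemma smooth_pos_euler : smooth_pos f.
Proof.
move=> j a a0; apply: (near_eq_derivable (f := gr j)).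
  by near=> x; rewrite derive1n_gr//; near: x; exact: near_gt.
by have [] := dgr j a0.
Unshelve. all: by end_near. Qed.

Variable kap : R.
Hypothesis kap0 : 0 < kap.
Hypothesis f0 : f 0 = 0.
Hypothesis bG : forall j T, bounded_on [set t | t <= T] (fun t => expR (- kap * t) * G j t).
Hypothesis lG : forall j, exists l : R, (fun t => expR (- kap * t) * G j.+1 t) @ -oo --> l.

Let m := Num.truncn kap.
Let m_le : m%:R <= kap. Proof. by rewrite truncn_le// ltW. Qed.
Let m_gt : kap < m.+1%:R. Proof. exact: truncnS_gt. Qed.

Let powV a j : 0 < a -> (a ^+ j)^-1 = expR (- (j%:R * ln a)).
Proof. by move=> a0; rewrite expRN expRM_natl lnK// posrE. Qed.

Let bgr j A : 0 < A -> exists2 C, 0 <= C & forall a, 0 < a <= A ->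
  `|gr j a| <= C * expR ((kap - j%:R) * ln a).
Proof.
move=> A0; have [C C0 hC] := bounded_ge0 (bG j (ln A)).
exists C => // a /andP[a0 aA]; have := hC (ln a); rewrite /= ler_ln ?posrE// => /(_ aA) h.
have E : gr j a = expR (- kap * ln a) * G j (ln a) * expR ((kap - j%:R) * ln a).
  have e : expR (- kap * ln a) * expR ((kap - j%:R) * ln a) = expR (- (j%:R * ln a)).
    by rewrite -expRD; congr expR; ring.
  by rewrite /gr powV// -e; ring.
by rewrite E normrM (gtr0_norm (expR_gt0 _)); apply: ler_wpM2r => //; exact: expR_ge0.
Qed.

Let expln_cvg0 (q : R) : 0 < q -> (fun a => expR (q * ln a)) @ (0:R)^'+ --> (0 : R).
Proof.
move=> q0; apply/cvgrPdist_lt => ep ep0.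
have d0 : 0 < expR (ln ep / q) by exact: expR_gt0.
near=> a.
have a0 : 0 < a by near: a; exact: nbhs_right_gt.
have ad : a < expR (ln ep / q) by near: a; exact: nbhs_right_lt.
rewrite sub0r normrN gtr0_norm ?expR_gt0// -[ltRHS](lnK (x := ep)) ?posrE// ltr_expR.
rewrite mulrC -ltr_pdivlMr// -[ltRHS]expRK ltr_ln// posrE//.
Unshelve. all: by end_near. Qed.

(** The limit of the j-th derivative at 0 vanishes for j < kap. For j = kap,
    which occurs when kap is an integer, it is the limit of e^(- kap t) G_j. *)
Let ext j : exists l : R, (j <= m)%N ->
  gr j @ (0:R)^'+ --> l /\ (j%:R < kap -> l = 0).
Proof.
have [mj|jm] := ltnP m j; first by exists 0.
have jk : j%:R <= kap by apply: (le_trans _ m_le); rewrite ler_nat.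
rewrite le_eqVlt in jk; have [/eqP jk'|jk'] := orP jk.
  case: j jm jk jk' => [|j] jm jk jk'; first by move: kap0; rewrite -jk' ltxx.
  have [l hl] := lG j; exists l => _; split; last by rewrite jk' ltxx.
  have E : forall a, 0 < a -> gr j.+1 a = (fun t => expR (- kap * t) * G j.+1 t) (ln a).
    move=> a a0; rewrite /gr mulrC; congr (_ * _).
    by rewrite powV// jk'; congr expR; ring.
  have lnN : @ln R @ (0:R)^'+ --> -oo.
    apply/cvgrNyPlt => A; near=> a.
    have a0 : 0 < a by near: a; exact: nbhs_right_gt.
    rewrite -[ltRHS]expRK ltr_ln ?posrE ?expR_gt0//.
    by near: a; apply: nbhs_right_lt; exact: expR_gt0.
  have h := cvg_comp _ _ lnN hl.
  apply: cvg_trans h; apply: near_eq_cvg; near=> a.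
  have a0 : 0 < a by near: a; exact: nbhs_right_gt.
  by rewrite /= -E.
exists 0 => _; split=> //; have [C C0 hC] := bgr j ltr01.
have q0 : 0 < kap - j%:R by rewrite subr_gt0.
have lim : (fun a => C * expR ((kap - j%:R) * ln a)) @ (0:R)^'+ --> (0 : R).
  by rewrite -[X in _ --> X](mulr0 C); apply: cvgMr; exact: expln_cvg0.
apply/cvgrPdist_lt => ep ep0.
move/cvgrPdist_lt : lim => /(_ _ ep0) lim.
near=> a; rewrite sub0r normrN; apply: (@le_lt_trans _ _ (C * expR ((kap - j%:R) * ln a))).
  apply: hC; apply/andP; split; first by near: a; exact: nbhs_right_gt.
  by near: a; exact: nbhs_right_le.
have : `|0 - C * expR ((kap - j%:R) * ln a)| < ep by near: a.
by rewrite sub0r normrN ger0_norm// mulr_ge0// expR_ge0.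
Unshelve. all: by end_near. Qed.

Lemma locally_Ckappa_euler : locally_Ckappa kap f.
Proof.
have [l hl0] := choice ext.
have hl j : (j <= m)%N -> gr j @ (0:R)^'+ --> l j by move=> /hl0[].
have l00 : l 0%N = 0 by have [_] := hl0 0%N (leq0n _); apply.
pose g j a := if a <= 0 then l j else gr j a.
have gE j a : 0 < a -> g j a = gr j a by move=> a0; rewrite /g leNgt a0.
have near_g j a : 0 < a -> \forall x \near a, gr j x = g j x.
  by move=> a0; near=> x; rewrite gE//; near: x; exact: near_gt.
have dg j a : 0 < a -> is_derive a 1 (g j) (g j.+1 a).
  move=> a0; apply: (near_eq_is_derive (near_g j a a0)); rewrite gE//; exact: dgr.
exists g; split.
- move=> a; rewrite le_eqVlt => /predU1P[<-|a0]; first by rewrite /g lexx l00 f0.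
  by rewrite gE// /gr expr0 invr1 mulr1 fG.
- by move=> j a _ a0; exact: dg.
- move=> j jm; apply/continuous_within_itvcyP; split.
    move=> a /[!in_itv]/= /andP[a0 _]; exact: is_derive_continuous (dg j a a0).
  rewrite /g lexx; apply: cvg_trans (hl j jm); apply: near_eq_cvg; near=> a.
  by apply/esym; apply: gE; near: a; exact: nbhs_right_gt.
- rewrite -/m => A.
  have [A0|A0] := leP A 0.
    exists 0 => a a' /andP[a0 aA] /andP[a'0 a'A].
    have -> : a = 0 by apply/eqP; rewrite eq_le a0 (le_trans aA).
    have -> : a' = 0 by apply/eqP; rewrite eq_le a'0 (le_trans a'A).
    by rewrite subrr normr0 mul0r.
  have [C C0 hC] := bgr m A0.
  have [C' C'0 hC'] := bgr m.+1 A0.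
  (* If kap is an integer, only a bound is required. *)
  have [th|th] := leP (kap - m%:R) 0.
    have th0 : kap - m%:R = 0 by apply/eqP; rewrite eq_le th subr_ge0.
    have bd a : 0 <= a <= A -> `|g m a| <= C + `|l m|.
      move=> /andP[]; rewrite le_eqVlt => /predU1P[<- _|a0 aA]; first by rewrite /g lexx lerDr.
      rewrite gE//; have := hC a; rewrite a0 aA th0 mul0r expR0 mulr1 => /(_ isT) h.
      by apply: (le_trans h); rewrite lerDl.
    exists (2 * (C + `|l m|)) => a a' ha ha'; rewrite th0 powRr0 mulr1.
    by apply: (le_trans (ler_normB _ _)); have := bd a ha; have := bd a' ha'; lra.
  have lm0 : l m = 0 by have [_] := hl0 m (leqnn _); apply; rewrite -subr_gt0.
  set q := kap - m%:R in th hC *.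
  have q1 : q < 1 by rewrite /q; move: m_gt; rewrite -natr1; lra.
  have powE x : 0 < x -> x `^ q = expR (q * ln x) by move=> x0; rewrite /powR gt_eqF.
  have powdiv x : 0 < x -> x `^ q * x^-1 = expR ((q - 1) * ln x).
    move=> x0; rewrite powE// -{2}(lnK (x := x)) ?posrE// -expRN -expRD.
    by congr expR; ring.
  have powdec x y : 0 < x -> x <= y -> y `^ q * y^-1 <= x `^ q * x^-1.
    move=> x0 xy; have y0 : 0 < y by lra.
    rewrite !powdiv// ler_expR ler_wnM2l//; first by lra.
    by rewrite ler_ln ?posrE.
  have powmon x y : 0 < x -> x <= y -> x `^ q <= y `^ q.
    by move=> x0 xy; rewrite ge0_ler_powR// ?nnegrE; lra.
  have bd a : 0 < a <= A -> `|g m a| <= C * a `^ q.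
    by move=> h; have /andP[a0 _] := h; rewrite powE// gE//; exact: hC.
  have bd' a : 0 < a <= A -> `|g m.+1 a| <= C' * (a `^ q * a^-1).
    move=> h; have /andP[a0 _] := h; rewrite gE//; apply: (le_trans (hC' _ h)).
    rewrite powdiv// le_eqVlt; apply/orP; left; apply/eqP.
    by congr (_ * expR _); rewrite /q -natr1; ring.
  (* A function O(a^q) with derivative O(a^(q - 1)) is Hoelder of exponent q:
     if a <= h both values are O(h^q), and otherwise the mean value theorem
     bounds the increment by a^(q - 1) h <= h^q. *)
  have main a a' : 0 <= a -> a < a' -> a' <= A -> `|g m a' - g m a| <= (3 * C + C') * (a' - a) `^ q.
    move=> a0 aa' a'A; pose h := a' - a; have h0 : 0 < h by rewrite subr_gt0.
    have p2 : (2 * h) `^ q <= 2 * h `^ q.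
      rewrite powRM; [|lra|exact: ltW]; apply: ler_wpM2r; first exact: powR_ge0.
      by rewrite -[leRHS]powRr1; [apply: ler_powR; lra|lra].
    have p0 : 0 <= h `^ q by exact: powR_ge0.
    have [ah|ha] := leP a h.
      have b1 : `|g m a'| <= C * (2 * h) `^ q.
        apply: (le_trans (bd a' _)); first by rewrite a'A andbT; move: ah; rewrite /h; lra.
        apply: ler_wpM2l => //; apply: powmon; move: ah; rewrite /h; lra.
      have b2 : `|g m a| <= C * h `^ q.
        move: a0; rewrite le_eqVlt => /predU1P[<-|a0].
          by rewrite /g lexx lm0 normr0 mulr_ge0.
        apply: (le_trans (bd a _)); first by rewrite a0; lra.
        by apply: ler_wpM2l => //; exact: powmon.
      apply: (le_trans (ler_normB _ _)).
      have := ler_wpM2l C0 p2; have := mulr_ge0 C'0 p0; rewrite -/h; lra.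
    have a0' : 0 < a by lra.
    have aq : a `^ q * a^-1 * h <= h `^ q.
      apply: (@le_trans _ _ (h `^ q * h^-1 * h)).
        by apply: ler_wpM2r; [exact: ltW|apply: powdec => //; exact: ltW].
      by rewrite divfK// gt_eqF.
    have [x /[!in_itv]/= /andP[ax xa'] E] : exists2 x, x \in `]a, a'[ & g m a' - g m a = g m.+1 x * (a' - a).
      apply: (MVT aa') => [x /[!in_itv]/= /andP[ax _]|]; first by apply: dg; lra.
      apply: derivable_within_continuous => x /[!in_itv]/= /andP[ax _].
      by have [] := dg m x (lt_le_trans a0' ax).
    rewrite E normrM (gtr0_norm h0) -/h.
    have b1 : `|g m.+1 x| <= C' * (a `^ q * a^-1).
      have x0 : 0 < x by lra.
      apply: (le_trans (bd' x _)); first by rewrite x0; lra.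
      apply: ler_wpM2l => //.
      by apply: powdec => //; exact: ltW.
    apply: (le_trans (ler_wpM2r (ltW h0) b1)); have := ler_wpM2l C'0 aq.
    have := mulr_ge0 C0 p0; lra.
  exists (3 * C + C') => a a' /andP[a0 aA] /andP[a'0 a'A].
  have [aa'|aa'|->] := ltgtP a a'.
  + rewrite distrC; have -> : `|a - a'| = a' - a by rewrite distrC gtr0_norm ?subr_gt0.
    exact: main.
  + have -> : `|a - a'| = a - a' by rewrite gtr0_norm ?subr_gt0.
    exact: main.
  + by rewrite !subrr normr0 mulr_ge0 ?powR_ge0//; lra.
Unshelve. all: by end_near. Qed.
End EulerDerivatives.

Section DifferentialAlgebra.
Context {R : realType} (e : sign).
Variables (mu k b c sg : R) (S Sd : R -> R).
Implicit Types (f g : R -> R) (t : R).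

(** The algebra generated by the functions occurring in the profile equation,
    and the ideal of those that vanish with S and S'. Both are stable under d/dt,
    which controls all derivatives of a profile without computing them. *)
Inductive alg : (R -> R) -> Prop :=
| alg_cst a : alg (fun _ => a)
| alg_exp : alg (fun t => expR (2 * t))
| alg_S : alg S
| alg_Sd : alg Sd
| alg_Gamma : alg (fun t => Gamma e (S t))
| alg_dGamma : alg (fun t => dGamma e (S t))
| alg_QQ : alg (fun t => QQ e (S t))
| alg_add f g : alg f -> alg g -> alg (fun t => f t + g t)
| alg_mul f g : alg f -> alg g -> alg (fun t => f t * g t).

Inductive idl : (R -> R) -> Prop :=
| idl_S : idl S
| idl_Sd : idl Sd
| idl_Gamma : idl (fun t => Gamma e (S t))
| idl_add f g : idl f -> idl g -> idl (fun t => f t + g t)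
| idl_mul f g : alg f -> idl g -> idl (fun t => f t * g t).

Hypothesis dS : forall t, is_derive t 1 S (Sd t).
Hypothesis dSd : forall t, is_derive t 1 Sd
  (sg * mu * expR (2 * t) * Gamma e (S t) + Gamma e (S t) * gg e k b c (S t)).
Hypothesis S1 : forall t, `|S t| <= 1.

Lemma alg_opp f : alg f -> alg (fun t => - f t).
Proof.
move=> h; have := alg_mul (alg_cst (-1)) h; congr alg.
by apply/funext => t; rewrite mulN1r.
Qed.
Lemma alg_exprn f n : alg f -> alg (fun t => f t ^+ n).
Proof.
move=> h; elim: n => [|n IH].
  by have -> : (fun t => f t ^+ 0) = (fun=> 1); [apply/funext => t; rewrite expr0|exact: alg_cst].
have -> : (fun t => f t ^+ n.+1) = (fun t => f t * f t ^+ n) by apply/funext => t; rewrite exprS.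
exact: alg_mul.
Qed.

Ltac algt := repeat first [ assumption | notypeclasses refine (alg_cst _)
  | exact alg_exp | exact alg_S | exact alg_Sd | exact alg_Gamma | exact alg_dGamma | exact alg_QQ
  | notypeclasses refine (alg_add _ _) | notypeclasses refine (alg_opp _)
  | notypeclasses refine (alg_mul _ _) | notypeclasses refine (alg_exprn _ _) ].

Lemma alg_FF : alg (fun t => FF e (S t)).
Proof. rewrite /FF; algt. Qed.
Lemma alg_gg : alg (fun t => gg e k b c (S t)).
Proof. have h := alg_FF; rewrite /gg; algt. Qed.

Let dGammaS t : is_derive t 1 (fun t => Gamma e (S t)) (dGamma e (S t) * Sd t).
Proof. exact: is_derive_chain (is_derive_Gamma e (S t)) (dS t). Qed.
Let ddGammaS t : is_derive t 1 (fun t => dGamma e (S t)) (- sgv R e * Gamma e (S t) * Sd t).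
Proof. exact: is_derive_chain (is_derive_dGamma e (S t)) (dS t). Qed.
Let dQQS t : is_derive t 1 (fun t => QQ e (S t)) (sgv R e * Gamma e (S t) * QQ e (S t) ^+ 2 * Sd t).
Proof. exact: is_derive_chain (is_derive_QQ e (S1 t)) (dS t). Qed.

Lemma alg_deriv f : alg f -> exists2 g, alg g & forall t, is_derive t 1 f (g t).
Proof.
elim => [a|||||||f1 f2 a1 [g1 h1 d1] a2 [g2 h2 d2]|f1 f2 a1 [g1 h1 d1] a2 [g2 h2 d2]].
- by exists (fun=> 0) => [|t]; [algt|exact: dC].
- by exists (fun t => 2 * expR (2 * t)) => [|t]; [algt|der; ring].
- by exists Sd; [algt|].
- by exists (fun t => sg * mu * expR (2 * t) * Gamma e (S t) + Gamma e (S t) * gg e k b c (S t));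
    [have h := alg_gg; algt|].
- by exists (fun t => dGamma e (S t) * Sd t); [algt|].
- by exists (fun t => - sgv R e * Gamma e (S t) * Sd t); [algt|].
- by exists (fun t => sgv R e * Gamma e (S t) * QQ e (S t) ^+ 2 * Sd t); [algt|].
- by exists (fun t => g1 t + g2 t) => [|t]; [algt|exact: dD].
- by exists (fun t => f1 t * g2 t + f2 t * g1 t) => [|t]; [algt|exact: dM].
Qed.

Lemma idl_deriv f : idl f -> exists2 g, idl g & forall t, is_derive t 1 f (g t).
Proof.
elim => [|||f1 f2 a1 [g1 h1 d1] a2 [g2 h2 d2]|f1 f2 a1 a2 [g2 h2 d2]].
- by exists Sd; [exact: idl_Sd|].
- exists (fun t => (sg * mu * expR (2 * t) + gg e k b c (S t)) * Gamma e (S t)).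
    by apply: idl_mul idl_Gamma; have h := alg_gg; algt.
  by move=> t; apply: (is_derive_eq (dSd t)); ring.
- by exists (fun t => dGamma e (S t) * Sd t); [apply: idl_mul idl_Sd; algt|].
- by exists (fun t => g1 t + g2 t) => [|t]; [exact: idl_add|exact: dD].
- have [g1 h1 d1] := alg_deriv a1.
  exists (fun t => f1 t * g2 t + g1 t * f2 t) => [|t].
    by apply: idl_add; exact: idl_mul.
  by apply: (is_derive_eq (dM (d1 t) (d2 t))); rewrite (mulrC (f2 t)).
Qed.

Lemma idl_alg f : idl f -> alg f.
Proof. by elim=> *; algt. Qed.

Section Growth.
Variable kap : R.
Hypothesis kap0 : 0 < kap.
Let tame f := (forall T, bounded_on [set t | t <= T] f) /\ exists l : R, f @ -oo --> l.
Hypothesis tame_S : tame (fun t => expR (- kap * t) * S t).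
Hypothesis tame_Sd : tame (fun t => expR (- kap * t) * Sd t).

Let tameM f g : tame f -> tame g -> tame (fun t => f t * g t).
Proof.
move=> [b1 [l1 c1]] [b2 [l2 c2]]; split; first by move=> T; exact: bounded_mul.
by exists (l1 * l2); exact: cvgM.
Qed.
Let tameD f g : tame f -> tame g -> tame (fun t => f t + g t).
Proof.
move=> [b1 [l1 c1]] [b2 [l2 c2]]; split; first by move=> T; exact: bounded_add.
by exists (l1 + l2); exact: cvgD.
Qed.
Let tameC a : tame (fun=> a).
Proof. by split; [move=> T; exact: bounded_cst|exists a; exact: cvg_cst]. Qed.

Let exp_lim q : 0 < q -> (fun t => expR (q * t)) @ -oo --> (0 : R).
Proof.
move=> q0; apply/cvgrPdist_lt => ep ep0.
exists (ln ep / q); split; first exact: num_real.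
move=> t ty; rewrite sub0r normrN gtr0_norm ?expR_gt0//.
by rewrite -[ltRHS](lnK (x := ep)) ?posrE// ltr_expR mulrC -ltr_pdivlMr.
Qed.

Let tame_exp q : 0 < q -> tame (fun t => expR (q * t)).
Proof.
move=> q0; split; last by exists 0; exact: exp_lim.
move=> T; exists (expR (q * T)) => t /= tT.
by rewrite gtr0_norm ?expR_gt0// ler_expR ler_wpM2l// ltW.
Qed.

Let tame_cut f : tame (fun t => expR (- kap * t) * f t) -> tame f.
Proof.
move=> h; have := tameM (tame_exp kap0) h; congr tame; apply/funext => t.
by rewrite mulrA -expRD mulNr addrN expR0 mul1r.
Qed.

Let S_lim0 : S @ -oo --> (0 : R).
Proof.
have [_ [l hl]] := tame_S.
have -> : S = (fun t => expR (kap * t) * (expR (- kap * t) * S t)).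
  by apply/funext => t; rewrite mulrA -expRD mulNr addrN expR0 mul1r.
by rewrite -[X in _ --> X](mul0r l); apply: cvgM => //; exact: exp_lim.
Qed.

Let tame_comp (F dF : R -> R) (C : R) : (forall s : R, `|s| <= 1 -> is_derive s 1 F (dF s)) ->
  (forall s : R, `|s| <= 1 -> `|F s| <= C) -> tame (fun t => F (S t)).
Proof.
move=> hd hb; split; first by move=> T; exists C => t _; exact: hb.
have n0 : `|0 : R| <= 1 by rewrite normr0.
have cF : {for 0, continuous F} by exact: is_derive_continuous (hd 0 n0).
exists (F 0); exact: (cvg_comp _ _ S_lim0 cF).
Qed.

Let dGamma_le (s : R) : `|s| <= 1 -> `|dGamma e s| <= 3.
Proof. by move=> /(dGamma_bounds e)/andP[? ?]; rewrite ger0_norm//; lra. Qed.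

Lemma tame_alg f : alg f -> tame f.
Proof.
elim => [a|||||||f1 f2 a1 h1 a2 h2|f1 f2 a1 h1 a2 h2].
- exact: tameC.
- by apply: tame_exp.
- exact: tame_cut.
- exact: tame_cut.
- apply: (tame_comp (F := @Gamma R e) (C := 3) (dF := dGamma e)) => s s1; first exact: is_derive_Gamma.
  by apply: (le_trans (Gamma_le e s1)); lra.
- by apply: (tame_comp (F := dGamma e) (C := 3)) => s s1; [exact: is_derive_dGamma|exact: dGamma_le].
- apply: (tame_comp (F := QQ e) (C := 1)) => s s1; first exact: is_derive_QQ.
  by have /andP[? ?] := QQ_bounds e s1; rewrite ger0_norm.
- exact: tameD.
- exact: tameM.
Qed.

(** Gamma(s) / s tends to 1 at 0, and S tends to 0. *)
Let tame_Gamma : tame (fun t => expR (- kap * t) * Gamma e (S t)).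
Proof.
pose q s := if s == 0 then 1 else Gamma e s / s : R.
have E s : Gamma e s = q s * s.
  by rewrite /q; case: eqP => [->|/eqP h]; rewrite ?Gamma0 ?mulr0// divfK.
have -> : (fun t => expR (- kap * t) * Gamma e (S t)) = (fun t => q (S t) * (expR (- kap * t) * S t)).
  by apply/funext => t; rewrite E mulrCA.
apply: tameM => //; split.
  move=> T; exists 3 => t _; rewrite /q; case: eqP => [_|/eqP h]; first by rewrite normr1; lra.
  rewrite normrM normfV ler_pdivrMr ?normr_gt0//; exact: Gamma_le.
exists 1; apply: (cvg_comp _ _ S_lim0).
apply/cvgrPdist_lt => ep ep0.
near=> s.
have s1 : `|s| <= 1 by near: s; apply: (cvgr0_norm_le (fun s => s)) => //; exact: cvg_id.
rewrite /q; case: eqP => [_|/eqP h]; first by rewrite subrr normr0.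
have hG : `|Gamma e s - s| <= 9 * s ^+ 2 * `|s|.
  have := @lip_deriv R (fun s => Gamma e s - s) (fun s => dGamma e s - 1) (9 * s ^+ 2) s 0 `|s|.
  rewrite Gamma0 !subr0; apply => //; first by rewrite normr0.
    by move=> x _; have hx := is_derive_Gamma e x; der; ring.
  move=> x xs; have x1 : `|x| <= 1 by exact: le_trans s1.
  have /andP[F0 F1] := FF_bounds e x1.
  rewrite dGammaE addrC addKr normrN normrM (ger0_norm F0).
  have -> : `|sgv R e| = 1 by case: e; rewrite /= ?normrN normr1.
  rewrite mul1r; apply: (le_trans F1); apply: ler_wpM2l => //.
  by rewrite -[x ^+ 2]real_normK ?num_real// -[s ^+ 2]real_normK ?num_real//; apply: lerXn2r.
have -> : 1 - Gamma e s / s = - ((Gamma e s - s) / s) by rewrite mulrBl divff//; ring.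
rewrite normrN normrM normfV.
apply: (@le_lt_trans _ _ (9 * s ^+ 2)); first by rewrite ler_pdivrMr ?normr_gt0.
have hs : `|s| < ep / 9 by near: s; apply: (cvgr0_norm_lt (fun s => s)); [exact: cvg_id|rewrite divr_gt0].
rewrite -[s ^+ 2]real_normK ?num_real//; have := normr_ge0 s; nra.
Unshelve. all: by end_near. Qed.

Lemma tame_idl f : idl f -> tame (fun t => expR (- kap * t) * f t).
Proof.
elim => [|||f1 f2 a1 h1 a2 h2|f1 f2 a1 a2 h2] //.
- have -> : (fun t => expR (- kap * t) * (f1 t + f2 t)) =
    (fun t => expR (- kap * t) * f1 t + expR (- kap * t) * f2 t) by apply/funext => t; rewrite mulrDr.
  exact: tameD.
- have -> : (fun t => expR (- kap * t) * (f1 t * f2 t)) =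
    (fun t => f1 t * (expR (- kap * t) * f2 t)) by apply/funext => t; rewrite mulrCA.
  by apply: tameM => //; exact: tame_alg.
Qed.

End Growth.

(** Iterates g |-> g' - j g inside a class P stable under differentiation. *)
Lemma euler_sequence (P : (R -> R) -> Prop) (f0 g0 : R -> R) :
  (forall f, P f -> exists2 g, P g & forall t, is_derive t 1 f (g t)) ->
  (forall f g j, P f -> P g -> P (fun t => f t - j%:R * g t)) ->
  P g0 -> (forall t, is_derive t 1 f0 (g0 t)) ->
  exists G : nat -> R -> R, [/\ G 0%N = f0, forall j, P (G j.+1) &
    forall j t, is_derive t 1 (G j) (G j.+1 t + j%:R * G j t)].
Proof.
move=> hP hL P0 d0.
have ex f : exists g, P f -> P g /\ forall t, is_derive t 1 f (g t).
  by have [/hP[g p d]|n] := pselect (P f); [exists g|exists f].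
have [D HD] := choice ex.
pose G := nat_rect (fun _ => R -> R) g0 (fun j g => (fun t => D g t - j.+1%:R * g t)).
have PG j : P (G j) by elim: j => //= j IH; apply: hL => //; exact: (HD _ IH).1.
exists (fun j => if j is j'.+1 then G j' else f0); split=> // -[|j] t.
  by apply: (is_derive_eq (d0 t)); rewrite mul0r addr0.
by apply: (is_derive_eq ((HD _ (PG j)).2 t)) => /=; rewrite subrK.
Qed.

End DifferentialAlgebra.

(** * Profiles *)

Section Profiles.
Context {R : realType} (e : sign).
Variables (mu k b c : R).
Implicit Types (t : R).
Hypothesis K0 : 0 < kap2 k b c.
Notation kap := (Num.sqrt (kap2 k b c)).

(** The radial data of the ansatz in the cones where x^2 - y^2 has sign sg, as
    functions of t = ln a: S is the polar distance s, Sd its derivative, B is beta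
    + (c / 2) t and Ph is phi - c alpha - b t. *)
Record profile (sg : R) (S Sd B Ph : R -> R) : Prop := Profile {
  profile_S : forall t, is_derive t 1 S (Sd t);
  profile_Sd : forall t, is_derive t 1 Sd
    (sg * mu * expR (2 * t) * Gamma e (S t) + Gamma e (S t) * gg e k b c (S t));
  profile_le1 : forall t, `|S t| <= 1;
  profile_B : forall t, is_derive t 1 B (- (c * sgv R e / 2) * (FF e (S t) * QQ e (S t)));
  profile_Ph : forall t, is_derive t 1 Ph (- 2 * k * FF e (S t));
  profile_S_bound : exists C, forall t, `|S t| <= C * expR (kap * t);
  profile_Sd_bound : forall T, exists C, forall t, t <= T -> `|Sd t| <= C * expR (kap * t);
  profile_B_bound : exists C, forall t, `|B t| <= C * expR (kap * t);
  profile_Ph_bound : exists C, forall t, `|Ph t| <= C * expR (kap * t);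
  profile_S_lim : exists l : R, (fun t => expR (- kap * t) * S t) @ -oo --> l;
  profile_Sd_lim : exists l : R, (fun t => expR (- kap * t) * Sd t) @ -oo --> l }.

Lemma kap_gt0 : 0 < kap. Proof. by rewrite sqrtr_gt0. Qed.

(** Serves in the cones with sg * mu > 0, where the force is repulsive. *)
Lemma profile_zero sg : profile sg (fun=> 0) (fun=> 0) (fun=> 0) (fun=> 0).
Proof.
have F0 : FF e (0 : R) = 0 by rewrite /FF dGamma0 subrr mulr0.
split.
- by move=> t; exact: dC.
- by move=> t; rewrite Gamma0 mulr0 mul0r addr0; exact: dC.
- by move=> t; rewrite normr0.
- by move=> t; rewrite F0 mul0r mulr0; exact: dC.
- by move=> t; rewrite F0 mulr0; exact: dC.
- by exists 0 => t; rewrite normr0 mul0r.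
- by move=> T; exists 0 => t _; rewrite normr0 mul0r.
- by exists 0 => t; rewrite normr0 mul0r.
- by exists 0 => t; rewrite normr0 mul0r.
- by exists 0; under eq_fun do rewrite mulr0; exact: cvg_cst.
- by exists 0; under eq_fun do rewrite mulr0; exact: cvg_cst.
Qed.

Lemma profile_small sg : sg * mu < 0 -> exists S Sd B Ph, profile sg S Sd B Ph /\
  exists T, forall t, t <= T -> S t != 0.
Proof.
move=> sgmu; have m0 : 0 < - (sg * mu) by rewrite oppr_gt0.
have [S [Sd [d [d0 dd S1 [[C hC] bSd lS lSd]]]]] := small_solution e m0 K0.
have k0 := kap_gt0.
have dS t := (dd t).1; have dSd t := (dd t).2.
have C0 : 0 <= C by have := le_trans (normr_ge0 (S 0)) (hC 0); rewrite mulr0 expR0 mulr1.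
have FC t : 0 <= FF e (S t) <= 9 * C * expR (kap * t).
  have /andP[F0 F1] := FF_bounds e (S1 t); rewrite F0 /=; apply: (le_trans F1).
  have := hC t; have := S1 t; rewrite -[S t ^+ 2]real_normK ?num_real//; have := normr_ge0 (S t); nra.
have dexpk t : is_derive t 1 (fun t => expR (kap * t)) (expR (kap * t) * kap) by der; ring.
have anti (f : R -> R) (D : R) : continuous f -> 0 <= D -> (forall t, `|f t| <= D * expR (kap * t)) ->
    exists F : R -> R, (forall t, is_derive t 1 F (f t)) /\ exists C, forall t, `|F t| <= C * expR (kap * t).
  move=> cf D0 hD.
  have dh t : is_derive t 1 (fun t => D / kap * expR (kap * t)) (D * expR (kap * t)).
    have h := dexpk t; der; field; by rewrite gt_eqF.
  have h0 t : 0 <= D / kap * expR (kap * t) by rewrite mulr_ge0 ?expR_ge0// divr_ge0// ltW.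
  have [F [dF bF]] := antiderivative_at_minus_infinity cf h0 dh hD.
  by exists F; split => //; exists (D / kap).
have cFS : continuous (fun t => FF e (S t)).
  by move=> t; exact: is_derive_continuous (is_derive_chain (is_derive_FF e (S t)) (dS t)).
have cQS : continuous (fun t => QQ e (S t)).
  by move=> t; exact: is_derive_continuous (is_derive_chain (is_derive_QQ e (S1 t)) (dS t)).
have [B [dB bB]] : exists F : R -> R, (forall t, is_derive t 1 F (- (c * sgv R e / 2) * (FF e (S t) * QQ e (S t)))) /\ exists C, forall t, `|F t| <= C * expR (kap * t).
  apply: (anti _ (`|c / 2| * (9 * C))).
  - by move=> t; apply: cvgMr; apply: cvgM; [exact: cFS|exact: cQS].
  - by rewrite !mulr_ge0.
  - move=> t; have /andP[F0 F1] := FC t; have /andP[Q0 Q1] := QQ_bounds e (S1 t).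
    rewrite normrM normrN mulrAC normrM.
    have -> : `|sgv R e| = 1 by case: e; rewrite /= ?normrN normr1.
    rewrite mulr1 -[leRHS]mulrA; apply: ler_wpM2l => //.
    by rewrite normrM !ger0_norm//; nra.
have [Ph [dPh bPh]] : exists F : R -> R, (forall t, is_derive t 1 F (- 2 * k * FF e (S t))) /\ exists C, forall t, `|F t| <= C * expR (kap * t).
  apply: (anti _ (`|2 * k| * (9 * C))).
  - by move=> t; apply: cvgMr; exact: cFS.
  - by rewrite !mulr_ge0.
  - move=> t; have /andP[F0 F1] := FC t.
    rewrite (_ : - 2 * k * FF e (S t) = - (2 * k * FF e (S t))); last by ring.
    by rewrite normrN normrM -[leRHS]mulrA; apply: ler_wpM2l => //; rewrite ger0_norm.
exists S, Sd, B, Ph; split.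
  split => //.
  - by move=> t; apply: (is_derive_eq (dSd t)); rewrite opprK.
  - by exists C.
  - by exists d.
  - by exists (kap * d).
move/cvgrPdist_lt : lS => /(_ _ d0) [T [_ hT]].
exists (T - 1) => t tT; have /hT : t < T by lra.
by apply: contraTneq => ->; rewrite mulr0 subr0 ltr_norml ltxx andbF.
Qed.

Section Regularity.
Variables (sg : R) (S Sd B Ph : R -> R).
Hypothesis P : profile sg S Sd B Ph.

(** A function of ln a as a function of a; the value 0 at a = 0 is the limit
    of the functions to which this is applied. *)
Definition radial (f : R -> R) (a : R) : R := if a <= 0 then 0 else f (ln a).

Let radialE f (a : R) : 0 < a -> radial f a = f (ln a).
Proof. by move=> a0; rewrite /radial leNgt a0. Qed.

Let tame_of (f : R -> R) : (forall T, exists C, forall t, t <= T -> `|f t| <= C * expR (kap * t)) ->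
  (exists l : R, (fun t => expR (- kap * t) * f t) @ -oo --> l) ->
  (forall T, bounded_on [set t | t <= T] (fun t => expR (- kap * t) * f t)) /\
  exists l : R, (fun t => expR (- kap * t) * f t) @ -oo --> l.
Proof.
move=> hb hl; split=> // T; have [C hC] := hb T; exists C => t tT.
rewrite normrM (gtr0_norm (expR_gt0 _)); have := ler_wpM2l (expR_ge0 (- kap * t)) (hC t tT).
by rewrite mulrCA -expRD mulNr addNr expR0 mulr1.
Qed.

Let idl_Ckappa (f0 g0 : R -> R) : idl e S Sd g0 -> (forall t, is_derive t 1 f0 (g0 t)) ->
  (forall T, exists C, forall t, t <= T -> `|f0 t| <= C * expR (kap * t)) ->
  smooth_pos (radial f0) /\ locally_Ckappa kap (radial f0).
Proof.
move=> ig d0 hb.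
have [|G [G0 PG dG]] := euler_sequence (idl_deriv (profile_S P) (profile_Sd P) (profile_le1 P)) _ ig d0.
  move=> f g j hf hg; have := idl_add hf (idl_mul (alg_cst e S Sd (- j%:R)) hg).
  by congr idl; apply/funext => t; rewrite mulNr.
have tS := tame_of (fun T => let: ex_intro C h := profile_S_bound P in ex_intro _ C (fun t _ => h t)) (profile_S_lim P).
have tSd := tame_of (profile_Sd_bound P) (profile_Sd_lim P).
have tG j := tame_idl (profile_le1 P) kap_gt0 tS tSd (PG j).
have fG a : 0 < a -> radial f0 a = G 0%N (ln a) by move=> a0; rewrite radialE// G0.
split; first exact: (smooth_pos_euler dG fG).
apply: (locally_Ckappa_euler dG fG kap_gt0).
- by rewrite /radial lexx.
- move=> [|j] T; last exact: (tG j).1.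
  have [C hC] := hb T; exists C => t tT; rewrite G0.
  rewrite normrM (gtr0_norm (expR_gt0 _)); have := ler_wpM2l (expR_ge0 (- kap * t)) (hC t tT).
  by rewrite mulrCA -expRD mulNr addNr expR0 mulr1.
- by move=> j; exact: (tG j).2.
Qed.

Let alg_smooth (f0 g0 f : R -> R) : alg e S Sd g0 -> (forall t, is_derive t 1 f0 (g0 t)) ->
  (forall a, 0 < a -> f a = f0 (ln a)) -> smooth_pos f.
Proof.
move=> ig d0 fE.
have [|G [G0 PG dG]] := euler_sequence (alg_deriv (profile_S P) (profile_Sd P) (profile_le1 P)) _ ig d0.
  move=> f1 g j hf hg; have := alg_add hf (alg_mul (alg_cst e S Sd (- j%:R)) hg).
  by congr alg; apply/funext => t; rewrite mulNr.
by apply: (smooth_pos_euler dG) => a a0; rewrite fE// G0.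
Qed.

Let dB_idl : idl e S Sd (fun t => - (c * sgv R e / 2) * (FF e (S t) * QQ e (S t))).
Proof.
have -> : (fun t => - (c * sgv R e / 2) * (FF e (S t) * QQ e (S t))) =
  (fun t => (- (c * sgv R e / 2) * (Gamma e (S t) * (QQ e (S t) * QQ e (S t)))) * Gamma e (S t)).
  apply/funext => t; have n0 := dGamma1_gt0 e (profile_le1 P t).
  have E := Gamma_sqrF e (S t); rewrite /QQ; move: n0 E; move: (Gamma e (S t)) (dGamma e (S t)) (FF e (S t)) => G C F n0 E.
  rewrite -[RHS]mulrA; congr (_ * _); rewrite mulrAC E; field; by rewrite gt_eqF.
apply: idl_mul; last exact: idl_Gamma.
apply: alg_mul; first exact: alg_cst.
apply: alg_mul; first exact: alg_Gamma.
by apply: alg_mul; exact: alg_QQ.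
Qed.

Lemma profile_regular_s : smooth_pos (radial S) /\ locally_Ckappa kap (radial S).
Proof.
apply: (idl_Ckappa (idl_Sd _ _ _) (profile_S P)) => T.
by have [C hC] := profile_S_bound P; exists C.
Qed.

Definition phase (a : R) : R := radial B a - c / 2 * ln a.

Lemma profile_regular_beta : smooth_pos phase /\ locally_Ckappa_mod_log kap c phase.
Proof.
split.
  apply: (@alg_smooth (fun t => B t - c / 2 * t) (fun t => - (c * sgv R e / 2) * (FF e (S t) * QQ e (S t)) - c / 2)).
  - apply: alg_add; last exact: alg_cst.
    exact: idl_alg dB_idl.
  - by move=> t; have h := profile_B P t; der; ring.
  - by move=> a a0; rewrite /phase radialE.
exists (radial B); last by [].
apply: (idl_Ckappa dB_idl (profile_B P) _).2 => T.
by have [C hC] := profile_B_bound P; exists C.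
Qed.
End Regularity.
End Profiles.

(** * Measure-preserving maps *)

Section LebesgueInvariance.
Context {R : realType}.
Notation leb := (@lebesgue_measure R).
Notation mR := (measurableTypeR R).

Lemma measurable_shift (a : R) : measurable_fun [set: mR] (fun y : mR => (y + a : mR)).
Proof. exact: measurable_funD. Qed.

Lemma lebesgue_shift (a : R) (A : set mR) : measurable A ->
  leb ((fun y : mR => (y + a : mR)) @^-1` A) = leb A.
Proof.
move=> mA; have mf := measurable_shift a.
have h := @lebesgue_measure_unique R (pushforward leb (fun y : mR => (y + a : mR))).
rewrite [RHS]h// => X [[x y] _ <-] /=.
transitivity (leb `]x - a, y - a]%classic); last first.
  congr (leb _); apply/seteqP; split => r /=; by rewrite !in_itv/= ltrBlDr lerBrDr.
by rewrite !lebesgue_measure_itv/= !lte_fin ltrD2r -!EFinB; case: ifP => // _; congr EFin; ring.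
Qed.

Lemma lebesgue_reflect (a : R) (A : set mR) : measurable A ->
  leb ((fun y : mR => (a - y : mR)) @^-1` A) = leb A.
Proof.
move=> mA; have mf : measurable_fun [set: mR] (fun y : mR => (a - y : mR)) by exact: measurable_funB.
have h := @lebesgue_measure_unique R (pushforward leb (fun y : mR => (a - y : mR))).
rewrite [RHS]h// => X [[x y] _ <-] /=.
transitivity (leb `[a - y, a - x[%classic); last first.
  by congr (leb _); apply/seteqP; split => r /=; rewrite !in_itv/= => /andP[? ?]; apply/andP; split; lra.
rewrite !lebesgue_measure_itv/= !lte_fin -!EFinB.
have -> : (a - y < a - x) = (x < y) by rewrite ltrD2l ltrN2.
by case: ifP => // _; congr EFin; ring.
Qed.
End LebesgueInvariance.

Section MeasurePreserving.
Context {R : realType} {d} {X : measurableType d}.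
Variable m : {measure set X -> \bar R}.

Definition preserves (T : X -> X) :=
  measurable_fun setT T /\ forall A, measurable A -> m (T @^-1` A) = m A.

Lemma preserves_comp T U : preserves T -> preserves U -> preserves (T \o U).
Proof.
move=> [mT pT] [mU pU]; split; first exact: measurableT_comp.
move=> A mA; rewrite comp_preimage pU ?pT//.
by rewrite -[X in measurable X]setTI; exact: mT.
Qed.

Section Integral.
Variables (T : X -> X) (f : X -> \bar R).
Hypothesis pT : preserves T.
Hypothesis mf : measurable_fun setT f.
Let mT : measurable_fun setT T := pT.1.

Let E A : measurable A -> A `<=` setT -> m A = pushforward m T A.
Proof. by move=> mA _; rewrite /pushforward pT.2. Qed.

Lemma preserves_ge0_integral : (forall p, 0 <= f p)%E -> (\int[m]_p f p = \int[m]_p f (T p))%E.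
Proof.
move=> f0; rewrite (eq_measure_integral (pushforward m T))//.
by rewrite ge0_integral_pushforward// preimage_setT.
Qed.

Lemma preserves_integrable : m.-integrable setT (f \o T) -> m.-integrable setT f.
Proof.
move=> intf; have := @integrable_pushforward _ _ _ _ R T mT m setT f mf.
rewrite preimage_setT => /(_ intf measurableT) /integrableP[_ h].
by apply/integrableP; split => //; rewrite (eq_measure_integral (pushforward m T)).
Qed.

Lemma preserves_integral : m.-integrable setT (f \o T) -> (\int[m]_p f p = \int[m]_p f (T p))%E.
Proof.
move=> intf; rewrite (eq_measure_integral (pushforward m T))//.
by rewrite (@integral_pushforward _ _ _ _ R T mT m setT f mf)// preimage_setT.
Qed.
End Integral.

Lemma integrable_preserves (T : X -> X) (f : X -> \bar R) : preserves T ->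
  m.-integrable setT f -> m.-integrable setT (f \o T).
Proof.
move=> pT /integrableP[mf h]; have [mT _] := pT.
apply/integrableP; split; first exact: measurableT_comp.
have mf' : measurable_fun setT (fun p => `|f p|%E) by exact: measurableT_comp.
by rewrite (preserves_ge0_integral pT mf') in h.
Qed.
End MeasurePreserving.

Section ProductPreserving.
Context {R : realType} {d1 d2} {X1 : measurableType d1} {X2 : measurableType d2}.
Variables (m0 : {measure set X1 -> \bar R}) (m1 : {sigma_finite_measure set X1 -> \bar R}).
Variable m2 : {sigma_finite_measure set X2 -> \bar R}.

(** By Cavalieri's principle, since the map moves points only within the
    fibres of the first projection. *)
Lemma preserves_fiber (g : X1 -> X2 -> X2) :
  measurable_fun setT (fun p : X1 * X2 => g p.1 p.2) ->
  (forall x A, measurable A -> m2 (g x @^-1` A) = m2 A) ->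
  preserves (m0 \x m2)%E (fun p => (p.1, g p.1 p.2)).
Proof.
move=> mg pg; split; first exact/measurable_fun_pair.
move=> A mA; rewrite /product_measure1 /=; apply: eq_integral => x _ /=.
rewrite -[RHS](pg x); last exact: measurable_xsection.
by congr (m2 _); apply/seteqP; split => y; rewrite /xsection /= !inE.
Qed.

Lemma preserves_first (T : X1 -> X1) : preserves m0 T ->
  preserves (m0 \x m2)%E (fun p => (T p.1, p.2)).
Proof.
move=> pT; have [mT _] := pT; split.
  by apply/measurable_fun_pair => //=; exact: measurableT_comp.
move=> A mA; rewrite /product_measure1 /=.
rewrite [RHS](preserves_ge0_integral pT)//; last exact: measurable_fun_xsection.
Qed.

Lemma preserves_swap : preserves (m1 \x m1)%E (fun p => (p.2, p.1)).
Proof.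
have ms : measurable_fun [set: X1 * X1] (fun p : X1 * X1 => (p.2, p.1)) by exact/measurable_fun_pair.
split=> // A mA.
have secE (x : X1) (C : set (X1 * X1)) : measurable C -> m1 (xsection C x) = (\int[m1]_y (\1_C (x, y))%:E)%E.
  move=> mC; have h := @integral_indic _ _ _ m1 setT measurableT (xsection C x) (measurable_xsection _ mC).
  rewrite setIT in h; rewrite -h.
  apply: eq_integral => y _; rewrite !indicE; congr (_%:R%:E).
  by rewrite mem_xsection.
have mB : measurable ((fun p : X1 * X1 => (p.2, p.1)) @^-1` A).
  by rewrite -[X in measurable X]setTI; exact: ms.
have key C : measurable C -> (m1 \x m1)%E C = (\int[m1]_x \int[m1]_y (\1_C (x, y))%:E)%E.
  by move=> mC; rewrite /product_measure1 /=; apply: eq_integral => x _; rewrite /= secE.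
apply: etrans; first exact: key mB.
apply: etrans; last exact/esym/(key A mA).
have mi : measurable_fun setT (fun p : X1 * X1 => (\1_A p)%:E : \bar R).
  by apply/measurable_EFinP; exact: measurable_indic.
apply/esym/(fubini_tonelli (m1 := m1) (m2 := m1) (fun p => (\1_A p)%:E)) => //.
Qed.
End ProductPreserving.

Section SwapLast.
Context {R : realType} {d1 d2} {X1 : measurableType d1} {X2 : measurableType d2}.
Variables (m1 : {sigma_finite_measure set X1 -> \bar R}) (m2 : {sigma_finite_measure set X2 -> \bar R}).

Lemma preserves_swap23 : preserves ((m1 \x m2) \x m2)%E (fun p => (p.1.1, p.2, p.1.2)).
Proof.
have mT : measurable_fun [set: X1 * X2 * X2] (fun p : X1 * X2 * X2 => (p.1.1, p.2, p.1.2)).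
  by apply/measurable_fun_pair => //=; [apply/measurable_fun_pair => //=|]; exact: measurableT_comp.
split=> // A mA.
pose B := (fun p : X1 * X2 * X2 => (p.1.1, p.2, p.1.2)) @^-1` A.
have mB : measurable B by rewrite -[X in measurable X]setTI; exact: mT.
have secE (C : set (X1 * X2 * X2)) z : measurable C -> m2 (xsection C z) = (\int[m2]_y (\1_C (z, y))%:E)%E.
  move=> mC; have h := @integral_indic _ _ _ m2 setT measurableT (xsection C z) (measurable_xsection _ mC).
  rewrite setIT in h; rewrite -h.
  apply: eq_integral => y _; rewrite !indicE; congr (_%:R%:E).
  by rewrite mem_xsection.
have key C : measurable C -> ((m1 \x m2) \x m2)%E C = (\int[m1]_x \int[m2]_y \int[m2]_z (\1_C ((x, y), z))%:E)%E.
  move=> mC; rewrite /product_measure1 /=.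
  have mphi : measurable_fun setT (fun z => m2 (xsection C z)) by exact: measurable_fun_xsection.
  rewrite (fubini_tonelli1 (m1 := m1) (m2 := m2) (fun z => m2 (xsection C z)))//.
  by apply: eq_integral => x _; apply: eq_integral => y _; rewrite /= secE.
apply: etrans; first exact: key mB.
apply: etrans; last exact/esym/(key A mA).
apply: eq_integral => x _.
pose f (w : X2 * X2) : \bar R := (\1_A ((x, w.1), w.2))%:E.
have mf : measurable_fun setT f.
  have mg : measurable_fun [set: X2 * X2] (fun w : X2 * X2 => ((x, w.1), w.2)).
    by apply/measurable_fun_pair => //=; apply/measurable_fun_pair.
  have mD : measurable ((fun w : X2 * X2 => ((x, w.1), w.2)) @^-1` A).
    by rewrite -[X in measurable X]setTI; exact: mg.
  by apply/measurable_EFinP; exact: measurable_indic mD.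
have f0 w : (0 <= f w)%E by rewrite /f lee_fin indicE.
rewrite -(fubini_tonelli (m1 := m2) (m2 := m2) f mf f0).
by apply: eq_integral.
Qed.
End SwapLast.

Section R3.
Context {R : realType}.
Notation leb := (@lebesgue_measure R).
Notation mR := (measurableTypeR R).
Notation T3 := (mR * mR * mR)%type.

Lemma rat_approx (w i : R) : 0 < i -> exists q : rat, `|w - ratr q| < i.
Proof.
move=> i0; have wi : w - i < w + i by lra.
have [q] := rat_in_itvoo wi.
by rewrite in_itv/= => /andP[h1 h2]; exists q; rewrite ltr_norml; apply/andP; lra.
Qed.

(** The sigma-algebra is the product one; open sets belong to it as countable
    unions of rational boxes. *)
Lemma open_measurable3 (U : set T3) : open (U : set (R * R * R)) -> measurable U.
Proof.
move=> oU.
pose box (q1 q2 q3 : rat) (n : nat) : set T3 :=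
  (ball (ratr q1 : R) n.+1%:R^-1 `*` ball (ratr q2 : R) n.+1%:R^-1) `*` ball (ratr q3 : R) n.+1%:R^-1.
have mbox q1 q2 q3 n : measurable (box q1 q2 q3 n).
  by apply: measurableX; [apply: measurableX|]; exact: measurable_ball.
pose sel q1 q2 q3 n := if `[< box q1 q2 q3 n `<=` U >] then box q1 q2 q3 n else set0.
have msel q1 q2 q3 n : measurable (sel q1 q2 q3 n) by rewrite /sel; case: ifP.
have -> : U = \bigcup_q1 \bigcup_q2 \bigcup_q3 \bigcup_n sel q1 q2 q3 n.
  apply/seteqP; split; last first.
    by move=> p [q1 _ [q2 _ [q3 _ [n _]]]]; rewrite /sel; case: ifPn => [/asboolP h /h|].
  move=> [[x y] z] Up.
  have /nbhs_ballP[ep /= ep0 hU] : nbhs (((x : R), (y : R)), (z : R)) U by exact: open_nbhs_nbhs.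
  pose n := Num.truncn (2 / ep).
  have n0 : 0 < n.+1%:R^-1 :> R by rewrite invr_gt0.
  have n1 : 2 * n.+1%:R^-1 < ep.
    have h : 2 / ep < n.+1%:R by exact: truncnS_gt.
    rewrite ltr_pdivrMr//; rewrite ltr_pdivrMr// in h; by rewrite mulrC.
  have app (w : R) := rat_approx w n0.
  have [q1 h1] := app x; have [q2 h2] := app y; have [q3 h3] := app z.
  exists q1 => //; exists q2 => //; exists q3 => //; exists n => //.
  rewrite /sel; case: ifPn => [_|/asboolP[]].
    by split => /=; [split => /=|]; rewrite /ball/= distrC.
  move=> [[x' y'] z'] [[/= b1 b2] b3]; apply: hU.
  have tri (w w' q : R) : `|w - q| < n.+1%:R^-1 -> ball q n.+1%:R^-1 w' -> ball w ep w'.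
    rewrite /ball/= => k1 k2; rewrite (_ : w - w' = (w - q) + (q - w')); last by ring.
    apply: (le_lt_trans (ler_normD _ _)); move: k1 k2 n1.
    by move: (_^-1) => i; lra.
  by split => /=; [split => /=|]; [exact: tri h1 b1|exact: tri h2 b2|exact: tri h3 b3].
do 3 (apply: bigcupT_measurable_rat => ?).
by apply: bigcupT_measurable.
Qed.

Lemma continuous_measurable3 (f : R * R * R -> R) : continuous f ->
  measurable_fun [set: T3] (f : T3 -> mR).
Proof.
move=> cf; apply: (measurability _ (RGenOpens.measurableE R)) => _ [_ [a [b ->] <-]].
rewrite setTI; apply: open_measurable3.
by move/continuousP : cf; apply; exact: interval_open.
Qed.

Lemma compact_measurable3 (K : set (R * R * R)) : compact K -> measurable (K : set T3).
Proof.
move=> cK; rewrite -[X in measurable X]setCK; apply: measurableC; apply: open_measurable3.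
by apply: closed_openC; apply: compact_closed cK; exact: norm_hausdorff.
Qed.
End R3.

(** * Null lines and singular integrals *)

Section PlaneMeasure.
Variable R : realType.
Notation leb := (@lebesgue_measure R).
Notation mR := (measurableTypeR R).

(** A name for the product measure, to which the sigma-finite structure
    required by iterated integrals is attached. *)
Definition leb2 : set (mR * mR) -> \bar R := (leb \x leb)%E.
HB.instance Definition _ := Measure.on leb2.

Let sigma_finite_leb2 : sigma_finite setT leb2.
Proof.
have /sigma_finiteP[F [TF ndF Foo]] := sigma_finiteT (leb : {sigma_finite_measure set mR -> \bar R}).
exists (fun n => F n `*` F n).
  apply/seteqP; split => // -[x y] _.
  have inF (z : mR) : (\bigcup_n F n) z by rewrite -TF.
  have [[n _ Fx] [p _ Fy]] := (inF x, inF y).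
  exists (maxn n p) => //; split => /=.
    by move: x Fx; apply/subsetPset/ndF/leq_maxl.
  by move: y Fy; apply/subsetPset/ndF/leq_maxr.
move=> n; have [mF Fn] := Foo n; split; first exact: measurableX.
by rewrite /leb2 product_measure1E// lte_mul_pinfty// ge0_fin_numE.
Qed.

HB.instance Definition _ := Measure_isSigmaFinite.Build _ _ _ leb2 sigma_finite_leb2.
End PlaneMeasure.
Arguments leb2 R : clear implicits.

Section NullMaps.
Context {R : realType}.
Notation leb := (@lebesgue_measure R).
Notation mR := (measurableTypeR R).
Notation T3 := (mR * mR * mR)%type.

(** Coordinates of space-time whose last one runs along the lines x - y =
    const, respectively x + y = const, respectively along the time axis. They
    preserve the measure, so that integrals over space-time become integrals over
    such lines. *)
Definition along_P (q : R * R * R) : R * R * R :=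
  (q.1.1, q.2 + q.1.2 / 2, q.2 - q.1.2 / 2).
Definition along_M (q : R * R * R) : R * R * R :=
  (q.1.1, q.1.2 / 2 + q.2, q.1.2 / 2 - q.2).
Definition along_t (q : R * R * R) : R * R * R := (q.2, q.1.1, q.1.2).

Let shear (g : mR * mR -> mR) : measurable_fun setT g ->
  preserves (mu3 R) (fun p : T3 => (p.1, (p.2 + g p.1 : mR))).
Proof.
move=> mg; have h := @preserves_fiber R _ _ _ _ (leb2 R) leb (fun z y => (y + g z : mR)).
apply: h.
  by apply: measurable_funD => //; exact: measurableT_comp.
by move=> z A mA; exact: lebesgue_shift.
Qed.

Let flip (g : mR * mR -> mR) : measurable_fun setT g ->
  preserves (mu3 R) (fun p : T3 => (p.1, (g p.1 - p.2 : mR))).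
Proof.
move=> mg; have h := @preserves_fiber R _ _ _ _ (leb2 R) leb (fun z y => (g z - y : mR)).
apply: h.
  by apply: measurable_funB => //; exact: measurableT_comp.
by move=> z A mA; exact: lebesgue_reflect.
Qed.

Let swap : preserves (mu3 R) (fun p : T3 => (p.1.1, p.2, p.1.2)).
Proof. exact: (@preserves_swap23 R _ _ _ _ leb leb). Qed.

Let msnd (a : R) : measurable_fun [set: mR * mR] (fun z : mR * mR => (a * z.2 : mR)).
Proof. by apply: measurable_funM => //. Qed.

(** A composition of shears and of exchanges of coordinates. *)
Lemma preserves_along_P : preserves (mu3 R) (along_P : T3 -> T3).
Proof.
have h := preserves_comp swap (preserves_comp (shear (msnd 1)) (preserves_comp swap (shear (msnd (- 2^-1))))).
apply: (eq_ind _ (preserves (mu3 R)) h).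
by apply/funext => -[[t a] b]; rewrite /along_P /=; congr ((_, _), _); lra.
Qed.

Lemma preserves_along_M : preserves (mu3 R) (along_M : T3 -> T3).
Proof.
have h := preserves_comp swap (preserves_comp (shear (msnd (-1))) (preserves_comp swap (flip (msnd (2^-1))))).
apply: (eq_ind _ (preserves (mu3 R)) h).
by apply/funext => -[[t a] b]; rewrite /along_M /=; congr ((_, _), _); lra.
Qed.

Lemma preserves_along_t : preserves (mu3 R) (along_t : T3 -> T3).
Proof.
have h := @preserves_first R _ _ _ _ (leb2 R) leb _ (@preserves_swap R _ mR leb).
exact: preserves_comp h swap.
Qed.
End NullMaps.

Lemma integral_EFin {R : realType} d (X : measurableType d) (m : {measure set X -> \bar R})
    (D : set X) (f : X -> R) : measurable D -> m.-integrable D (EFin \o f) ->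
  (\int[m]_(x in D) (f x)%:E = (\int[m]_(x in D) f x)%R%:E)%E.
Proof. by move=> mD i; rewrite /Rintegral fineK//; exact: integrable_fin_num. Qed.

Section SingularFTC.
Context {R : realType}.
Notation leb := (@lebesgue_measure R).
Variables (h H : R -> R).

Lemma ftc_closed (a b : R) : a < b ->
  (forall x, a <= x <= b -> is_derive x 1 H (h x) /\ {for x, continuous h}) ->
  \int[leb]_(x in `[a, b]) h x = H b - H a.
Proof.
move=> ab D; rewrite /Rintegral (@continuous_FTC2 _ h H)//.
- by apply: continuous_in_subspaceT => x; rewrite inE/= in_itv/= => /D[].
- have c x : a <= x <= b -> {for x, continuous H}.
    by move=> /D[dx _]; apply/differentiable_continuous/derivable1_diffP.
  split.
  + by move=> x; rewrite in_itv/= => /andP[/ltW ax /ltW xb]; have [|[]] := D x; rewrite ?ax.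
  + by apply: cvg_at_right_filter; apply: c; rewrite lexx ltW.
  + by apply: cvg_at_left_filter; apply: c; rewrite lexx ltW.
move=> x; rewrite in_itv/= => /andP[/ltW ax /ltW xb]; have [|dx _] := D x; first by rewrite ax.
by rewrite derive1E; exact: derive_val.
Qed.

Lemma ftc_singular_left (a b l : R) : a < b -> leb.-integrable `[a, b] (EFin \o h) ->
  (forall x, a < x <= b -> is_derive x 1 H (h x) /\ {for x, continuous h}) ->
  H x @[x --> a^'+] --> l -> \int[leb]_(x in `[a, b]) h x = H b - l.
Proof.
move=> ab ih D Hl.
have c1 : \int[leb]_(x in `[a, c]) h x @[c --> a^'+] --> (0 : R).
  by apply: cvg_at_right_filter; exact: (parameterized_integral_cvg_left ab ih).
have c2 : \int[leb]_(x in `[a, c]) h x + (H b - H c) @[c --> a^'+] --> 0 + (H b - l).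
  by apply: cvgD c1 _; apply: cvgB Hl; exact: cvg_cst.
rewrite add0r in c2; apply: (cvg_unique _ _ c2) => //.
apply: cvg_near_cst; near=> c.
have ac : a < c by near: c; exact: nbhs_right_gt.
have cb : c < b by near: c; exact: nbhs_right_lt.
rewrite -(@ftc_closed c b)//; last by move=> x /andP[cx xb]; apply: D; rewrite xb andbT; exact: lt_le_trans cx.
have := @Rintegral_itvB R h (BLeft a) (BRight b) c ih; rewrite !bnd_simp => /(_ (ltW ac) (ltW cb)).
rewrite (@Rintegral_itv_obnd_cbnd R c (BRight b)); last first.
  apply: integrableS ih => //; apply: subset_itvr; rewrite bnd_simp; exact: ltW.
by move=> <-; ring.
Unshelve. all: by end_near. Qed.

Lemma ftc_singular_right (a b l : R) : a < b -> leb.-integrable `[a, b] (EFin \o h) ->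
  (forall x, a <= x < b -> is_derive x 1 H (h x) /\ {for x, continuous h}) ->
  H x @[x --> b^'-] --> l -> \int[leb]_(x in `[a, b]) h x = l - H a.
Proof.
move=> ab ih D Hl.
have c1 := parameterized_integral_cvg_at_left ab ih.
have c2 : H c - H a @[c --> b^'-] --> l - H a by apply: cvgB Hl _; exact: cvg_cst.
apply: (cvg_unique _ c1) => //.
apply: cvg_trans c2; apply: near_eq_cvg; near=> c.
have ac : a < c by near: c; exact: nbhs_left_gt.
have cb : c < b by near: c; exact: nbhs_left_lt.
rewrite /parameterized_integral -(@ftc_closed a c)// => x /andP[cx xb]; apply: D; rewrite cx; exact: le_lt_trans cb.
Unshelve. all: by end_near. Qed.

(** The two one-sided limits of H at the singularity cancel. *)
Lemma ftc_through_singularity (l M : R) : 0 < M -> leb.-integrable setT (EFin \o h) ->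
  (forall x : R, x != 0 -> is_derive x 1 H (h x) /\ {for x, continuous h}) ->
  H x @[x --> 0^'] --> l -> (forall x : R, M <= `|x| -> H x = 0) ->
  (\int[leb]_x (h x)%:E = 0)%E.
Proof.
move=> M0 ih D Hl H0.
have h0 x : M < `|x| -> h x = 0.
  move=> Mx; have x0 : x != 0 by rewrite -normr_gt0 (lt_trans M0).
  have [dx _] := D _ x0.
  have e : is_derive x 1 H 0.
    apply: (@near_eq_is_derive _ _ _ (cst 0)) => //; near=> y.
    rewrite H0//; apply/ltW; near: y.
    exact: (@norm_continuous _ _ x _ (near_gt Mx)).
  by rewrite -[LHS](@derive_val _ _ _ _ _ _ _ dx) [LHS](@derive_val _ _ _ _ _ _ _ e).
have ihS a b : leb.-integrable `[a, b] (EFin \o h) by apply: integrableS ih.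
have L : \int[leb]_(x in `[- M, 0]) h x = l - H (- M).
  apply: ftc_singular_right => //; first by rewrite oppr_lt0.
    by move=> x /andP[_ x0]; apply: D; rewrite lt_eqF.
  exact: cvg_dnbhs_at_left.
have Ri : \int[leb]_(x in `[0, M]) h x = H M - l.
  apply: ftc_singular_left => //.
    by move=> x /andP[x0 _]; apply: D; rewrite gt_eqF.
  exact: cvg_dnbhs_at_right.
have z : \int[leb]_(x in `[- M, M]) h x = 0.
  have := @Rintegral_itvB R h (BLeft (- M)) (BRight M) 0 (ihS _ _).
  rewrite !bnd_simp oppr_le0 => /(_ (ltW M0) (ltW M0)).
  rewrite (@Rintegral_itv_obnd_cbnd R 0 (BRight M)); last first.
    apply: integrableS (ihS 0 M) => //; apply: subset_itvr; rewrite bnd_simp; exact: lexx.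
  rewrite L Ri !H0 ?normrN ?(ger0_norm (ltW M0))// => /eqP; rewrite subr_eq => /eqP ->; ring.
have -> : (\int[leb]_x (h x)%:E)%E = (\int[leb]_(x in `[(- M)%R, M]) (h x)%:E)%E.
  rewrite [RHS]integral_mkcond; apply: eq_integral => x _; rewrite patchE.
  case: ifPn => // /negP xM; rewrite h0// ltNge ler_norml; apply/negP => ?; apply: xM.
  by rewrite inE /= in_itv.
by rewrite integral_EFin// z.
Unshelve. all: by end_near. Qed.
End SingularFTC.

Section Weights.
Context {R : realType}.
Notation leb := (@lebesgue_measure R).
Notation mR := (measurableTypeR R).
Implicit Types (q r x M d : R).

(** |x|^q, with value 1 at x = 0. *)
Definition wgt q x : R := expR (q * ln `|x|).

Lemma wgt_ge0 q x : 0 <= wgt q x. Proof. exact: expR_ge0. Qed.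
Lemma wgtD q r x : wgt (q + r) x = wgt q x * wgt r x.
Proof. by rewrite /wgt mulrDl expRD. Qed.
Lemma wgtN q x : wgt q (- x) = wgt q x.
Proof. by rewrite /wgt normrN. Qed.
Lemma wgt0 x : wgt 0 x = 1.
Proof. by rewrite /wgt mul0r expR0. Qed.

Lemma wgt_inv x : `|x^-1| <= wgt (-1) x.
Proof.
have [->|x0] := eqVneq x 0; first by rewrite invr0 normr0 wgt_ge0.
by rewrite /wgt mulN1r expRN lnK ?normfV// posrE normr_gt0.
Qed.

Lemma ln_norm_le x M : 1 <= M -> `|x| <= M -> ln `|x| <= ln M.
Proof.
move=> M1 xM; have [->|x0] := eqVneq x 0; first by rewrite normr0 ln0// ln_ge0.
by rewrite ler_ln// posrE ?normr_gt0// (lt_le_trans ltr01).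
Qed.

Lemma wgt_mono q r M : r <= q -> 1 <= M ->
  exists C, 0 <= C /\ forall x, `|x| <= M -> wgt q x <= C * wgt r x.
Proof.
move=> rq M1; exists (expR ((q - r) * ln M)); split => [|x xM]; first exact: expR_ge0.
rewrite -(subrK r q) wgtD subrK; apply: ler_wpM2r; first exact: wgt_ge0.
by rewrite ler_expR; apply: ler_wpM2l; [rewrite subr_ge0|exact: ln_norm_le].
Qed.

Lemma ln_wgt d M : 0 < d -> 1 <= M ->
  exists C, 0 <= C /\ forall x, `|x| <= M -> `|ln `|x| | <= C * wgt (- d) x.
Proof.
move=> d0 M1; have L0 : 0 <= ln M by exact: ln_ge0.
exists (d^-1 + ln M * expR (d * ln M)); split => [|x xM].
  by rewrite addr_ge0 ?invr_ge0 ?mulr_ge0 ?expR_ge0// ltW.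
have sL := ln_norm_le M1 xM; rewrite /wgt; move: (ln `|x|) sL => s sL.
rewrite mulrDl; have e0 := expR_gt0 (- d * s).
have [s0|s0] := lerP 0 s.
  rewrite ger0_norm// -[leLHS]add0r; apply: lerD.
    by rewrite mulr_ge0 ?expR_ge0// invr_ge0 ltW.
  rewrite -mulrA -expRD; apply: (le_trans sL).
  rewrite -[leLHS]mulr1; apply: ler_wpM2l => //.
  rewrite -[leLHS](@expR0 R) ler_expR.
  have : 0 <= d * (ln M - s) by apply: mulr_ge0; [exact: ltW|rewrite subr_ge0].
  by lra.
rewrite ltr0_norm// -[leLHS]addr0; apply: lerD; last by rewrite !mulr_ge0 ?expR_ge0.
rewrite mulrC ler_pdivlMr//.
by have := expR_ge1Dx (- d * s); lra.
Qed.

Lemma measurable_wgt q : measurable_fun [set: mR] (wgt q : mR -> mR).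
Proof.
apply: (@measurableT_comp _ _ _ _ _ _ (@expR R : mR -> mR)); first exact: measurable_expR.
apply: measurable_funM => //; apply: (@measurableT_comp _ _ _ _ _ _ (@ln R : mR -> mR)).
  exact: measurable_ln.
exact: normr_measurable.
Qed.

(** Monotone convergence along the intervals [M / (n + 2), M]. *)
Let integrable_pos q M : -1 < q -> 0 < M ->
  leb.-integrable (`]0, M]%classic : set mR) (EFin \o wgt q : mR -> \bar R).
Proof.
move=> q1 M0; have q0 : q + 1 != 0 by rewrite gt_eqF//; lra.
have qp : 0 < q + 1 by lra.
pose F (n : nat) := `[M / n.+2%:R, M]%classic.
have lo (n : nat) : 0 < M / n.+2%:R by rewrite divr_gt0.
have lt (n : nat) : M / n.+2%:R < M by rewrite ltr_pdivrMr// ltr_pMr// ltr1n.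
have mw A : measurable A -> measurable_fun A (EFin \o wgt q : mR -> \bar R).
  by move=> mA; apply/measurable_EFinP; exact: measurable_funS (measurable_wgt q).
have FU : \bigcup_n F n = `]0, M]%classic.
  apply/seteqP; split => x /=.
    by move=> [n _]; rewrite /F /= !in_itv/= => /andP[h ->]; rewrite (lt_le_trans (lo n)).
  rewrite in_itv/= => /andP[x0 xM]; exists (Num.truncn (M / x)) => //.
  rewrite /F /= in_itv/= xM andbT ler_pdivrMr// mulrC -ler_pdivrMr//.
  have := truncnS_gt (M / x); rewrite -[_.+2]addn1 natrD; lra.
pose Hq (x : R) := expR ((q + 1) * ln `|x|) * (q + 1)^-1.
have intF (n : nat) : (\int[leb]_(x in F n) (wgt q x)%:E <= (Hq M)%:E)%E.
  have D x : M / n.+2%:R <= x <= M -> is_derive x 1 Hq (wgt q x) /\ {for x, continuous (wgt q)}.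
    move=> /andP[h _]; have x0 : 0 < x by exact: lt_le_trans h.
    have n0 : `|x| = x by exact/ger0_norm/ltW.
    have dl : is_derive x 1 (fun y : R => ln `|y|) x^-1.
      by have := dlnabs (lt0r_neq0 x0) (dI x); rewrite mulr1.
    split.
      rewrite /Hq; der.
      have e1 : wgt 1 x = x by rewrite /wgt mul1r n0 lnK// posrE.
      have := wgtD q 1 x; rewrite e1 /wgt => ->; field.
      by rewrite q0 lt0r_neq0.
    apply: (@is_derive_continuous _ (wgt q) x (wgt q x * (q * x^-1))).
  have i : leb.-integrable (F n) (EFin \o wgt q).
    apply: continuous_compact_integrable; first exact: segment_compact.
    apply: continuous_in_subspaceT => x; rewrite inE /F /= in_itv /= => h.
    by have [] := D x h.
  rewrite integral_EFin//; last exact: measurable_itv.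
  rewrite (ftc_closed (lt n) D) lee_fin.
  by rewrite lerBlDr lerDl /Hq divr_ge0 ?expR_ge0// ltW.
apply/integrableP; split; first exact: mw.
have -> : (\int[leb]_(x in `]0%R, M]) `|(EFin \o wgt q) x| = \int[leb]_(x in `]0%R, M]) (wgt q x)%:E)%E.
  by apply: eq_integral => x _; rewrite /= ger0_norm ?wgt_ge0.
rewrite -FU; have cv : (fun i => \int[leb]_(x in F i) (wgt q x)%:E)%E @ \oo
    --> (\int[leb]_(x in \bigcup_i F i) (wgt q x)%:E)%E.
  apply: ge0_nondecreasing_set_cvg_integral.
  - move=> m n mn; rewrite subsetEset /F; apply: subset_itvr; rewrite bnd_simp.
    by rewrite ler_pM2l// lef_pV2 ?posrE// ler_nat ltnS ltnS.
  - by move=> i; exact: measurable_itv.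
  - by move=> i; apply: mw; exact: measurable_itv.
  - by move=> i x _; rewrite lee_fin wgt_ge0.
rewrite -(cvg_lim _ cv)//; apply: (@le_lt_trans _ _ (Hq M)%:E); last exact: ltry.
by apply: lime_le; [apply/cvg_ex; eexists; exact: cv|exact: nearW].
Qed.

Definition wgt_on q M x := wgt q x * \1_(`[- M, M]%classic : set R) x.

Lemma measurable_wgt_on q M : measurable_fun [set: mR] (wgt_on q M : mR -> mR).
Proof.
apply: measurable_funM; first exact: measurable_wgt.
exact: measurable_indic.
Qed.

Lemma wgt_on_ge0 q M x : 0 <= wgt_on q M x.
Proof. by rewrite /wgt_on mulr_ge0 ?wgt_ge0// indicE. Qed.

Lemma wgt_onE q M x : `|x| <= M -> wgt_on q M x = wgt q x.
Proof.
move=> xM; rewrite /wgt_on indicE mem_set ?mulr1//=.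
by rewrite in_itv/= -ler_norml.
Qed.

Lemma integrable_wgt_on q M : -1 < q -> 0 < M -> leb.-integrable setT (EFin \o wgt_on q M).
Proof.
move=> q1 M0; pose g x := wgt q x * \1_(`]0, M]%classic : set R) x.
have mg : measurable_fun [set: mR] (g : mR -> mR).
  by apply: measurable_funM; [exact: measurable_wgt|exact: measurable_indic].
have ig : leb.-integrable setT (EFin \o g).
  have mI : measurable (`]0, M]%classic : set mR) by exact: measurable_itv.
  have := (integrable_mkcond (EFin \o wgt q : mR -> \bar R) mI).1 (integrable_pos q1 M0).
  apply: eq_integrable => // x _; rewrite patchE /g /= indicE.
  by case: ifP; rewrite ?mulr1 ?mulr0.
pose T (x : mR) : mR := 0 - x.
have pT : preserves leb T.
  by split; [exact: measurable_funB|move=> A mA; exact: lebesgue_reflect].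
have ig' : leb.-integrable setT (EFin \o (g \o T)).
  apply: (preserves_integrable pT).
    by apply/measurable_EFinP; apply: measurableT_comp mg _; case: pT.
  apply: eq_integrable ig => // x _ /=.
  by rewrite /T !sub0r opprK.
have i0 := @integrable_indic_itv R 0 0 true false.
have := integrableD measurableT (integrableD measurableT ig ig') i0.
apply: le_integrable => //; first by apply/measurable_EFinP; exact: measurable_wgt_on.
move=> x _; rewrite /= lee_fin ger0_norm ?wgt_on_ge0//.
have g0 y : 0 <= g y by rewrite /g mulr_ge0 ?wgt_ge0// indicE.
rewrite ger0_norm; last by rewrite !addr_ge0 ?g0// indicE.
rewrite /g /T sub0r wgtN /wgt_on !indicE !mem_setE /= !in_itv/=.
have w0 := wgt_ge0 q x.
have [xM|_] := boolP (- M <= x <= M); last first.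
  by rewrite mulr0; apply: addr_ge0 => //; apply: addr_ge0; apply: mulr_ge0.
have [x0|x0|x0] := ltgtP x 0.
- have -> : 0 < - x <= M by case/andP: xM => ? ?; apply/andP; split; lra.
  by rewrite /= mulr0 add0r addr0.
- have -> : x <= M by case/andP: xM.
  by rewrite /= addr0 lerDl mulr_ge0.
rewrite x0 oppr0 ltxx /= !mulr0 !add0r /wgt normr0 ln0// !mulr0 expR0 mul1r.
exact: lexx.
Qed.
End Weights.

(** * Functions of controlled growth at the light cone *)

Section ProductIntegrable.
Context {R : realType} {d1 d2} {X1 : measurableType d1} {X2 : measurableType d2}.
Variables (m1 : {sigma_finite_measure set X1 -> \bar R}) (m2 : {sigma_finite_measure set X2 -> \bar R}).

Lemma integrable_prod (f1 : X1 -> R) (f2 : X2 -> R) :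
  m1.-integrable setT (EFin \o f1) -> m2.-integrable setT (EFin \o f2) ->
  (m1 \x m2)%E.-integrable setT (fun p => (f1 p.1 * f2 p.2)%:E).
Proof.
move=> i1 i2; have /measurable_EFinP m_1 := measurable_int _ i1.
have /measurable_EFinP m_2 := measurable_int _ i2.
have i2' := integrable_norm i2.
apply/integrable12ltyP.
  apply/measurable_EFinP; apply: measurable_funM.
    exact: measurableT_comp m_1 measurable_fst.
  exact: measurableT_comp m_2 measurable_snd.
under eq_integral => x _.
  under eq_integral => y _ do rewrite /= normrM EFinM.
  rewrite integralZl//; over.
rewrite /=; under eq_integral do rewrite -[X in (_ * X)%E]fineK ?integrable_fin_num//.
rewrite integralZr//; last exact: (integrable_norm i1).
have i1' := integrable_norm i1.
by rewrite lte_mul_pinfty ?integral_ge0//; [exact: integrable_fin_num i1'|exact: ltry].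
Qed.
End ProductIntegrable.

Section Dominated.
Context {R : realType}.
Notation leb := (@lebesgue_measure R).
Notation mR := (measurableTypeR R).
Notation T3 := (mR * mR * mR)%type.
Implicit Types (q r d M C : R) (z : R * R * R) (f g : R * R * R -> R).

Definition xi z := z.1.2 + z.2.
Definition zt z := z.1.2 - z.2.
(** The logarithm of the hyperbolic radius. *)
Definition tau z := (ln `|xi z| + ln `|zt z|) / 2.

Definition in_box M z := [/\ `|z.1.1| <= M, `|xi z| <= M & `|zt z| <= M].

(** Locally O(|xi|^(q - d) |zt|^(r - d)) for every d > 0. The loss d absorbs
    logarithms, so that the classes are stable under products with functions of
    logarithmic growth. *)
Definition dom q r f := measurable_fun [set: T3] (f : T3 -> mR) /\
  forall d M, 0 < d -> 1 <= M -> exists C, 0 <= C /\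
  forall z, in_box M z -> `|f z| <= C * (wgt (q - d) (xi z) * wgt (r - d) (zt z)).

Lemma dom_weaken q r q' r' f : q' <= q -> r' <= r -> dom q r f -> dom q' r' f.
Proof.
move=> qq rr [mf h]; split => // d M d0 M1.
have [C [C0 hC]] := h _ _ d0 M1.
have [A [A0 hA]] := wgt_mono (lerB qq (lexx d)) M1.
have [B [B0 hB]] := wgt_mono (lerB rr (lexx d)) M1.
exists (C * (A * B)); split => [|z bz]; first by rewrite !mulr_ge0.
have [_ bx bz'] := bz; apply: le_trans (hC _ bz) _.
rewrite -[leRHS]mulrA; apply: ler_wpM2l => //; rewrite mulrACA.
exact: (ler_pM (wgt_ge0 _ _) (wgt_ge0 _ _) (hA _ bx) (hB _ bz')).
Qed.

Lemma domD q r f g : dom q r f -> dom q r g -> dom q r (fun z => f z + g z).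
Proof.
move=> [mf hf] [mg hg]; split; first exact: measurable_funD.
move=> d M d0 M1; have [A [A0 hA]] := hf _ _ d0 M1; have [B [B0 hB]] := hg _ _ d0 M1.
exists (A + B); split => [|z bz]; first exact: addr_ge0.
by apply: (le_trans (ler_normD _ _)); rewrite mulrDl lerD ?hA ?hB.
Qed.

Lemma domN q r f : dom q r f -> dom q r (fun z => - f z).
Proof.
move=> [mf hf]; split; first exact: measurableT_comp.
move=> d M d0 M1; have [A [A0 hA]] := hf _ _ d0 M1; exists A; split=> // z bz.
by rewrite normrN hA.
Qed.

Lemma domM q r q' r' f g : dom q r f -> dom q' r' g ->
  dom (q + q') (r + r') (fun z => f z * g z).
Proof.
move=> [mf hf] [mg hg]; split; first exact: measurable_funM.
move=> d M d0 M1; have d2 : 0 < d / 2 by lra.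
have [A [A0 hA]] := hf _ _ d2 M1; have [B [B0 hB]] := hg _ _ d2 M1.
exists (A * B); split => [|z bz]; first exact: mulr_ge0.
have -> : q + q' - d = (q - d / 2) + (q' - d / 2) by lra.
have -> : r + r' - d = (r - d / 2) + (r' - d / 2) by lra.
rewrite normrM !wgtD.
apply: le_trans (ler_pM (normr_ge0 _) (normr_ge0 _) (hA _ bz) (hB _ bz)) _.
rewrite !wgtD; move: (wgt (- (d / 2)) (xi z)) (wgt (- (d / 2)) (zt z)) (wgt q _) (wgt q' _) (wgt r _) (wgt r' _) => a b c e u v.
by rewrite le_eqVlt (_ : (_ == _))//; apply/eqP; ring.
Qed.

Lemma dom_bounded f C : measurable_fun [set: T3] (f : T3 -> mR) -> (forall z, `|f z| <= C) -> dom 0 0 f.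
Proof.
move=> mf hf; split => // d M d0 M1.
have nd : - d <= 0 by rewrite oppr_le0 ltW.
have [A [A0 hA]] := wgt_mono nd M1.
have C0 : 0 <= C by exact: le_trans (hf (0, 0, 0)).
exists (C * (A * A)); split => [|z [_ bx bz]]; first by rewrite !mulr_ge0.
apply: le_trans (hf _) _; rewrite -[leLHS]mulr1 -[leRHS]mulrA; apply: ler_wpM2l => //.
have := hA _ bx; have := hA _ bz; rewrite !sub0r !wgt0 mulrACA => h1 h2.
by rewrite -[leLHS]mulr1; apply: ler_pM.
Qed.

Lemma dom_cst (a : R) : dom 0 0 (fun _ => a).
Proof. by apply: (@dom_bounded _ `|a|). Qed.

Lemma measurable_xi : measurable_fun [set: T3] (xi : T3 -> mR).
Proof.
apply: measurable_funD; last exact: measurable_snd.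
exact: measurableT_comp measurable_snd measurable_fst.
Qed.
Lemma measurable_zt : measurable_fun [set: T3] (zt : T3 -> mR).
Proof.
apply: measurable_funB; last exact: measurable_snd.
exact: measurableT_comp measurable_snd measurable_fst.
Qed.
Lemma measurable_lnabs (f : T3 -> mR) : measurable_fun setT f ->
  measurable_fun [set: T3] (fun z => ln `|f z| : mR).
Proof.
move=> mf; apply: (@measurableT_comp _ _ _ _ _ _ (@ln R : mR -> mR)); first exact: measurable_ln.
by apply: measurableT_comp mf; exact: normr_measurable.
Qed.
Lemma measurable_tau : measurable_fun [set: T3] (tau : T3 -> mR).
Proof.
apply: measurable_funM => //; apply: measurable_funD; apply: measurable_lnabs.
  exact: measurable_xi.
exact: measurable_zt.
Qed.
Lemma measurable_inv : measurable_fun [set: mR] (@GRing.inv R : mR -> mR).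
Proof.
rewrite -(setvU [set (0 : mR)]); apply/measurable_funU => //; first exact: measurableC.
split; last exact: measurable_fun_set1.
apply: open_continuous_measurable_fun; first exact/closed_openC/accessible_closed_set1/hausdorff_accessible/norm_hausdorff.
by move=> x; rewrite inE /= => x0; apply: inv_continuous; exact/eqP.
Qed.
Lemma measurable_invr (f : T3 -> mR) : measurable_fun setT f ->
  measurable_fun [set: T3] (fun z => (f z)^-1 : mR).
Proof. exact: measurableT_comp measurable_inv. Qed.

Let wgtNd_ge d M : 0 < d -> 1 <= M -> exists A : R, 0 <= A /\ forall x : R, `|x| <= M -> 1 <= A * wgt (- d) x.
Proof.
move=> d0 M1; have nd : - d <= 0 by rewrite oppr_le0 ltW.
have [A [A0 hA]] := wgt_mono nd M1; exists A; split => // x /hA.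
by rewrite wgt0.
Qed.

Lemma dom_inv_xi : dom (-1) 0 (fun z => (xi z)^-1).
Proof.
split; first exact: measurable_invr measurable_xi.
move=> d M d0 M1; have [A [A0 hA]] := wgtNd_ge d0 M1.
exists (A * A); split => [|z [_ bx bz]]; first exact: mulr_ge0.
apply: le_trans (wgt_inv _) _; rewrite !sub0r wgtD.
have := hA _ bx; have := hA _ bz => h1 h2.
rewrite (_ : _ * _ = wgt (-1) (xi z) * ((A * wgt (- d) (xi z)) * (A * wgt (- d) (zt z)))); last by ring.
rewrite -[leLHS]mulr1; apply: ler_wpM2l; first exact: wgt_ge0.
by rewrite -[leLHS]mulr1; apply: ler_pM.
Qed.
Lemma dom_inv_zt : dom 0 (-1) (fun z => (zt z)^-1).
Proof.
split; first exact: measurable_invr measurable_zt.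
move=> d M d0 M1; have [A [A0 hA]] := wgtNd_ge d0 M1.
exists (A * A); split => [|z [_ bx bz]]; first exact: mulr_ge0.
apply: le_trans (wgt_inv _) _; rewrite !sub0r wgtD.
have := hA _ bx; have := hA _ bz => h1 h2.
rewrite (_ : _ * _ = wgt (-1) (zt z) * ((A * wgt (- d) (xi z)) * (A * wgt (- d) (zt z)))); last by ring.
rewrite -[leLHS]mulr1; apply: ler_wpM2l; first exact: wgt_ge0.
by rewrite -[leLHS]mulr1; apply: ler_pM.
Qed.

Lemma dom_ln_xi : dom 0 0 (fun z => ln `|xi z|).
Proof.
split; first exact: measurable_lnabs measurable_xi.
move=> d M d0 M1; have [A [A0 hA]] := wgtNd_ge d0 M1; have [B [B0 hB]] := ln_wgt d0 M1.
exists (B * A); split => [|z [_ bx bz]]; first exact: mulr_ge0.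
rewrite !sub0r mulrACA -[leLHS]mulr1; apply: ler_pM => //; [exact: hB|exact: hA].
Qed.
Lemma dom_ln_zt : dom 0 0 (fun z => ln `|zt z|).
Proof.
split; first exact: measurable_lnabs measurable_zt.
move=> d M d0 M1; have [A [A0 hA]] := wgtNd_ge d0 M1; have [B [B0 hB]] := ln_wgt d0 M1.
exists (A * B); split => [|z [_ bx bz]]; first exact: mulr_ge0.
rewrite !sub0r mulrACA -[leLHS]mul1r; apply: ler_pM => //; [exact: hA|exact: hB].
Qed.

(** e^(q tau) is the product of |xi|^(q / 2) and |zt|^(q / 2). *)
Lemma dom_tau q (h : R -> R) : continuous h ->
  (forall T : R, exists C, forall t : R, t <= T -> `|h t| <= C * expR (q * t)) ->
  dom (q / 2) (q / 2) (fun z => h (tau z)).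
Proof.
move=> ch hh; split.
  apply: (@measurableT_comp _ _ _ _ _ _ (h : mR -> mR) _ (tau : T3 -> mR)); last exact: measurable_tau.
  exact: continuous_measurable_fun.
move=> d M d0 M1; have [A [A0 hA]] := wgtNd_ge d0 M1.
have [C hC] := hh (ln M).
have C0 : 0 <= C.
  have := le_trans (normr_ge0 _) (hC (ln M) (lexx _)); rewrite pmulr_lge0 ?expR_gt0//.
exists (C * (A * A)); split => [|z [_ bx bz]]; first by rewrite !mulr_ge0.
have l1 := ln_norm_le M1 bx; have l2 := ln_norm_le M1 bz.
have tM : tau z <= ln M by rewrite /tau; lra.
apply: (le_trans (hC _ tM)); rewrite -[leRHS]mulrA; apply: ler_wpM2l => //.
have -> : expR (q * tau z) = wgt (q / 2) (xi z) * wgt (q / 2) (zt z).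
  by rewrite /wgt -expRD /tau; congr expR; lra.
have := hA _ bx; have := hA _ bz => h1 h2; rewrite !wgtD.
rewrite (_ : _ * _ * _ = (wgt (q / 2) (xi z) * wgt (q / 2) (zt z)) * ((A * wgt (- d) (xi z)) * (A * wgt (- d) (zt z)))); last by ring.
rewrite -[leLHS]mulr1; apply: ler_wpM2l; first by rewrite mulr_ge0 ?wgt_ge0.
by rewrite -[leLHS]mulr1; apply: ler_pM.
Qed.

(** An integrable majorant, which is a product in the coordinates of
    [along_P]. *)
Let W q r M z := wgt_on 0 M z.1.1 * wgt_on q M (xi z) * wgt_on r M (zt z).

(** In the coordinates of [along_P] the value of xi is b + b. *)
Lemma integrable_wgt_twice q M : -1 < q -> 0 < M -> leb.-integrable setT (EFin \o (fun b => wgt_on q M (b + b))).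
Proof.
move=> q1 M0; have i := integrable_wgt_on q1 M0.
have C0 : 0 <= 1 + expR (q * ln 2) by rewrite addr_ge0 ?expR_ge0.
apply: (le_integrable measurableT _ _ (integrableZl measurableT (1 + expR (q * ln 2)) i)).
  apply/measurable_EFinP; apply: (@measurableT_comp _ _ _ _ _ _ (wgt_on q M : mR -> mR)).
    exact: measurable_wgt_on.
  exact: measurable_funD.
move=> b _; rewrite /= lee_fin ger0_norm ?wgt_on_ge0// ger0_norm; last by rewrite mulr_ge0 ?wgt_on_ge0.
have [bM|bM] := lerP `|b + b| M; last first.
  have -> : wgt_on q M (b + b) = 0.
    rewrite /wgt_on indicE memNset ?mulr0//= in_itv/= -ler_norml.
    by apply/negP; rewrite -ltNge.
  by apply: mulr_ge0 => //; exact: wgt_on_ge0.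
have bM' : `|b| <= M.
  apply: le_trans bM; have -> : b + b = 2 * b by ring.
  by rewrite normrM ger0_norm// ler_peMl// ler1n.
rewrite !wgt_onE// /wgt; have [->|b0] := eqVneq b 0.
  by rewrite addr0 normr0 ln0// !mulr0 expR0 mulr1 lerDl expR_ge0.
have -> : b + b = 2 * b by ring.
rewrite normrM lnM ?posrE ?normr_gt0// mulrDr expRD ger0_norm//.
by apply: ler_wpM2r; [exact: expR_ge0|rewrite lerDr].
Qed.

Lemma integrable_majorant q r M : -1 < q -> -1 < r -> 0 < M ->
  (mu3 R).-integrable setT (EFin \o W q r M).
Proof.
move=> q1 r1 M0.
have mw p (f : T3 -> mR) : measurable_fun setT f -> measurable_fun [set: T3] (fun z => wgt_on p M (f z) : mR).
  by move=> mf; apply: measurableT_comp mf; exact: measurable_wgt_on.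
have mW : measurable_fun [set: T3] (W q r M : T3 -> mR).
  apply: measurable_funM; [apply: measurable_funM|]; apply: mw.
  - exact: measurableT_comp measurable_fst measurable_fst.
  - exact: measurable_xi.
  - exact: measurable_zt.
apply: (preserves_integrable preserves_along_P); first exact/measurable_EFinP.
have i0 : leb.-integrable setT (EFin \o wgt_on 0 M) by apply: integrable_wgt_on => //; lra.
have i12 := integrable_prod (m1 := leb) (m2 := leb) i0 (integrable_wgt_on r1 M0).
have := integrable_prod (m1 := leb2 R) (m2 := leb) (f1 := fun p : mR * mR => wgt_on 0 M p.1 * wgt_on r M p.2) i12 (integrable_wgt_twice q1 M0).
apply: eq_integrable => // -[[t a] b] _; rewrite /W /along_P /xi /zt /=; congr EFin.
have -> : b + a / 2 + (b - a / 2) = b + b by lra.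
have -> : b + a / 2 - (b - a / 2) = a by lra.
by ring.
Qed.

Lemma dom_integrable q r f g M C : -1 < q -> -1 < r -> 1 <= M -> dom q r f ->
  measurable_fun [set: T3] (g : T3 -> mR) -> (forall z, `|g z| <= C) ->
  (forall z, ~ in_box M z -> g z = 0) ->
  (mu3 R).-integrable setT (fun z => (f z * g z)%:E).
Proof.
move=> q1 r1 M1 [mf hf] mg gC g0.
have M0 : 0 < M by exact: lt_le_trans M1.
pose d := Num.min ((q + 1) / 2) ((r + 1) / 2).
have d0 : 0 < d by rewrite lt_min; apply/andP; split; lra.
have dq : d <= (q + 1) / 2 by rewrite ge_min lexx.
have dr : d <= (r + 1) / 2 by rewrite ge_min lexx orbT.
have [A [A0 hA]] := hf _ _ d0 M1.
have q2 : -1 < q - d by lra.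
have r2 : -1 < r - d by lra.
have C0 : 0 <= C by exact: le_trans (gC (0, 0, 0)).
apply: (le_integrable measurableT _ _ (integrableZl measurableT (A * C) (integrable_majorant q2 r2 M0))).
  by apply/measurable_EFinP; exact: measurable_funM.
move=> z _; rewrite /= lee_fin.
have W0 : 0 <= W (q - d) (r - d) M z.
  by apply: mulr_ge0; [apply: mulr_ge0|]; exact: wgt_on_ge0.
have AC : 0 <= A * C by exact: mulr_ge0.
rewrite [leRHS]ger0_norm; last exact: mulr_ge0.
have [bz|bz] := pselect (in_box M z); last by rewrite g0// mulr0 normr0; exact: mulr_ge0.
have [b1 b2 b3] := bz.
rewrite normrM /W !wgt_onE// wgt0 mul1r mulrAC.
exact: (ler_pM (normr_ge0 _) (normr_ge0 _) (hA _ bz) (gC z)).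
Qed.

Lemma in_box_compact (K : set (R * R * R)) : compact K ->
  exists2 M, 1 <= M & forall z, K z -> in_box M z.
Proof.
move=> /compact_bounded[B [_ hB]].
have B1 : B < Num.max 1 (B + 1) by rewrite lt_max ltrDl ltr01 orbT.
have B0 : 1 <= Num.max 1 (B + 1) by rewrite le_max lexx.
move: (Num.max 1 (B + 1)) B1 B0 => N N1 N0; exists (N + N); first lra.
move=> z Kz; have h : `|z| <= N := hB _ N1 _ Kz.
have [/andP[h1 h2] h3] : (`|z.1.1| <= N) && (`|z.1.2| <= N) /\ `|z.2| <= N.
  have h1 : `|z.1| <= N by apply: le_trans h; rewrite /Num.norm /= le_max lexx.
  split; last by apply: le_trans h; rewrite [leRHS]/Num.norm /= le_max lexx orbT.
  by apply/andP; split; apply: le_trans h1; rewrite [leRHS]/Num.norm /= le_max lexx ?orbT.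
split; first by lra.
  by apply: (le_trans (ler_normD _ _)); exact: lerD.
by apply: (le_trans (ler_normB _ _)); exact: lerD.
Qed.

Lemma dom_L1loc q r f : -1 < q -> -1 < r -> dom q r f -> L1loc f.
Proof.
move=> q1 r1 df K cK; have [M M1 KM] := in_box_compact cK.
have mK := compact_measurable3 cK.
apply/(integrable_mkcond _ mK).
have := @dom_integrable q r f (\1_K) M 1 q1 r1 M1 df.
have m1 : measurable_fun [set: T3] (\1_K : T3 -> mR) by exact: measurable_indic.
have b1 z : `|\1_K z : R| <= 1 by rewrite indicE; case: (_ \in _); rewrite ?normr1 ?normr0.
have z1 z : ~ in_box M z -> \1_K z = 0 :> R by move=> nb; rewrite indicE memNset// => /KM.
move=> /(_ m1 b1 z1); apply: eq_integrable => // z _; rewrite patchE indicE.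
by case: ifP; rewrite ?mulr1 ?mulr0.
Qed.
End Dominated.

(** * Test functions *)

Section TestFunctions.
Context {R : realType}.
Notation mR := (measurableTypeR R).
Notation T3 := (mR * mR * mR)%type.
Notation R3 := (R * R * R)%type.
Implicit Types (rho : R3 -> R) (p v w : R3) (h s : R).

Lemma smooth3_derive v rho : smooth3 rho -> smooth3 ('D_v rho).
Proof. by move=> sr l; have := sr (rcons l v); rewrite foldr_rcons. Qed.

Lemma smooth3_continuous rho : smooth3 rho -> continuous rho.
Proof. by move=> /(_ [::])[]. Qed.

Lemma smooth3_is_derive rho p v : smooth3 rho -> is_derive p v rho ('D_v rho p).
Proof. by move=> /(_ [::])[_ d]; exact/derivableP/d. Qed.

Lemma test_derive v rho : test_function rho -> test_function ('D_v rho).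
Proof.
move=> [sr [K cK K0]]; split; first exact: smooth3_derive.
exists K => // p Kp; have oK : open (~` K).
  by apply: closed_openC; apply: compact_closed cK; exact: norm_hausdorff.
have e : \near p, rho p = cst 0 p.
  by have := open_nbhs_nbhs (conj oK (Kp : (~` K) p)); apply: filterS => q /K0.
by rewrite (near_eq_derive v e) derive_cst.
Qed.

Lemma test_bounded rho : test_function rho ->
  [/\ measurable_fun [set: T3] (rho : T3 -> mR),
      exists C, forall p, `|rho p| <= C &
      exists2 M, 1 <= M & forall p, ~ in_box M p -> rho p = 0].
Proof.
move=> [/smooth3_continuous cr [K cK K0]]; split; first exact: continuous_measurable3.
  have := @continuous_compact _ _ rho K (continuous_subspaceT cr) cK.
  move=> /compact_bounded[B [_ hB]].
  have BN : B < Num.max 0 (B + 1) by rewrite lt_max ltrDl ltr01 orbT.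
  exists (Num.max 0 (B + 1)) => p.
  have [Kp|/K0 ->] := pselect (K p); last by rewrite normr0 le_max lexx.
  by apply: (hB _ BN); exists p.
have [M M1 KM] := in_box_compact cK; exists M => // p np.
by apply: K0 => /KM.
Qed.

Lemma smooth3_vec (psi : R3 -> 'rV[R]_3) i l : smooth3 psi ->
  foldr (fun v (g : R3 -> R) p => 'D_v g p) (fun p => psi p 0 i) l =
  (fun p => foldr (fun v (g : R3 -> 'rV[R]_3) p => 'D_v g p) psi l p 0 i).
Proof.
move=> sp; elim: l => //= v l ->; apply/funext => p.
have [_ /(_ p v) d] := sp l.
by rewrite (derive_mx d) mxE.
Qed.

Lemma test_vec (psi : R3 -> 'rV[R]_3) i : test_function psi ->
  test_function (fun p => psi p 0 i).
Proof.
move=> [sp [K cK K0]]; split; last by exists K => // p /K0 ->; rewrite mxE.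
move=> l; rewrite /= smooth3_vec//; have [c d] := sp l; split.
  move=> p; apply: (@continuous_comp _ _ _ _ (fun M : 'rV[R]_3 => M 0 i)); first exact: c.
  exact: coord_continuous.
by move=> p v; have /derivable_mxP := d p v; apply.
Qed.

Lemma derive_vec (psi : R3 -> 'rV[R]_3) i v p : smooth3 psi ->
  'D_v psi p 0 i = 'D_v (fun p => psi p 0 i) p.
Proof. by move=> /(_ [::])[_ d]; rewrite (derive_mx (d p v)) mxE. Qed.

Lemma line_derive rho p v s : smooth3 rho ->
  is_derive s 1 (fun s => rho (p + s *: v)) ('D_v rho (p + s *: v)).
Proof.
move=> sr; have [d e] := smooth3_is_derive (p + s *: v) v sr.
have E : (fun h : R => h^-1 *: (((fun s => rho (p + s *: v)) \o shift s) (h *: 1) - rho (p + s *: v))) =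
         (fun h : R => h^-1 *: ((rho \o shift (p + s *: v)) (h *: v) - rho (p + s *: v))).
  by apply/funext => h /=; rewrite [h *: 1]mulr1 scalerDl addrCA addrA.
by split; [rewrite /derivable E|rewrite /derive E].
Qed.

Lemma mvt_from_zero (f df : R -> R) h : (forall s, is_derive s 1 f (df s)) ->
  exists2 c, `|c| <= `|h| & f h - f 0 = h * df c.
Proof.
move=> D; have cf a b : {within `[a, b], continuous f}.
  by apply: continuous_in_subspaceT => x _; exact: is_derive_continuous (D x).
have [h0|h0] := lerP 0 h.
  have [c] := MVT_segment h0 (fun x _ => D x) (cf _ _).
  rewrite in_itv/= => /andP[c0 ch] e; exists c; first by rewrite !ger0_norm.
  by rewrite e subr0 mulrC.
have [c] := MVT_segment (ltW h0) (fun x _ => D x) (cf _ _).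
rewrite in_itv/= => /andP[ch c0] e; exists c; first by rewrite !ler0_norm ?lerN2// ltW.
by rewrite -opprB e; ring.
Qed.

Lemma close_points (g : R3 -> R) p v w (e : R) : continuous g -> 0 < e ->
  exists2 d, 0 < d & forall s1 s2 h, `|h| < d -> `|s1| <= `|h| -> `|s2| <= `|h| ->
    `|g (p + s1 *: v + s2 *: w) - g p| < e.
Proof.
move=> cg e0; have /cvgrPdist_lt /(_ e e0) /nbhs_ballP[r /= r0 hr] := cg p.
have N0 : 0 < `|v| + `|w| + 1 by rewrite ltr_wpDl// addr_ge0.
exists (r / (`|v| + `|w| + 1)); first by rewrite divr_gt0.
move=> s1 s2 h hd h1 h2; rewrite distrC; apply: hr; rewrite -ball_normE /=.
rewrite -addrA opprD addNKr normrN.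
apply: (le_lt_trans (ler_normD _ _)); rewrite !normrZ.
rewrite ltr_pdivlMr// in hd; apply: le_lt_trans hd.
have k1 : `|s1| * `|v| <= `|h| * `|v| by exact: ler_wpM2r.
have k2 : `|s2| * `|w| <= `|h| * `|w| by exact: ler_wpM2r.
by have := normr_ge0 h; lra.
Qed.

(** [smooth3] only speaks of directional derivatives; their additivity follows
    from the mean value theorem and the continuity of one of them. *)
Lemma deriveD_direction rho p v w : smooth3 rho ->
  'D_(v + w) rho p = 'D_v rho p + 'D_w rho p.
Proof.
move=> sr; apply: cvg_lim => //.
have [dv ev] := smooth3_is_derive p v sr.
have c1 : (fun h : R => h^-1 *: (rho (p + h *: v) - rho p)) @ 0^' --> 'D_v rho p.
  apply: cvg_trans dv; apply: near_eq_cvg; apply: nearW => h.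
  by rewrite /= [_ + p]addrC.
have c2 : (fun h : R => h^-1 *: (rho (p + h *: v + h *: w) - rho (p + h *: v))) @ 0^' --> 'D_w rho p.
  apply/cvgrPdist_lt => e e0.
  have [d d0 hd] := close_points p v w (smooth3_continuous (smooth3_derive w sr)) e0.
  near=> h; have h0 : h != 0 by near: h; exact: nbhs_dnbhs_neq.
  have [c ch] := mvt_from_zero h (fun s => line_derive (p + h *: v) w s sr).
  rewrite scale0r addr0 => ->; rewrite [_ *: _]mulrA mulVf// mul1r distrC.
  apply: (hd h c h) => //; near: h; apply: dnbhs0_lt => //.
apply: (cvg_trans _ (cvgD c1 c2)); apply: near_eq_cvg; near=> h.
transitivity (h^-1 *: (rho (p + h *: v) - rho p) + h^-1 *: (rho (p + h *: v + h *: w) - rho (p + h *: v))).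
  by [].
rewrite -scalerDr; congr (_ *: _); rewrite addrC subrKA /=.
by rewrite [_ + p]addrC scalerDr addrA.
Unshelve. all: by end_near. Qed.

Lemma second_difference rho p v w h : smooth3 rho ->
  exists c1 c2, [/\ `|c1| <= `|h|, `|c2| <= `|h| &
    rho (p + h *: v + h *: w) - rho (p + h *: v) - (rho (p + h *: w) - rho p)
    = h * (h * 'D_w ('D_v rho) (p + c1 *: v + c2 *: w))].
Proof.
move=> sr; pose f s := rho (p + h *: w + s *: v) - rho (p + s *: v).
have df s : is_derive s 1 f ('D_v rho (p + h *: w + s *: v) - 'D_v rho (p + s *: v)).
  by apply: is_deriveB; exact: line_derive.
have [c1 c1h e1] := mvt_from_zero h df.
have [c2 c2h e2] := mvt_from_zero h (fun s => line_derive (p + c1 *: v) w s (smooth3_derive v sr)).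
have ac a b : p + a + b = p + b + a := addrAC _ _ _.
exists c1, c2; split => //; rewrite -e2 scale0r addr0.
by rewrite (ac (c1 *: v)) -e1 /f !scale0r !addr0 (ac (h *: v)).
Qed.

Let swap_middle (a b c d : R) : a - b - (c - d) = a - c - (b - d).
Proof. by ring. Qed.

Let halves (a a' b c e : R) : a = a' -> `|a' - c| < e / 2 -> `|a - b| < e / 2 -> `|b - c| <= e.
Proof.
move=> <- n1 n2; rewrite (_ : b - c = (a - c) - (a - b)); last by ring.
by apply: (le_trans (ler_normB _ _)); lra.
Qed.

(** Both sides are limits of the same second difference, divided by h^2. *)
Lemma deriveC_direction rho p v w : smooth3 rho ->
  'D_w ('D_v rho) p = 'D_v ('D_w rho) p.
Proof.
move=> sr; apply/eqP; rewrite -subr_eq0 -normr_le0; apply/ler_addgt0Pl => e e0; rewrite addr0.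
have e2 : 0 < e / 2 by lra.
have [d1 d10 h1] := close_points p v w (smooth3_continuous (smooth3_derive w (smooth3_derive v sr))) e2.
have [d2 d20 h2] := close_points p w v (smooth3_continuous (smooth3_derive v (smooth3_derive w sr))) e2.
have [h [h0 hd1 hd2]] : exists h, [/\ 0 < h, `|h| < d1 & `|h| < d2].
  have m0 : 0 < Num.min d1 d2 by rewrite lt_min d10.
  have m1 : Num.min d1 d2 <= d1 by rewrite ge_min lexx.
  have m2 : Num.min d1 d2 <= d2 by rewrite ge_min lexx orbT.
  move: (Num.min d1 d2) m0 m1 m2 => m m0 m1 m2; exists (m / 2).
  by rewrite ger0_norm; [split|]; lra.
have ac a b : p + a + b = p + b + a := addrAC _ _ _.
have [c1 [c2 [k1 k2 E1]]] := second_difference p v w h sr.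
have [c3 [c4 [k3 k4 E2]]] := second_difference p w v h sr.
have E : 'D_w ('D_v rho) (p + c1 *: v + c2 *: w) = 'D_v ('D_w rho) (p + c3 *: w + c4 *: v).
  apply: (mulfI (lt0r_neq0 h0)); apply: (mulfI (lt0r_neq0 h0)).
  rewrite (ac (h *: w) (h *: v)) in E2.
  by apply: (etrans (esym E1)); apply: etrans E2; exact: swap_middle.
exact: (halves E (h2 _ _ _ hd2 k3 k4) (h1 _ _ _ hd1 k1 k2)).
Qed.
End TestFunctions.

(** * Integration by parts along lines *)

Section LineIBP.
Context {R : realType}.
Notation leb := (@lebesgue_measure R).
Notation mR := (measurableTypeR R).
Notation T3 := (mR * mR * mR)%type.
Notation R3 := (R * R * R)%type.
Variables (T : R3 -> R3) (v : R3).
Implicit Types f g rho : R3 -> R.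
Hypothesis pT : preserves (mu3 R) (T : T3 -> T3).
Hypothesis lineT : forall p (b : R), T (p, b) = T (p, 0) + b *: v.
Hypothesis properT : forall p (M : R), exists2 B : R, 0 < B & forall b : R, B <= `|b| -> ~ in_box M (T (p, b)).

(** On null lines the parameter b = 0 is the crossing with the light cone. *)
Definition has_line_derivative (f g : R3 -> R) (p : R * R) := exists l : R,
  (forall b : R, b != 0 -> is_derive b 1 (fun b => f (T (p, b))) (g (T (p, b))) /\
    {for b, continuous (fun b => g (T (p, b)))}) /\
  f (T (p, b)) @[b --> 0^'] --> l.

Let fiber_zero f g rho p : test_function rho ->
  leb.-integrable setT (fun b : mR => (f (T (p, b)) * 'D_v rho (T (p, b)) + g (T (p, b)) * rho (T (p, b)))%:E) ->
  has_line_derivative f g p ->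
  (\int[leb]_b (f (T (p, b)) * 'D_v rho (T (p, b)) + g (T (p, b)) * rho (T (p, b)))%:E = 0)%E.
Proof.
move=> tr ih [l [D Hl]]; have sr := tr.1.
have [_ _ [M M1 hM]] := test_bounded tr.
have [B B0 hB] := properT p M.
have lf (s : R3 -> R) : (fun b : R => s (T (p, b))) = (fun b => s (T (p, 0) + b *: v)).
  by apply/funext => b; rewrite [in LHS]lineT.
have dr (b : R) : is_derive b 1 (fun b => rho (T (p, b))) ('D_v rho (T (p, b))).
  by rewrite lf [in X in is_derive _ _ _ X]lineT; exact: line_derive.
have cD (b : R) : {for b, continuous (fun b => 'D_v rho (T (p, b)))}.
  rewrite (lf ('D_v rho)); exact: (is_derive_continuous (line_derive _ v b (smooth3_derive v sr))).
apply: (@ftc_through_singularity R _ (fun b => f (T (p, b)) * rho (T (p, b))) (l * rho (T (p, 0))) B) => //.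
- move=> b b0; have [df cg] := D b b0; split.
    by der; ring.
  apply: continuousD; apply: continuousM => //.
    exact: is_derive_continuous df.
  exact: is_derive_continuous (dr b).
- apply: cvgM => //; apply: cvg_trans (is_derive_continuous (dr 0)).
  by apply: cvg_app; exact: nbhs_dnbhs.
by move=> b /hB /hM ->; rewrite mulr0.
Qed.

(** On almost every line the derivative of f rho has integral zero by the
    singular fundamental theorem, and Fubini's theorem assembles the lines. *)
Lemma integration_by_parts_along (f g rho : R3 -> R) : test_function rho ->
  (mu3 R).-integrable setT (fun z : T3 => (f z * 'D_v rho z)%:E) ->
  (mu3 R).-integrable setT (fun z : T3 => (g z * rho z)%:E) ->
  {ae leb2 R, forall p, has_line_derivative f g p} ->
  (\int[mu3 R]_z (f z * 'D_v rho z)%:E = - \int[mu3 R]_z (g z * rho z)%:E)%E.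
Proof.
move=> tr i1 i2 aeg.
pose F (z : T3) : \bar R := (f z * 'D_v rho z + g z * rho z)%:E.
have iF : (mu3 R).-integrable setT F by exact: integrableD i1 i2.
have iFT := integrable_preserves pT iF.
have mF := measurable_int _ iF.
suff F0 : (\int[mu3 R]_z F z = 0)%E.
  have := integralD measurableT i1 i2; rewrite -[X in X = _]/(\int[mu3 R]_z F z)%E F0.
  rewrite !integral_EFin// -EFinD -EFinN => -[e]; congr EFin; apply/eqP.
  by rewrite -addr_eq0 e.
rewrite (preserves_integral pT)//.
have iFT' : (leb2 R \x leb)%E.-integrable setT (F \o T) by exact: iFT.
apply: etrans (esym (integral12_prod_meas1 iFT')) _.
rewrite -[RHS](@integral0 _ _ _ (leb2 R) setT).
apply: ae_eq_integral => //; first exact: measurable_fubini_F iFT'.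
have := ae_integrable1 iFT'; apply: (@filterS2 _ _ (ae_filter_ringOfSetsType (leb2 R)) _ _ _ _ aeg) => p gp ip _.
exact: fiber_zero.
Qed.
End LineIBP.
Arguments has_line_derivative {R} T f g p.

Section NullIBP.
Context {R : realType}.
Notation leb := (@lebesgue_measure R).
Notation mR := (measurableTypeR R).
Notation T3 := (mR * mR * mR)%type.
Notation R3 := (R * R * R)%type.
Implicit Types (p : R * R) (b : R) (f g rho : R3 -> R).

Definition eP : R3 := ex R + ey R.
Definition eM : R3 := ex R - ey R.

Lemma along_P_line p b : along_P (p, b) = along_P (p, 0) + b *: eP.
Proof.
rewrite /along_P /eP /ex /ey /=; congr ((_, _), _); rewrite /= ?addr0 ?add0r /GRing.scale /=; lra.
Qed.
Lemma along_M_line p b : along_M (p, b) = along_M (p, 0) + b *: eM.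
Proof.
rewrite /along_M /eM /ex /ey /=; congr ((_, _), _); rewrite /= ?subr0 ?sub0r /GRing.scale /=; lra.
Qed.
Lemma along_t_line p b : along_t (p, b) = along_t (p, 0) + b *: et R.
Proof.
rewrite /along_t /et /=; congr ((_, _), _); rewrite /= ?scaler0 ?addr0 ?add0r//.
by rewrite [b *: _]mulr1.
Qed.

Lemma xi_P p b : xi (along_P (p, b)) = 2 * b.
Proof. by rewrite /xi /along_P /=; lra. Qed.
Lemma zt_P p b : zt (along_P (p, b)) = p.2.
Proof. by rewrite /zt /along_P /=; lra. Qed.
Lemma xi_M p b : xi (along_M (p, b)) = p.2.
Proof. by rewrite /xi /along_M /=; lra. Qed.
Lemma zt_M p b : zt (along_M (p, b)) = 2 * b.
Proof. by rewrite /zt /along_M /=; lra. Qed.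

Let proper (T : R3 -> R3) : (forall p (b M : R), in_box M (T (p, b)) -> `|b| <= M) ->
  forall p (M : R), exists2 B : R, 0 < B & forall b : R, B <= `|b| -> ~ in_box M (T (p, b)).
Proof.
move=> h p M; exists (`|M| + 1); first by rewrite ltr_wpDl.
move=> b Bb /h bM; have := ler_norm M; move: bM Bb; lra.
Qed.

Let twice b M : `|2 * b| <= M -> `|b| <= M.
Proof. by rewrite normrM ger0_norm//; have := normr_ge0 b; lra. Qed.

Let proper_P := proper (fun p b M (h : in_box M (along_P (p, b))) =>
  let: And3 _ k _ := h in twice (eq_ind _ (fun y => `|y| <= M) k _ (xi_P p b))).
Let proper_M := proper (fun p b M (h : in_box M (along_M (p, b))) =>
  let: And3 _ _ k := h in twice (eq_ind _ (fun y => `|y| <= M) k _ (zt_M p b))).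
Let proper_t := proper (fun p b M (h : in_box M (along_t (p, b))) =>
  let: And3 k _ _ := h in (k : `|b| <= M)).

Lemma wgt_lim0 (q : R) : 0 < q -> wgt q (2 * b) @[b --> 0^'] --> (0 : R).
Proof.
move=> q0; apply/cvgrPdist_lt => e e0; near=> b.
have b0 : b != 0 by near: b; exact: nbhs_dnbhs_neq.
have b1 : `|b| < expR (ln e / q) / 2 by near: b; apply: dnbhs0_lt; rewrite divr_gt0 ?expR_gt0.
rewrite sub0r normrN ger0_norm ?wgt_ge0// /wgt.
have nb : 0 < `|2 * b| by rewrite normr_gt0 mulf_neq0.
rewrite -[e]lnK ?posrE// ltr_expR mulrC -ltr_pdivlMr//.
rewrite -ltr_expR lnK ?posrE// normrM ger0_norm// mulrC -ltr_pdivlMr//.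
Unshelve. all: by end_near. Qed.

Let squeeze (F G : R -> R) (C : R) : (forall b : R, `|b| <= 2^-1 -> `|F b| <= C * G b) ->
  G b @[b --> 0^'] --> (0 : R) -> F b @[b --> 0^'] --> (0 : R).
Proof.
move=> FG G0; have CG : (fun b => C * G b) @ 0^' --> (0 : R).
  by have := cvgM (cvg_cst C) G0; rewrite mulr0; apply.
apply/norm_cvg0P; have z0 : (fun _ : R => 0 : R) @ 0^' --> (0 : R) by exact: cvg_cst.
apply: (squeeze_cvgr _ z0 CG); near=> b.
rewrite normr_ge0 /= FG//; apply/ltW; near: b; apply: dnbhs0_lt; rewrite invr_gt0//.
Unshelve. all: by end_near. Qed.

Lemma dom_lim_P q r f p : 0 < q -> dom q r f -> f (along_P (p, b)) @[b --> 0^'] --> (0 : R).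
Proof.
move=> q0 [_ hf]; have q2 : 0 < q / 2 by lra.
pose M := 1 + `|p.1| + `|p.2|.
have M1 : 1 <= M by rewrite /M -addrA lerDl addr_ge0.
have [C [C0 hC]] := hf _ _ q2 M1.
apply: (squeeze (C := C * wgt (r - q / 2) p.2) _ (wgt_lim0 q2)) => b b1.
apply: le_trans (hC _ _) _.
  split; rewrite ?xi_P ?zt_P /along_P /= /M.
  - by have := normr_ge0 p.2; lra.
  - by rewrite normrM ger0_norm//; have := normr_ge0 p.2; have := normr_ge0 p.1; lra.
  - by have := normr_ge0 p.1; lra.
rewrite xi_P zt_P (_ : q - q / 2 = q / 2); last by lra.
by rewrite [wgt (q / 2) _ * _]mulrC mulrA.
Qed.

Lemma dom_lim_M q r f p : 0 < r -> dom q r f -> f (along_M (p, b)) @[b --> 0^'] --> (0 : R).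
Proof.
move=> r0 [_ hf]; have r2 : 0 < r / 2 by lra.
pose M := 1 + `|p.1| + `|p.2|.
have M1 : 1 <= M by rewrite /M -addrA lerDl addr_ge0.
have [C [C0 hC]] := hf _ _ r2 M1.
apply: (squeeze (C := C * wgt (q - r / 2) p.2) _ (wgt_lim0 r2)) => b b1.
apply: le_trans (hC _ _) _.
  split; rewrite ?xi_M ?zt_M /along_M /= /M.
  - by have := normr_ge0 p.2; lra.
  - by have := normr_ge0 p.1; lra.
  - by rewrite normrM ger0_norm//; have := normr_ge0 p.2; have := normr_ge0 p.1; lra.
rewrite xi_M zt_M (_ : r - r / 2 = r / 2); last by lra.
by rewrite mulrA.
Qed.

Lemma ae_second_neq0 : {ae leb2 R, forall p, p.2 != 0}.
Proof.
exists (setT `*` [set 0]); split.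
- by apply: measurableX.
- rewrite /leb2 product_measure1E// -[RHS](mule0 (leb setT)).
  by congr (_ * _)%E; exact: lebesgue_measure_set1.
by move=> [a b] /= /negP; rewrite negbK => /eqP.
Qed.

Lemma test_integrable q r f rho : -1 < q -> -1 < r -> dom q r f -> test_function rho ->
  (mu3 R).-integrable setT (fun z : T3 => (f z * rho z)%:E).
Proof.
move=> q1 r1 df /test_bounded[m [C hC] [M M1 hM]].
exact: dom_integrable q1 r1 M1 df m hC hM.
Qed.

Let dom_affine q r f (c : R) : dom q r (fun z => f z - c) -> dom (Num.min q 0) (Num.min r 0) f.
Proof.
move=> h; rewrite (_ : f = (fun z => (f z - c) + c)); last by apply/funext => z; rewrite subrK.
apply: domD; [apply: dom_weaken h|apply: dom_weaken (dom_cst c)]; by rewrite ge_min lexx ?orbT.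
Qed.
Let min_gt (q : R) : -1 < q -> -1 < Num.min q 0.
Proof. by move=> h; rewrite lt_min h; lra. Qed.

(** As q > 0, f - c tends to 0 at the light cone along almost every line. *)
Lemma ibp_P q r q' r' f g (c : R) rho : 0 < q -> -1 < r -> -1 < q' -> -1 < r' ->
  dom q r (fun z => f z - c) -> dom q' r' g ->
  (forall p b, p.2 != 0 -> b != 0 ->
    is_derive b 1 (fun b => f (along_P (p, b))) (g (along_P (p, b))) /\
    {for b, continuous (fun b => g (along_P (p, b)))}) ->
  test_function rho ->
  (\int[mu3 R]_z (f z * 'D_eP rho z)%:E = - \int[mu3 R]_z (g z * rho z)%:E)%E.
Proof.
move=> q0 r1 q1' r1' df dg D tr.
apply: (integration_by_parts_along preserves_along_P along_P_line proper_P tr).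
- apply: test_integrable (dom_affine df) (test_derive _ tr); apply: min_gt => //; lra.
- exact: test_integrable dg tr.
apply: (@filterS _ _ (ae_filter_ringOfSetsType (leb2 R)) _ _ _ ae_second_neq0) => p p0; exists c; split; first by move=> b; exact: D.
have h := cvgD (dom_lim_P p q0 df) (cvg_cst c); rewrite add0r in h.
apply: (cvg_trans _ (h _ _)); apply: near_eq_cvg; apply: nearW => b; exact: subrK.
Qed.

Lemma ibp_M q r q' r' f g (c : R) rho : -1 < q -> 0 < r -> -1 < q' -> -1 < r' ->
  dom q r (fun z => f z - c) -> dom q' r' g ->
  (forall p b, p.2 != 0 -> b != 0 ->
    is_derive b 1 (fun b => f (along_M (p, b))) (g (along_M (p, b))) /\
    {for b, continuous (fun b => g (along_M (p, b)))}) ->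
  test_function rho ->
  (\int[mu3 R]_z (f z * 'D_eM rho z)%:E = - \int[mu3 R]_z (g z * rho z)%:E)%E.
Proof.
move=> q1 r0 q1' r1' df dg D tr.
apply: (integration_by_parts_along preserves_along_M along_M_line proper_M tr).
- apply: test_integrable (dom_affine df) (test_derive _ tr); apply: min_gt => //; lra.
- exact: test_integrable dg tr.
apply: (@filterS _ _ (ae_filter_ringOfSetsType (leb2 R)) _ _ _ ae_second_neq0) => p p0; exists c; split; first by move=> b; exact: D.
have h := cvgD (dom_lim_M p r0 df) (cvg_cst c); rewrite add0r in h.
apply: (cvg_trans _ (h _ _)); apply: near_eq_cvg; apply: nearW => b; exact: subrK.
Qed.

Lemma ibp_t q r q' r' f g rho : -1 < q -> -1 < r -> -1 < q' -> -1 < r' ->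
  dom q r f -> dom q' r' g ->
  (forall p b, is_derive b 1 (fun b => f (along_t (p, b))) (g (along_t (p, b))) /\
    {for b, continuous (fun b => g (along_t (p, b)))}) ->
  test_function rho ->
  (\int[mu3 R]_z (f z * 'D_(et R) rho z)%:E = - \int[mu3 R]_z (g z * rho z)%:E)%E.
Proof.
move=> q1 r1 q1' r1' df dg D tr.
apply: (integration_by_parts_along preserves_along_t along_t_line proper_t tr).
- exact: test_integrable df (test_derive _ tr).
- exact: test_integrable dg tr.
apply: nearW => p; exists (f (along_t (p, 0))); split; first by move=> b _; exact: D.
apply: cvg_trans (is_derive_continuous (D p 0).1).
by apply: cvg_app; exact: nbhs_dnbhs.
Qed.

(** A function constant on the lines has a limit at the light cone on each of
    them, whatever its growth from line to line: logarithms of the transverse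
    coordinate are allowed. *)
Lemma ibp_P_const q r f rho : -1 < q -> -1 < r -> dom q r f ->
  (forall p b, f (along_P (p, b)) = f (along_P (p, 0))) -> test_function rho ->
  (\int[mu3 R]_z (f z * 'D_eP rho z)%:E = 0)%E.
Proof.
move=> q1 r1 df fc tr.
rewrite (@integration_by_parts_along R _ _ preserves_along_P along_P_line proper_P f (cst 0) rho tr).
- by rewrite integral0_eq ?oppe0// => z _; rewrite mul0r.
- exact: test_integrable df (test_derive _ tr).
- by apply: eq_integrable (integrable0 _ _) => // z _; rewrite mul0r.
apply: nearW => p; exists (f (along_P (p, 0))).
have -> : (fun b => f (along_P (p, b))) = cst (f (along_P (p, 0))) by apply/funext => b; rewrite fc.
by split; [move=> b _; split; [exact: is_derive_cst|exact: cst_continuous]|exact: cvg_cst].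
Qed.

Lemma ibp_M_const q r f rho : -1 < q -> -1 < r -> dom q r f ->
  (forall p b, f (along_M (p, b)) = f (along_M (p, 0))) -> test_function rho ->
  (\int[mu3 R]_z (f z * 'D_eM rho z)%:E = 0)%E.
Proof.
move=> q1 r1 df fc tr.
rewrite (@integration_by_parts_along R _ _ preserves_along_M along_M_line proper_M f (cst 0) rho tr).
- by rewrite integral0_eq ?oppe0// => z _; rewrite mul0r.
- exact: test_integrable df (test_derive _ tr).
- by apply: eq_integrable (integrable0 _ _) => // z _; rewrite mul0r.
apply: nearW => p; exists (f (along_M (p, 0))).
have -> : (fun b => f (along_M (p, b))) = cst (f (along_M (p, 0))) by apply/funext => b; rewrite fc.
by split; [move=> b _; split; [exact: is_derive_cst|exact: cst_continuous]|exact: cvg_cst].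
Qed.
End NullIBP.

(** * Functions of the hyperbolic radius *)

Section ConeFunctions.
Context {R : realType}.
Notation mR := (measurableTypeR R).
Notation T3 := (mR * mR * mR)%type.
Notation R3 := (R * R * R)%type.
Implicit Types (F dF : bool -> R -> R) (p : R * R) (b : R) (z : R3).

Definition horizontal z := 0 < xi z * zt z.
(** Glues a function of ln a on the cones |x| > |y| with another one on the
    cones |y| > |x|. *)
Definition sel F z : R := F (horizontal z) (tau z).
Definition alpha z : R := (ln `|xi z| - ln `|zt z|) / 2.

Let ln_twice (b : R) : b != 0 -> is_derive b 1 (fun b => ln `|2 * b|) b^-1.
Proof.
move=> b0; have h : is_derive b 1 (fun b : R => 2 * b) 2 by der; ring.
have n0 : 2 * b != 0 by rewrite mulf_neq0.
by apply: (is_derive_eq (dlnabs n0 h)); field.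
Qed.

Let tau_P p b : b != 0 -> is_derive b 1 (fun b => tau (along_P (p, b))) (xi (along_P (p, b)))^-1.
Proof.
move=> b0; have h := ln_twice b0; rewrite xi_P.
have -> : (fun b => tau (along_P (p, b))) = (fun b => (ln `|2 * b| + ln `|p.2|) * 2^-1).
  by apply/funext => y; rewrite /tau xi_P zt_P.
by der; field.
Qed.
Let tau_M p b : b != 0 -> is_derive b 1 (fun b => tau (along_M (p, b))) (zt (along_M (p, b)))^-1.
Proof.
move=> b0; have h := ln_twice b0; rewrite zt_M.
have -> : (fun b => tau (along_M (p, b))) = (fun b => (ln `|p.2| + ln `|2 * b|) * 2^-1).
  by apply/funext => y; rewrite /tau xi_M zt_M.
by der; field.
Qed.

Lemma alpha_P p b : b != 0 -> is_derive b 1 (fun b => alpha (along_P (p, b))) (xi (along_P (p, b)))^-1.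
Proof.
move=> b0; have h := ln_twice b0; rewrite xi_P.
have -> : (fun b => alpha (along_P (p, b))) = (fun b => (ln `|2 * b| - ln `|p.2|) * 2^-1).
  by apply/funext => y; rewrite /alpha xi_P zt_P.
by der; field.
Qed.
Lemma alpha_M p b : b != 0 -> is_derive b 1 (fun b => alpha (along_M (p, b))) (- (zt (along_M (p, b)))^-1).
Proof.
move=> b0; have h := ln_twice b0; rewrite zt_M.
have -> : (fun b => alpha (along_M (p, b))) = (fun b => (ln `|p.2| - ln `|2 * b|) * 2^-1).
  by apply/funext => y; rewrite /alpha xi_M zt_M.
by der; field.
Qed.

Let same_sign (a b : R) : a != 0 -> b != 0 -> \forall y \near b, (0 < a * y) = (0 < a * b).
Proof.
move=> a0 b0; have := mulf_neq0 a0 b0.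
have c : {for b, continuous (fun y : R => a * y)}.
  apply: (is_derive_continuous (a := a)); by der; ring.
rewrite neq_lt => /orP[n|n].
  have cn : \forall y \near b, a * y < 0 by exact: (c _ (near_lt n)).
  near=> y; have y0 : a * y < 0 by near: y.
  by rewrite (lt_gtF n) (lt_gtF y0).
have cn : \forall y \near b, 0 < a * y by exact: (c _ (near_gt n)).
near=> y; have y0 : 0 < a * y by near: y.
by rewrite n y0.
Unshelve. all: by end_near. Qed.

Lemma sel_P F dF p b : (forall h (t : R), is_derive t 1 (F h) (dF h t)) -> p.2 != 0 -> b != 0 ->
  is_derive b 1 (fun b => sel F (along_P (p, b))) ((xi (along_P (p, b)))^-1 * sel dF (along_P (p, b))).
Proof.
move=> D p0 b0; pose h := horizontal (along_P (p, b)).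
apply: (@near_eq_is_derive _ _ _ (fun b => F h (tau (along_P (p, b))))).
  have a0 : p.2 * 2 != 0 by rewrite mulf_neq0.
  have := same_sign a0 b0; apply: filterS => y e.
  rewrite /sel /h /horizontal !xi_P !zt_P; congr (F _ _).
  by rewrite [2 * y * _]mulrC [2 * b * _]mulrC !mulrA e.
rewrite mulrC; exact: is_derive_chain (D _ _) (tau_P p b0).
Qed.

Lemma sel_M F dF p b : (forall h (t : R), is_derive t 1 (F h) (dF h t)) -> p.2 != 0 -> b != 0 ->
  is_derive b 1 (fun b => sel F (along_M (p, b))) ((zt (along_M (p, b)))^-1 * sel dF (along_M (p, b))).
Proof.
move=> D p0 b0; pose h := horizontal (along_M (p, b)).
apply: (@near_eq_is_derive _ _ _ (fun b => F h (tau (along_M (p, b))))).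
  have a0 : p.2 * 2 != 0 by rewrite mulf_neq0.
  have := same_sign a0 b0; apply: filterS => y e.
  by rewrite /sel /h /horizontal !xi_M !zt_M; congr (F _ _); rewrite !mulrA e.
rewrite mulrC; exact: is_derive_chain (D _ _) (tau_M p b0).
Qed.

Lemma dom_sel (q : R) F : (forall h, continuous (F h)) ->
  (forall h (T : R), exists C, forall t : R, t <= T -> `|F h t| <= C * expR (q * t)) ->
  dom (q / 2) (q / 2) (sel F).
Proof.
move=> cF hF; have [mt bt] := dom_tau (cF true) (hF true).
have [mf bf] := dom_tau (cF false) (hF false).
have selE : sel F = fun z => if horizontal z then F true (tau z) else F false (tau z).
  by apply/funext => z; rewrite /sel; case: (horizontal z).
split.
  rewrite selE; apply: measurable_fun_ifT => //.
  apply: measurable_fun_ltr => //; apply: measurable_funM; [exact: measurable_xi|exact: measurable_zt].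
move=> d M d0 M1; have [A [A0 hA]] := bt _ _ d0 M1; have [B [B0 hB]] := bf _ _ d0 M1.
exists (A + B); split; first exact: addr_ge0.
move=> z bz; rewrite mulrDl; have w0 (q1 q2 x y : R) : 0 <= wgt q1 x * wgt q2 y by rewrite mulr_ge0 ?wgt_ge0.
rewrite selE; case: (horizontal z).
  by apply: (le_trans (hA _ bz)); rewrite lerDl mulr_ge0.
by apply: (le_trans (hB _ bz)); rewrite lerDr mulr_ge0.
Qed.

(** [dom 0 0] is an algebra over which every [dom q r] is a module; the
    tactics [dom0] and [domk] below use this. *)
Lemma dom0_add f g : dom 0 0 f -> dom 0 0 g -> @dom R 0 0 (fun z => f z + g z).
Proof. exact: domD. Qed.
Lemma dom0_mul f g : dom 0 0 f -> dom 0 0 g -> @dom R 0 0 (fun z => f z * g z).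
Proof. by move=> hf hg; have := domM hf hg; rewrite !addr0. Qed.
Lemma domk_mull q r f g : dom q r f -> dom 0 0 g -> @dom R q r (fun z => f z * g z).
Proof. by move=> hf hg; have := domM hf hg; rewrite !addr0. Qed.
Lemma domk_mulr q r f g : dom 0 0 f -> dom q r g -> @dom R q r (fun z => f z * g z).
Proof. by move=> hf hg; have := domM hf hg; rewrite !add0r. Qed.
End ConeFunctions.

Lemma dom0_exp {R : realType} (f : R * R * R -> R) n : dom 0 0 f -> dom 0 0 (fun z => f z ^+ n).
Proof.
move=> hf; elim: n => [|n IHn]; first exact: dom_cst.
by rewrite (_ : (fun z => _) = (fun z => f z * f z ^+ n)); [exact: dom0_mul|apply/funext => z; rewrite exprS].
Qed.

Ltac dom_hyp := match goal with
  | H : dom ?q ?r ?f |- dom ?q ?r ?f => exact H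
  | H : dom ?q ?r ?f |- dom ?q ?r (fun z => ?f z) => exact H end.
Ltac dom0 := first [ dom_hyp | lazymatch goal with
  | |- dom _ _ (fun z => @?f z + @?g z) => notypeclasses refine (@dom0_add _ f g _ _); cbv beta; dom0
  | |- dom _ _ (fun z => - @?f z) => notypeclasses refine (@domN _ _ _ f _); cbv beta; dom0
  | |- dom _ _ (fun z => @?f z * @?g z) => notypeclasses refine (@dom0_mul _ f g _ _); cbv beta; dom0
  | |- dom _ _ (fun z => @?f z ^+ ?n) => notypeclasses refine (@dom0_exp _ f n _); cbv beta; dom0
  | |- dom _ _ (fun z => ?a) => notypeclasses refine (dom_cst a) end ].
Ltac domk := first [ dom_hyp | lazymatch goal with
  | |- dom _ _ (fun z => @?f z + @?g z) => notypeclasses refine (@domD _ _ _ f g _ _); cbv beta; domk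
  | |- dom _ _ (fun z => - @?f z) => notypeclasses refine (@domN _ _ _ f _); cbv beta; domk
  | |- dom _ _ (fun z => @?f z * @?g z) => first
    [ notypeclasses refine (@domk_mull _ _ _ f g _ _); cbv beta; [ domk | dom0 ]
    | notypeclasses refine (@domk_mulr _ _ _ f g _ _); cbv beta; [ dom0 | domk ] ] end ].

(** * Vector algebra and null derivatives *)

Section Vectors.
Context {R : realType}.
Implicit Types (u v : 'rV[R]_3) (e : sign).

Lemma vec3_0 (x y z : R) : vec3 x y z 0 0 = x. Proof. by rewrite mxE. Qed.
Lemma vec3_1 (x y z : R) : vec3 x y z 0 1 = y. Proof. by rewrite mxE. Qed.
Lemma vec3_2 (x y z : R) : vec3 x y z 0 2%:R = z. Proof. by rewrite mxE. Qed.
Definition vec3E := (vec3_0, vec3_1, vec3_2).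

Lemma ord3P (Q : 'I_3 -> Prop) : Q 0 -> Q 1 -> Q 2%:R -> forall i, Q i.
Proof.
move=> q0 q1 q2 i; have : i \in [:: 0; 1; 2%:R] by case: i => -[|[|[|]]].
by rewrite !inE => /orP[/eqP->|/orP[/eqP->|/eqP->]].
Qed.

Lemma mul_eta v e i : (v *m Defs.eta R e) 0 i = v 0 i * vec3 (sgv R e) 1 1 0 i.
Proof. by rewrite /Defs.eta mul_mx_diag mxE. Qed.

Lemma wedge_0 e u v : wedge e u v 0 0 = sgv R e * (u 0 1 * v 0 2%:R - u 0 2%:R * v 0 1).
Proof. by rewrite /wedge mul_eta /cross !vec3E mulrC. Qed.
Lemma wedge_1 e u v : wedge e u v 0 1 = u 0 2%:R * v 0 0 - u 0 0 * v 0 2%:R.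
Proof. by rewrite /wedge mul_eta /cross !vec3E mulr1. Qed.
Lemma wedge_2 e u v : wedge e u v 0 2%:R = u 0 0 * v 0 1 - u 0 1 * v 0 0.
Proof. by rewrite /wedge mul_eta /cross !vec3E mulr1. Qed.

Lemma innerE e u v : inner e u v = sgv R e * (u 0 0 * v 0 0) + u 0 1 * v 0 1 + u 0 2%:R * v 0 2%:R.
Proof.
have E (f : 'I_3 -> R) : \sum_i f i = f 0 + f 1 + f 2%:R.
  rewrite !big_ord_recl big_ord0 addr0 addrA; congr (f _ + f _ + f _); exact: val_inj.
have t i : (v *m Defs.eta R e)^T i 0 = v 0 i * vec3 (sgv R e) 1 1 0 i by rewrite mxE mul_eta.
by rewrite /inner mxE E !t !vec3E; ring.
Qed.
End Vectors.

Section Balance.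
Context {R : realType}.
Notation leb := (@lebesgue_measure R).
Notation mR := (measurableTypeR R).
Notation T3 := (mR * mR * mR)%type.
Notation R3 := (R * R * R)%type.
Implicit Types (rho : R3 -> R) (z : R3).

Lemma ae_off_cone : {ae mu3 R, forall z : T3, xi z != 0 /\ zt z != 0}.
Proof.
have null (f : T3 -> mR) (T : T3 -> T3) : measurable_fun setT f -> preserves (mu3 R) T ->
    (forall p (y : R), f (T (p, y)) = 2 * y) -> (mu3 R).-negligible [set z | f z = 0].
  move=> mf pT fT; have mN : measurable [set z : T3 | f z = 0].
    by rewrite -[X in measurable X]setTI (_ : [set z | _] = f @^-1` [set 0])//; exact: mf.
  exists [set z | f z = 0]; split => //; rewrite -pT.2//.
  have -> : T @^-1` [set z | f z = 0] = setT `*` [set 0].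
    apply/seteqP; split => -[p y] /=; rewrite fT; last by move=> [_ ->]; rewrite mulr0.
    by move=> /eqP; rewrite mulf_eq0 pnatr_eq0 /= => /eqP ->.
  have h := @product_measure1E _ _ _ _ R (leb2 R) leb setT [set (0 : R)] measurableT (measurable_set1 0).
  apply: (etrans h); rewrite -[RHS](mule0 (leb2 R setT)).
  by congr (_ * _)%E; exact: lebesgue_measure_set1.
have n1 := null _ _ measurable_xi preserves_along_P (fun p y => xi_P p y).
have n2 := null _ _ measurable_zt preserves_along_M (fun p y => zt_M p y).
apply: negligibleS (negligibleU n1 n2) => z /= /not_andP[|] /negP; rewrite negbK => /eqP; by [left|right].
Qed.

Lemma derive_ex rho z : smooth3 rho -> 'D_(ex R) rho z = ('D_eP rho z + 'D_eM rho z) / 2.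
Proof.
move=> sr; have e1 := deriveD_direction z (ex R) (ey R) sr.
have := deriveD_direction z eM (ey R) sr; rewrite subrK => e2.
by rewrite -[eP]/(ex R + ey R) e1 e2; field.
Qed.
Lemma derive_ey rho z : smooth3 rho -> 'D_(ey R) rho z = ('D_eP rho z - 'D_eM rho z) / 2.
Proof.
move=> sr; have e1 := deriveD_direction z (ex R) (ey R) sr.
have := deriveD_direction z eM (ey R) sr; rewrite subrK => e2.
by rewrite -[eP]/(ex R + ey R) e1 e2; field.
Qed.

Lemma wave_operator rho z : smooth3 rho ->
  'D_(ex R) ('D_(ex R) rho) z - 'D_(ey R) ('D_(ey R) rho) z = 'D_eP ('D_eM rho) z.
Proof.
move=> sr; have sx := smooth3_derive (ex R) sr; have sy := smooth3_derive (ey R) sr.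
have sM := smooth3_derive eM sr.
have M (g : R3 -> R) : smooth3 g -> 'D_eM g z = 'D_(ex R) g z - 'D_(ey R) g z.
  by move=> sg; have := deriveD_direction z eM (ey R) sg; rewrite subrK => ->; rewrite addrK.
have h1 : 'D_eP ('D_eM rho) z = 'D_(ex R) ('D_eM rho) z + 'D_(ey R) ('D_eM rho) z.
  exact: (deriveD_direction z (ex R) (ey R) sM).
have h2 := deriveC_direction z eM (ex R) sr; have h3 := deriveC_direction z eM (ey R) sr.
have h4 := deriveC_direction z (ey R) (ex R) sr.
apply: esym; apply: (etrans h1); apply: (etrans (congr2 +%R h2 h3)).
apply: (etrans (congr2 +%R (M _ sx) (M _ sy))).
apply: (etrans (congr1 (fun q => _ + (q - _)) h4)); exact: subrKA.
Qed.

Lemma integral_lin2 (X0 X1 : T3 -> R) (a0 a1 : R) : (mu3 R).-integrable setT (EFin \o X0) ->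
  (mu3 R).-integrable setT (EFin \o X1) ->
  (\int[mu3 R]_z (a0 * X0 z + a1 * X1 z)%:E)%E =
  (a0 * (\int[mu3 R]_z X0 z) + a1 * (\int[mu3 R]_z X1 z))%:E.
Proof.
move=> i0 i1.
have j0 : (mu3 R).-integrable setT (EFin \o (fun z => a0 * X0 z)) by have := integrableZl measurableT a0 i0.
have j1 : (mu3 R).-integrable setT (EFin \o (fun z => a1 * X1 z)) by have := integrableZl measurableT a1 i1.
rewrite integral_EFin//; last exact: integrableD j0 j1.
by congr EFin; rewrite (RintegralD _ j0 j1)// (RintegralZl _ _ i0)// (RintegralZl _ _ i1).
Qed.

Lemma integral_lin3 (X0 X1 X2 : T3 -> R) (a0 a1 a2 : R) : (mu3 R).-integrable setT (EFin \o X0) ->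
  (mu3 R).-integrable setT (EFin \o X1) -> (mu3 R).-integrable setT (EFin \o X2) ->
  (\int[mu3 R]_z (a0 * X0 z + a1 * X1 z + a2 * X2 z)%:E)%E =
  (a0 * (\int[mu3 R]_z X0 z) + a1 * (\int[mu3 R]_z X1 z) + a2 * (\int[mu3 R]_z X2 z))%:E.
Proof.
move=> i0 i1 i2.
have j0 : (mu3 R).-integrable setT (EFin \o (fun z => a0 * X0 z)) by have := integrableZl measurableT a0 i0.
have j1 : (mu3 R).-integrable setT (EFin \o (fun z => a1 * X1 z)) by have := integrableZl measurableT a1 i1.
have j : (mu3 R).-integrable setT (EFin \o (fun z => a0 * X0 z + a1 * X1 z)) by exact: integrableD j0 j1.
have := integral_lin2 1 a2 j i2; rewrite mul1r (RintegralD _ j0 j1)// (RintegralZl _ _ i0)// (RintegralZl _ _ i1)//.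
by move=> <-; apply: eq_integral => z _; rewrite mul1r.
Qed.

(** Three integrations by parts whose right-hand sides cancel pointwise off
    the light cone, which is a null set. *)
Lemma integral_balance (X0 X1 X2 Y0 Y1 Y2 : T3 -> R) (a0 a1 a2 : R) :
  (mu3 R).-integrable setT (EFin \o X0) -> (mu3 R).-integrable setT (EFin \o X1) ->
  (mu3 R).-integrable setT (EFin \o X2) -> (mu3 R).-integrable setT (EFin \o Y0) ->
  (mu3 R).-integrable setT (EFin \o Y1) -> (mu3 R).-integrable setT (EFin \o Y2) ->
  (\int[mu3 R]_z (X0 z)%:E = - \int[mu3 R]_z (Y0 z)%:E)%E ->
  (\int[mu3 R]_z (X1 z)%:E = - \int[mu3 R]_z (Y1 z)%:E)%E ->
  (\int[mu3 R]_z (X2 z)%:E = - \int[mu3 R]_z (Y2 z)%:E)%E ->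
  (forall z, xi z != 0 -> zt z != 0 -> a0 * Y0 z + a1 * Y1 z + a2 * Y2 z = 0) ->
  (\int[mu3 R]_z (a0 * X0 z + a1 * X1 z + a2 * X2 z)%:E = 0)%E.
Proof.
move=> i0 i1 i2 j0 j1 j2 e0 e1 e2 bal.
have conv (X Y : T3 -> R) : (mu3 R).-integrable setT (EFin \o X) -> (mu3 R).-integrable setT (EFin \o Y) ->
    (\int[mu3 R]_z (X z)%:E = - \int[mu3 R]_z (Y z)%:E)%E -> \int[mu3 R]_z X z = - \int[mu3 R]_z Y z.
  by move=> iX iY; rewrite !integral_EFin// => -[].
rewrite integral_lin3// (conv _ _ i0 j0 e0) (conv _ _ i1 j1 e1) (conv _ _ i2 j2 e2); have := integral_lin3 a0 a1 a2 j0 j1 j2.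
have -> : (\int[mu3 R]_z (a0 * Y0 z + a1 * Y1 z + a2 * Y2 z)%:E = 0)%E.
  rewrite -[RHS](@integral0 _ _ _ (mu3 R) setT); apply: ae_eq_integral => //.
    have mY (Y : T3 -> R) : (mu3 R).-integrable setT (EFin \o Y) -> measurable_fun setT Y.
      by move=> /measurable_int /measurable_EFinP.
    apply/measurable_EFinP; apply: measurable_funD; first apply: measurable_funD;
      by apply: measurable_funM => //; first [exact: mY j0|exact: mY j1|exact: mY j2].
  apply: (@filterS _ _ (ae_filter_ringOfSetsType (mu3 R)) _ _ _ ae_off_cone) => z [x0 z0] _.
  by rewrite bal.
by move=> -[e]; congr EFin; rewrite !mulrN -!opprD -e oppr0.
Qed.

Lemma integral_lin3_eq0 (X0 X1 X2 : T3 -> R) (a0 a1 a2 : R) :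
  (mu3 R).-integrable setT (EFin \o X0) -> (mu3 R).-integrable setT (EFin \o X1) ->
  (mu3 R).-integrable setT (EFin \o X2) ->
  (\int[mu3 R]_z (X0 z)%:E = 0)%E -> (\int[mu3 R]_z (X1 z)%:E = 0)%E -> (\int[mu3 R]_z (X2 z)%:E = 0)%E ->
  (\int[mu3 R]_z (a0 * X0 z + a1 * X1 z + a2 * X2 z)%:E = 0)%E.
Proof.
move=> i0 i1 i2 e0 e1 e2.
by rewrite integral_lin3// /Rintegral e0 e1 e2 /= !mulr0 !addr0.
Qed.
End Balance.

(** * The ansatz solves the system *)

Section Ansatz.
Context {R : realType} (e : sign).
Variables (mu k b c : R).
Hypothesis K0 : 0 < kap2 k b c.
Notation kap := (Num.sqrt (kap2 k b c)).
Notation ep := (sgv R e).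
Notation mR := (measurableTypeR R).
Notation T3 := (mR * mR * mR)%type.
Notation R3 := (R * R * R)%type.
Variables S Sd B Ph : bool -> R -> R.
Definition cone_sign (h : bool) : R := if h then 1 else -1.
Hypothesis HP : forall h, profile e mu k b c (cone_sign h) (S h) (Sd h) (B h) (Ph h).
Implicit Types (z : R3) (p : R * R) (y s : R) (w : R3 -> R).

(** The fields of the ansatz, whose map is u = (H_, G_ cos th_, G_ sin th_).
    D_ and DD_ are the first two derivatives of s in tau, K_ is that of beta, and
    E_ is x^2 - y^2 off the light cone ([relE]). *)
Definition D_ := sel Sd.
Definition G_ := sel (fun h t => Gamma e (S h t)).
Definition H_ := sel (fun h t => dGamma e (S h t)).
Definition F_ := sel (fun h t => FF e (S h t)).
Definition Q_ := sel (fun h t => QQ e (S h t)).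
Definition E_ := sel (fun h t => cone_sign h * expR (2 * t)).
Definition Ph_ := sel Ph.
Definition K_ z := - c * Q_ z.
Definition DD_ z := mu * E_ z * G_ z
  + G_ z * (- (k ^+ 2 * H_ z - 2 * k ^+ 2 * F_ z + k * b) - c ^+ 2 * Q_ z ^+ 2).
Definition th_ z := sel B z - c / 2 * tau z + k * alpha z + mu * z.1.1.
Definition C_ z := cos (th_ z).
Definition N_ z := sin (th_ z).
Definition phi_ z := c * alpha z + b * tau z + Ph_ z.

Lemma relG z : G_ z * G_ z = ep * (1 - H_ z ^+ 2).
Proof. exact: Gamma_sqr. Qed.
Lemma relQ z : Q_ z * (1 + H_ z) = 1.
Proof. by rewrite /Q_ /H_ /sel /QQ mulVf// gt_eqF// dGamma1_gt0//; exact: profile_le1 (HP _) _. Qed.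
Lemma relE z : xi z != 0 -> zt z != 0 -> (xi z)^-1 * (zt z)^-1 * E_ z = 1.
Proof.
move=> x0 z0; have n0 := mulf_neq0 x0 z0.
have -> : E_ z = xi z * zt z; last by field; rewrite x0 z0.
rewrite /E_ /sel /tau (_ : 2 * _ = ln `|xi z| + ln `|zt z|); last by field.
rewrite expRD !lnK ?posrE ?normr_gt0// -normrM /cone_sign /horizontal.
by case: ltgtP n0 => // h _; [rewrite gtr0_norm// mul1r|rewrite ltr0_norm// mulN1r opprK].
Qed.

(** Null derivatives, for both families at once: in the direction of x + y (s
    = 1, w = 1 / (x + y)) and of x - y (s = -1, w = 1 / (x - y)) the derivatives
    of tau and alpha are w and s w. uX0, uX1, uX2 are the components of the
    derivative of u. *)
Definition uX0 s w z := w z * (- ep * (G_ z * D_ z)).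
Definition uX1 s w z := w z * (H_ z * D_ z * C_ z - G_ z * (s * k + K_ z) * N_ z).
Definition uX2 s w z := w z * (H_ z * D_ z * N_ z + G_ z * (s * k + K_ z) * C_ z).
(** The flux: the exterior product of u and its null derivative, plus s phi
    times the null derivative, component by component and with the signs of the
    metric. The first equation pairs it with the other null derivative of the test
    function. *)
Definition A0 s w z := w z * (ep * (G_ z * G_ z * (s * k + K_ z)) - s * phi_ z * (ep * (G_ z * D_ z))).
Definition A1 s w z := w z * (- (D_ z * N_ z) - H_ z * G_ z * (s * k + K_ z) * C_ z
  + s * phi_ z * (H_ z * D_ z * C_ z - G_ z * (s * k + K_ z) * N_ z)).
Definition A2 s w z := w z * (D_ z * C_ z - H_ z * G_ z * (s * k + K_ z) * N_ z
  + s * phi_ z * (H_ z * D_ z * N_ z + G_ z * (s * k + K_ z) * C_ z)).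

Definition dK_ z := - c * (ep * G_ z * Q_ z ^+ 2 * D_ z).
(** The rates of th_ and phi_ in a null direction. *)
Definition dth s z := s * k + K_ z.
Definition dphi s z := s * c + b - 2 * k * F_ z.

(** The derivatives of the flux in the other null direction, of which w' is
    the rate. *)
Definition dA0 s w w' z := w z * w' z * (ep * (2 * (G_ z * (H_ z * D_ z)) * (s * k + K_ z) + G_ z * G_ z * dK_ z)
  - s * (dphi (- s) z * (ep * (G_ z * D_ z)) + phi_ z * (ep * (H_ z * D_ z * D_ z + G_ z * DD_ z)))).
Definition dA1 s w w' z := w z * w' z * (- (DD_ z * N_ z + D_ z * (C_ z * dth (- s) z))
  - ((- ep * (G_ z * D_ z)) * G_ z * (s * k + K_ z) * C_ z + H_ z * (H_ z * D_ z) * (s * k + K_ z) * C_ z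
     + H_ z * G_ z * dK_ z * C_ z - H_ z * G_ z * (s * k + K_ z) * (N_ z * dth (- s) z))
  + s * dphi (- s) z * (H_ z * D_ z * C_ z - G_ z * (s * k + K_ z) * N_ z)
  + s * phi_ z * ((- ep * (G_ z * D_ z)) * D_ z * C_ z + H_ z * DD_ z * C_ z - H_ z * D_ z * (N_ z * dth (- s) z)
     - (H_ z * D_ z * (s * k + K_ z) * N_ z + G_ z * dK_ z * N_ z + G_ z * (s * k + K_ z) * (C_ z * dth (- s) z)))).
Definition dA2 s w w' z := w z * w' z * (DD_ z * C_ z - D_ z * (N_ z * dth (- s) z)
  - ((- ep * (G_ z * D_ z)) * G_ z * (s * k + K_ z) * N_ z + H_ z * (H_ z * D_ z) * (s * k + K_ z) * N_ z
     + H_ z * G_ z * dK_ z * N_ z + H_ z * G_ z * (s * k + K_ z) * (C_ z * dth (- s) z))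
  + s * dphi (- s) z * (H_ z * D_ z * N_ z + G_ z * (s * k + K_ z) * C_ z)
  + s * phi_ z * ((- ep * (G_ z * D_ z)) * D_ z * N_ z + H_ z * DD_ z * N_ z + H_ z * D_ z * (C_ z * dth (- s) z)
     + (H_ z * D_ z * (s * k + K_ z) * C_ z + G_ z * dK_ z * C_ z - G_ z * (s * k + K_ z) * (N_ z * dth (- s) z)))).

Notation ixi := (fun z : R3 => (xi z)^-1).
Notation izt := (fun z : R3 => (zt z)^-1).

Let ep_case : ep = 1 \/ ep = -1.
Proof. by case: (e); [left|right]. Qed.

(** Off the light cone the first equation is a polynomial identity modulo the
    three relations [relG], [relQ], [relE] between the fields: the equations for
    s, beta and Ph were used in computing the derivatives of the fluxes. *)
Lemma balance0 z : xi z != 0 -> zt z != 0 -> dA0 1 ixi izt z + dA0 (-1) izt ixi z = 0.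
Proof.
move=> x0 z0; rewrite /dA0 /dth /dphi /dK_ /DD_ /K_ (_ : F_ z = ep * (1 - H_ z))//.
have r2 : Q_ z * H_ z = 1 - Q_ z by rewrite -(relQ z); ring.
move: r2 (relG z) (relE x0 z0).
move: (G_ z) (H_ z) (Q_ z) (E_ z) (D_ z) (C_ z) (N_ z) (phi_ z) (xi z)^-1 (zt z)^-1 => G H Q E D C N f w w'.
by have [-> | ->] := ep_case => r2 r1 r3; ring: r1 r2 r3.
Qed.

Lemma balance1 z : xi z != 0 -> zt z != 0 ->
  dA1 1 ixi izt z + dA1 (-1) izt ixi z = 2 * (- (mu * (G_ z * N_ z))).
Proof.
move=> x0 z0; rewrite /dA1 /dth /dphi /dK_ /DD_ /K_ (_ : F_ z = ep * (1 - H_ z))//.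
have r2 : Q_ z * H_ z = 1 - Q_ z by rewrite -(relQ z); ring.
move: r2 (relG z) (relE x0 z0).
move: (G_ z) (H_ z) (Q_ z) (E_ z) (D_ z) (C_ z) (N_ z) (phi_ z) (xi z)^-1 (zt z)^-1 => G H Q E D C N f w w'.
by have [-> | ->] := ep_case => r2 r1 r3; ring: r1 r2 r3.
Qed.

Lemma balance2 z : xi z != 0 -> zt z != 0 ->
  dA2 1 ixi izt z + dA2 (-1) izt ixi z = 2 * (mu * (G_ z * C_ z)).
Proof.
move=> x0 z0; rewrite /dA2 /dth /dphi /dK_ /DD_ /K_ (_ : F_ z = ep * (1 - H_ z))//.
have r2 : Q_ z * H_ z = 1 - Q_ z by rewrite -(relQ z); ring.
move: r2 (relG z) (relE x0 z0).
move: (G_ z) (H_ z) (Q_ z) (E_ z) (D_ z) (C_ z) (N_ z) (phi_ z) (xi z)^-1 (zt z)^-1 => G H Q E D C N f w w'.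
by have [-> | ->] := ep_case => r2 r1 r3; ring: r1 r2 r3.
Qed.

(** What the computation of derivatives uses of a null direction, so that it
    is done once for both. *)
Record direction (T : R3 -> R3) (w w' : R3 -> R) (s : R) : Prop := Direction {
  dir_sel : forall F dF : bool -> R -> R, (forall h (t : R), is_derive t 1 (F h) (dF h t)) ->
    forall p y, p.2 != 0 -> y != 0 ->
    is_derive y 1 (fun y => sel F (T (p, y))) (w (T (p, y)) * sel dF (T (p, y)));
  dir_alpha : forall p y, y != 0 -> is_derive y 1 (fun y => alpha (T (p, y))) (s * w (T (p, y)));
  dir_t : forall p y, is_derive y 1 (fun y => (T (p, y)).1.1) 0;
  dir_w : forall p y, y != 0 -> is_derive y 1 (fun y => w (T (p, y))) (- 2 * w (T (p, y)) ^+ 2);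
  dir_w' : forall p y, is_derive y 1 (fun y => w' (T (p, y))) 0 }.

Let inv_twice y : y != 0 -> is_derive y 1 (fun y : R => (2 * y)^-1) (- 2 * (2 * y)^-1 ^+ 2).
Proof.
move=> y0; have h : is_derive y 1 (fun y : R => 2 * y) 2 by der; ring.
have n0 : 2 * y != 0 by rewrite mulf_neq0.
by apply: (is_derive_eq (dV n0 h)); field.
Qed.

Lemma direction_P : direction along_P ixi izt 1.
Proof.
split.
- by move=> F dF D p y p0 y0; exact: sel_P.
- by move=> p y y0; rewrite mul1r; exact: alpha_P.
- by move=> p y; exact: dC.
- move=> p y y0; rewrite xi_P (_ : (fun y => _) = (fun y : R => (2 * y)^-1)); first exact: inv_twice.
  by apply/funext => x; rewrite xi_P.
- move=> p y; rewrite (_ : (fun y => _) = (fun y : R => p.2^-1)); first exact: dC.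
  by apply/funext => x; rewrite zt_P.
Qed.

Lemma direction_M : direction along_M izt ixi (-1).
Proof.
split.
- by move=> F dF D p y p0 y0; exact: sel_M.
- by move=> p y y0; rewrite mulN1r; exact: alpha_M.
- by move=> p y; exact: dC.
- move=> p y y0; rewrite zt_M (_ : (fun y => _) = (fun y : R => (2 * y)^-1)); first exact: inv_twice.
  by apply/funext => x; rewrite zt_M.
- move=> p y; rewrite (_ : (fun y => _) = (fun y : R => p.2^-1)); first exact: dC.
  by apply/funext => x; rewrite xi_M.
Qed.

Section AlongDirection.
Variables (T : R3 -> R3) (w w' : R3 -> R) (s : R).
Hypothesis dirT : direction T w w' s.
Variables (p : R * R) (y : R).
Hypotheses (p0 : p.2 != 0) (y0 : y != 0).
Notation z := (T (p, y)).
Notation line f := (fun y => f (T (p, y))).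

Let dsel F dF (h : forall h (t : R), is_derive t 1 (F h) (dF h t)) :=
  dir_sel dirT h p0 y0.
Let S1 h t : `|S h t| <= 1 := profile_le1 (HP h) t.

Lemma line_D : is_derive y 1 (line D_) (w z * DD_ z).
Proof.
apply: (is_derive_eq (dsel (fun h t => profile_Sd (HP h) t))).
by rewrite /DD_ /gg /sel /E_ /G_ /H_ /F_ /Q_ /sel; ring.
Qed.
Lemma line_G : is_derive y 1 (line G_) (w z * (H_ z * D_ z)).
Proof.
apply: (dsel (dF := fun h t => dGamma e (S h t) * Sd h t)) => h t.
exact: is_derive_chain (is_derive_Gamma _ _) (profile_S (HP h) t).
Qed.
Lemma line_H : is_derive y 1 (line H_) (w z * (- ep * (G_ z * D_ z))).
Proof.
apply: (dsel (dF := fun h t => - ep * (Gamma e (S h t) * Sd h t))) => h t.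
by rewrite mulrA; exact: is_derive_chain (is_derive_dGamma _ _) (profile_S (HP h) t).
Qed.
Lemma line_F : is_derive y 1 (line F_) (w z * (G_ z * D_ z)).
Proof.
apply: (dsel (dF := fun h t => Gamma e (S h t) * Sd h t)) => h t.
exact: is_derive_chain (is_derive_FF _ _) (profile_S (HP h) t).
Qed.
Lemma line_Q : is_derive y 1 (line Q_) (w z * (ep * G_ z * Q_ z ^+ 2 * D_ z)).
Proof.
apply: (dsel (dF := fun h t => ep * Gamma e (S h t) * QQ e (S h t) ^+ 2 * Sd h t)) => h t.
exact: is_derive_chain (is_derive_QQ e (S1 h t)) (profile_S (HP h) t).
Qed.
Lemma line_K : is_derive y 1 (line K_) (w z * dK_ z).
Proof. by have h := line_Q; rewrite /K_ /dK_; der; ring. Qed.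
Lemma line_E : is_derive y 1 (line E_) (w z * (2 * E_ z)).
Proof.
apply: (dsel (dF := fun h t => 2 * (cone_sign h * expR (2 * t)))) => h t.
by der; ring.
Qed.
Lemma line_Ph : is_derive y 1 (line Ph_) (w z * (- 2 * k * F_ z)).
Proof. exact: (dsel (fun h t => profile_Ph (HP h) t)). Qed.
Lemma line_tau : is_derive y 1 (line tau) (w z).
Proof.
apply: (is_derive_eq (dsel (F := fun h t => t) (dF := fun h t => 1) (fun h t => dI t))).
by rewrite /sel mulr1.
Qed.
Lemma line_th : is_derive y 1 (line th_) (w z * dth s z).
Proof.
have h1 := dsel (fun h t => profile_B (HP h) t); have h2 := line_tau.
have h3 := dir_alpha dirT p y0; have h4 := dir_t dirT p y.
rewrite /th_; der; rewrite -[sel _ z]/(- (c * ep / 2) * (F_ z * Q_ z)) (_ : F_ z = ep * (1 - H_ z))//.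
rewrite /dth /K_; have r2 : Q_ z * H_ z = 1 - Q_ z by rewrite -(relQ z); ring.
have r4 : ep * ep = 1 by exact: sgvM.
move: r2 r4; move: (Q_ z) (H_ z) ep => Q H e' r2 r4.
by field: r2 r4.
Qed.
Lemma line_C : is_derive y 1 (line C_) (- (w z * (N_ z * dth s z))).
Proof. by have h := line_th; rewrite /C_ /N_; der; ring. Qed.
Lemma line_N : is_derive y 1 (line N_) (w z * (C_ z * dth s z)).
Proof. by have h := line_th; rewrite /C_ /N_; der; ring. Qed.
Lemma line_phi : is_derive y 1 (line phi_) (w z * dphi s z).
Proof.
have h1 := line_tau; have h2 := line_Ph; have h3 := dir_alpha dirT p y0.
by rewrite /phi_ /dphi; der; ring.
Qed.

Lemma line_u1 : is_derive y 1 (line (fun z => G_ z * C_ z)) (uX1 s w z).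
Proof.
have h1 := line_G; have h2 := line_C.
by rewrite /uX1; der; rewrite /dth; ring.
Qed.
Lemma line_u2 : is_derive y 1 (line (fun z => G_ z * N_ z)) (uX2 s w z).
Proof.
have h1 := line_G; have h2 := line_N.
by rewrite /uX2; der; rewrite /dth; ring.
Qed.

Lemma line_uX0_continuous : {for y, continuous (line (uX0 s w))}.
Proof.
have h1 := line_G; have h2 := line_D; have h3 := dir_w dirT p y0.
by rewrite /uX0; eapply is_derive_continuous; repeat der1.
Qed.
Lemma line_uX1_continuous : {for y, continuous (line (uX1 s w))}.
Proof.
have h1 := line_G; have h2 := line_D; have h3 := dir_w dirT p y0; have h4 := line_C.
have h5 := line_N; have h6 := line_K; have h7 := line_H.
by rewrite /uX1; eapply is_derive_continuous; repeat der1.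
Qed.
Lemma line_uX2_continuous : {for y, continuous (line (uX2 s w))}.
Proof.
have h1 := line_G; have h2 := line_D; have h3 := dir_w dirT p y0; have h4 := line_C.
have h5 := line_N; have h6 := line_K; have h7 := line_H.
by rewrite /uX2; eapply is_derive_continuous; repeat der1.
Qed.

Lemma line_A0 : is_derive y 1 (line (A0 (- s) w')) (dA0 (- s) w' w z).
Proof.
have h1 := line_G; have h2 := line_D; have h3 := dir_w' dirT p y; have h6 := line_K.
have h8 := line_phi; rewrite /A0 /dA0 opprK; der; ring.
Qed.
Lemma line_A1 : is_derive y 1 (line (A1 (- s) w')) (dA1 (- s) w' w z).
Proof.
have h1 := line_G; have h2 := line_D; have h3 := dir_w' dirT p y; have h4 := line_C.
have h5 := line_N; have h6 := line_K; have h7 := line_H; have h8 := line_phi.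
by rewrite /A1 /dA1 opprK; der; ring.
Qed.
Lemma line_A2 : is_derive y 1 (line (A2 (- s) w')) (dA2 (- s) w' w z).
Proof.
have h1 := line_G; have h2 := line_D; have h3 := dir_w' dirT p y; have h4 := line_C.
have h5 := line_N; have h6 := line_K; have h7 := line_H; have h8 := line_phi.
by rewrite /A2 /dA2 opprK; der; ring.
Qed.

Lemma line_dA0_continuous : {for y, continuous (line (dA0 (- s) w' w))}.
Proof.
have h1 := line_G; have h2 := line_D; have h3 := dir_w dirT p y0; have h4 := line_C.
have h5 := line_N; have h6 := line_K; have h7 := line_H; have h8 := line_phi.
have h9 := line_E; have h10 := line_F; have h11 := line_Q; have h12 := dir_w' dirT p y.
by rewrite /dA0 /dphi /dK_ /DD_; eapply is_derive_continuous; repeat der1.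
Qed.
Lemma line_dA1_continuous : {for y, continuous (line (dA1 (- s) w' w))}.
Proof.
have h1 := line_G; have h2 := line_D; have h3 := dir_w dirT p y0; have h4 := line_C.
have h5 := line_N; have h6 := line_K; have h7 := line_H; have h8 := line_phi.
have h9 := line_E; have h10 := line_F; have h11 := line_Q; have h12 := dir_w' dirT p y.
by rewrite /dA1 /dth /dphi /dK_ /DD_; eapply is_derive_continuous; repeat der1.
Qed.
Lemma line_dA2_continuous : {for y, continuous (line (dA2 (- s) w' w))}.
Proof.
have h1 := line_G; have h2 := line_D; have h3 := dir_w dirT p y0; have h4 := line_C.
have h5 := line_N; have h6 := line_K; have h7 := line_H; have h8 := line_phi.
have h9 := line_E; have h10 := line_F; have h11 := line_Q; have h12 := dir_w' dirT p y.
by rewrite /dA2 /dth /dphi /dK_ /DD_; eapply is_derive_continuous; repeat der1.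
Qed.
End AlongDirection.

(** In time the map only rotates, at speed mu. *)
Lemma along_t_th p y : is_derive y 1 (fun y => th_ (along_t (p, y))) mu.
Proof.
rewrite (_ : (fun y => _) = (fun y => th_ (along_t (p, 0)) + mu * y)); last first.
  by apply/funext => x; rewrite /th_ /= mulr0 addr0.
by der; ring.
Qed.
Lemma along_t_u1 p y : is_derive y 1 (fun y => G_ (along_t (p, y)) * C_ (along_t (p, y)))
  (- (mu * (G_ (along_t (p, y)) * N_ (along_t (p, y))))).
Proof.
have h := along_t_th p y; have h2 : is_derive y 1 (fun y => G_ (along_t (p, y))) 0 := dC y (G_ (along_t (p, 0))).
by rewrite /C_ /N_; der; ring.
Qed.
Lemma along_t_u2 p y : is_derive y 1 (fun y => G_ (along_t (p, y)) * N_ (along_t (p, y)))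
  (mu * (G_ (along_t (p, y)) * C_ (along_t (p, y)))).
Proof.
have h := along_t_th p y; have h2 : is_derive y 1 (fun y => G_ (along_t (p, y))) 0 := dC y (G_ (along_t (p, 0))).
by rewrite /C_ /N_; der; ring.
Qed.

(** a^kap is the product of the powers kap / 2 of the two null coordinates. *)
Local Notation kp := (kap / 2).
Let kp0 : 0 < kp. Proof. by rewrite divr_gt0// kap_gt0. Qed.
Let S1 h t : `|S h t| <= 1 := profile_le1 (HP h) t.

Let dom_of_S (f df : R -> R) (q : R) : (forall x : R, `|x| <= 1 -> is_derive x 1 f (df x)) ->
  (forall h (T : R), exists C, forall t : R, t <= T -> `|f (S h t)| <= C * expR (q * t)) ->
  dom (q / 2) (q / 2) (sel (fun h t => f (S h t))).
Proof.
move=> D bf; apply: dom_sel => // h t.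
exact: is_derive_continuous (is_derive_chain (D _ (S1 h t)) (profile_S (HP h) t)).
Qed.
Let dom_of_S0 (f df : R -> R) (C : R) : (forall x : R, `|x| <= 1 -> is_derive x 1 f (df x)) ->
  (forall x : R, `|x| <= 1 -> `|f x| <= C) -> dom 0 0 (sel (fun h t => f (S h t))).
Proof.
move=> D bf; have := @dom_of_S f df 0 D; rewrite mul0r; apply=> h T; exists C => t _.
by rewrite mul0r expR0 mulr1; exact: bf.
Qed.
Let dom_of_Sk (f df : R -> R) (A : R) : (forall x : R, `|x| <= 1 -> is_derive x 1 f (df x)) -> 0 <= A ->
  (forall x : R, `|x| <= 1 -> `|f x| <= A * `|x|) -> dom kp kp (sel (fun h t => f (S h t))).
Proof.
move=> D A0 bf; apply: (dom_of_S D) => h T; have [C hC] := profile_S_bound (HP h).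
exists (A * C) => t _; apply: (le_trans (bf _ (S1 h t))).
by rewrite -mulrA; apply: ler_wpM2l.
Qed.

Lemma dom_D : dom kp kp D_.
Proof.
apply: dom_sel => [h t|h T]; first exact: is_derive_continuous (profile_Sd (HP h) t).
exact: profile_Sd_bound (HP h) T.
Qed.
Lemma dom_G : dom kp kp G_.
Proof.
apply: (dom_of_Sk (df := dGamma e) (A := 3)) => // [x _|x]; [exact: is_derive_Gamma|exact: Gamma_le].
Qed.
Lemma dom_F : dom kp kp F_.
Proof.
apply: (dom_of_Sk (df := Gamma e) (A := 9)) => // [x _|x x1]; first exact: is_derive_FF.
have /andP[f0 f1] := FF_bounds e x1; rewrite ger0_norm//; apply: (le_trans f1).
rewrite -real_normK ?num_real// expr2; apply: ler_wpM2l => //.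
by rewrite -[leRHS]mulr1; apply: ler_wpM2l.
Qed.
Lemma dom_H : dom 0 0 H_.
Proof.
apply: (dom_of_S0 (df := fun x => - ep * Gamma e x) (C := 3)) => [x _|x x1].
  exact: is_derive_dGamma.
by have /andP[? ?] := dGamma_bounds e x1; rewrite ger0_norm//; lra.
Qed.
Lemma dom_Q : dom 0 0 Q_.
Proof.
apply: (dom_of_S0 (df := fun x => ep * Gamma e x * QQ e x ^+ 2) (C := 1)) => [x x1|x x1].
  exact: is_derive_QQ.
by have /andP[? ?] := QQ_bounds e x1; rewrite ger0_norm.
Qed.
Lemma dom_E : dom 0 0 E_.
Proof.
have D h (t : R) : is_derive t 1 (fun t => cone_sign h * expR (2 * t)) (2 * (cone_sign h * expR (2 * t))).
  by der; ring.
have := @dom_sel R 0 (fun h t => cone_sign h * expR (2 * t)); rewrite mul0r; apply.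
  by move=> h t; exact: is_derive_continuous (D h t).
move=> h T; exists (expR (2 * T)) => t tT; rewrite mul0r expR0 mulr1 normrM.
have -> : `|cone_sign h| = 1 by case: h; rewrite /= ?normrN normr1.
by rewrite mul1r ger0_norm ?expR_ge0// ler_expR ler_pM2l.
Qed.
Lemma dom_Ph : dom kp kp Ph_.
Proof.
apply: dom_sel => [h t|h T]; first exact: is_derive_continuous (profile_Ph (HP h) t).
by have [C hC] := profile_Ph_bound (HP h); exists C.
Qed.
Lemma dom_B : dom kp kp (sel B).
Proof.
apply: dom_sel => [h t|h T]; first exact: is_derive_continuous (profile_B (HP h) t).
by have [C hC] := profile_B_bound (HP h); exists C.
Qed.
Lemma dom0_tau : @dom R 0 0 tau.
Proof.
have h1 := @dom_ln_xi R; have h2 := @dom_ln_zt R.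
by rewrite /tau; dom0.
Qed.
Lemma dom0_alpha : @dom R 0 0 alpha.
Proof.
have h1 := @dom_ln_xi R; have h2 := @dom_ln_zt R.
by rewrite /alpha; dom0.
Qed.
Lemma dom0_phi : dom 0 0 phi_.
Proof.
have h1 := dom0_tau; have h2 := dom0_alpha; have h3 : dom 0 0 Ph_ by apply: dom_weaken dom_Ph; exact: ltW.
by rewrite /phi_; dom0.
Qed.
Let measurable_th : measurable_fun [set: T3] (th_ : T3 -> mR).
Proof.
apply: measurable_funD.
  apply: measurable_funD; first apply: measurable_funB.
  - by case: dom_B.
  - by apply: measurable_funM => //; case: dom0_tau.
  - by apply: measurable_funM => //; case: dom0_alpha.
by apply: measurable_funM => //; exact: measurableT_comp measurable_fst measurable_fst.
Qed.
Lemma dom0_C : dom 0 0 C_.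
Proof.
apply: (@dom_bounded _ _ 1).
  apply: (@measurableT_comp _ _ _ _ _ _ (@cos R : mR -> mR)) measurable_th.
  by apply: continuous_measurable_fun; exact: continuous_cos.
by move=> z; rewrite ler_norml cos_geN1 cos_le1.
Qed.
Lemma dom0_N : dom 0 0 N_.
Proof.
apply: (@dom_bounded _ _ 1).
  apply: (@measurableT_comp _ _ _ _ _ _ (@sin R : mR -> mR)) measurable_th.
  by apply: continuous_measurable_fun; exact: continuous_sin.
by move=> z; rewrite ler_norml sin_geN1 sin_le1.
Qed.

Let weaken0 f : dom kp kp f -> dom 0 0 f.
Proof. by apply: dom_weaken; exact: ltW. Qed.
Lemma dom0_K : dom 0 0 K_.
Proof. by have h := dom_Q; rewrite /K_; dom0. Qed.
Lemma dom0_dK : dom 0 0 dK_.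
Proof. by have h := dom_Q; have h2 := weaken0 dom_G; have h3 := weaken0 dom_D; rewrite /dK_; dom0. Qed.
Lemma domk_DD : dom kp kp DD_.
Proof.
have h := dom_Q; have h2 := dom_G; have h3 := weaken0 dom_F; have h4 := dom_E; have h5 := dom_H.
have hq : dom 0 0 (fun z => Q_ z ^+ 2) by exact: dom0_mul.
by rewrite /DD_; domk.
Qed.
Lemma dom0_dth s : dom 0 0 (dth s).
Proof. by have h := dom0_K; rewrite /dth; dom0. Qed.
Lemma dom0_dphi s : dom 0 0 (dphi s).
Proof. by have h := weaken0 dom_F; rewrite /dphi; dom0. Qed.

Section Growth.
Variables (w w' : R3 -> R) (q r q' r' : R).
Hypotheses (hw : dom q r w) (hw' : dom q' r' w').

Lemma dom_uX0 s : dom (q + kp) (r + kp) (uX0 s w).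
Proof.
apply: (domM hw); have h1 := dom_G; have h2 := weaken0 dom_D; domk.
Qed.
Lemma dom_uX1 s : dom (q + kp) (r + kp) (uX1 s w).
Proof.
apply: (domM hw); have h1 := dom_G; have h2 := dom_D; have h3 := dom_H; have h4 := dom0_C.
have h5 := dom0_N; have h6 := dom0_K; domk.
Qed.
Lemma dom_uX2 s : dom (q + kp) (r + kp) (uX2 s w).
Proof.
apply: (domM hw); have h1 := dom_G; have h2 := dom_D; have h3 := dom_H; have h4 := dom0_C.
have h5 := dom0_N; have h6 := dom0_K; domk.
Qed.
Lemma dom_A0 s : dom (q + kp) (r + kp) (A0 s w).
Proof.
apply: (domM hw); have h1 := dom_G; have h2 := dom_D; have h3 := dom_H; have h4 := dom0_C.
have h5 := dom0_N; have h6 := dom0_K; have h7 := dom0_phi; have h8 := weaken0 h1; domk.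
Qed.
Lemma dom_A1 s : dom (q + kp) (r + kp) (A1 s w).
Proof.
apply: (domM hw); have h1 := dom_G; have h2 := dom_D; have h3 := dom_H; have h4 := dom0_C.
have h5 := dom0_N; have h6 := dom0_K; have h7 := dom0_phi; domk.
Qed.
Lemma dom_A2 s : dom (q + kp) (r + kp) (A2 s w).
Proof.
apply: (domM hw); have h1 := dom_G; have h2 := dom_D; have h3 := dom_H; have h4 := dom0_C.
have h5 := dom0_N; have h6 := dom0_K; have h7 := dom0_phi; domk.
Qed.
Lemma dom_dA0 s : dom (q + q' + kp) (r + r' + kp) (dA0 s w w').
Proof.
apply: (domM (domM hw hw')); have h1 := dom_G; have h2 := dom_D; have h3 := dom_H; have h4 := domk_DD.
have h6 := dom0_K; have h7 := dom0_phi; have h8 := weaken0 h1; have h9 := dom0_dK; have h10 := dom0_dphi (- s).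
have h11 := weaken0 h2; domk.
Qed.
Lemma dom_dA1 s : dom (q + q' + kp) (r + r' + kp) (dA1 s w w').
Proof.
apply: (domM (domM hw hw')); have h1 := dom_G; have h2 := dom_D; have h3 := dom_H; have h4 := domk_DD.
have h5 := dom0_C; have h12 := dom0_N; have h13 := dom0_dth (- s).
have h6 := dom0_K; have h7 := dom0_phi; have h8 := weaken0 h1; have h9 := dom0_dK; have h10 := dom0_dphi (- s).
have h11 := weaken0 h2; domk.
Qed.
Lemma dom_dA2 s : dom (q + q' + kp) (r + r' + kp) (dA2 s w w').
Proof.
apply: (domM (domM hw hw')); have h1 := dom_G; have h2 := dom_D; have h3 := dom_H; have h4 := domk_DD.
have h5 := dom0_C; have h12 := dom0_N; have h13 := dom0_dth (- s).
have h6 := dom0_K; have h7 := dom0_phi; have h8 := weaken0 h1; have h9 := dom0_dK; have h10 := dom0_dphi (- s).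
have h11 := weaken0 h2; domk.
Qed.
End Growth.

Definition u_ z : 'rV[R]_3 := vec3 (H_ z) (G_ z * C_ z) (G_ z * N_ z).
(** Half the sum and half the difference of the null derivatives of u. *)
Definition ux_ z : 'rV[R]_3 := vec3 ((uX0 1 ixi z + uX0 (-1) izt z) / 2)
  ((uX1 1 ixi z + uX1 (-1) izt z) / 2) ((uX2 1 ixi z + uX2 (-1) izt z) / 2).
Definition uy_ z : 'rV[R]_3 := vec3 ((uX0 1 ixi z - uX0 (-1) izt z) / 2)
  ((uX1 1 ixi z - uX1 (-1) izt z) / 2) ((uX2 1 ixi z - uX2 (-1) izt z) / 2).

Let CN z : N_ z * N_ z = 1 - C_ z * C_ z.
Proof. by have := cos2Dsin2 (th_ z); rewrite /C_ /N_ => <-; ring. Qed.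

Lemma u_target z : target e (u_ z).
Proof.
have H0 : 2^-1 <= H_ z by have /andP[] := dGamma_bounds e (S1 (horizontal z) (tau z)).
move: (relG z) (CN z) H0; rewrite /u_ /target.
by case: (e) => /=; rewrite !vec3E !exprMn => g cn h0; [|split; last lra];
  rewrite ![_ ^+ 2]expr2 cn g; ring.
Qed.

(** The phase derivative K_ drops out, being the same in the two null
    directions; only the difference 2 k between the angular rates remains. *)
Lemma jacobian z : inner e (u_ z) (wedge e (ux_ z) (uy_ z)) = k * (G_ z * D_ z) * ((xi z)^-1 * (zt z)^-1).
Proof.
rewrite innerE wedge_0 wedge_1 wedge_2 /u_ /ux_ /uy_ !vec3E /uX0 /uX1 /uX2.
move: (relG z) (CN z); move: (G_ z) (H_ z) (K_ z) (D_ z) (C_ z) (N_ z) (xi z)^-1 (zt z)^-1 => G H K D C N w w'.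
by have [-> | ->] := ep_case => r1 r2; field: r1 r2.
Qed.

(** The exponent of the derivatives of u at the light cone. *)
Let m := kp - 1.
Let m1 : -1 < m. Proof. by move: kp0; rewrite /m; lra. Qed.
Let k1 : -1 < kp. Proof. by move: kp0; lra. Qed.
Let domP0 := dom_uX0 (@dom_inv_xi R) 1.
Let domP1 := dom_uX1 (@dom_inv_xi R) 1.
Let domP2 := dom_uX2 (@dom_inv_xi R) 1.
Let domM0 := dom_uX0 (@dom_inv_zt R) (-1).
Let domM1 := dom_uX1 (@dom_inv_zt R) (-1).
Let domM2 := dom_uX2 (@dom_inv_zt R) (-1).
Let domPm f : dom (-1 + kp) (0 + kp) f -> dom m m f.
Proof. by apply: dom_weaken; rewrite /m; move: kp0; lra. Qed.
Let domMm f : dom (0 + kp) (-1 + kp) f -> dom m m f.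
Proof. by apply: dom_weaken; rewrite /m; move: kp0; lra. Qed.
Let half (f g : R3 -> R) : dom m m f -> dom m m g -> dom m m (fun z => (f z + g z) / 2).
Proof. by move=> hf hg; domk. Qed.
Let half' (f g : R3 -> R) : dom m m f -> dom m m g -> dom m m (fun z => (f z - g z) / 2).
Proof. by move=> hf hg; domk. Qed.

Let dom_u i : dom 0 0 (fun z => u_ z 0 i).
Proof.
have h1 := weaken0 dom_G; have h2 := dom_H; have h3 := dom0_C; have h4 := dom0_N.
move: i; apply: ord3P; rewrite /u_; under eq_fun do rewrite vec3E; dom0.
Qed.
Let dom_ux i : dom m m (fun z => ux_ z 0 i).
Proof.
move: i; apply: ord3P; rewrite /ux_; under eq_fun do rewrite vec3E; apply: half;
  by [apply: domPm; first [exact: domP0|exact: domP1|exact: domP2]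
     |apply: domMm; first [exact: domM0|exact: domM1|exact: domM2]].
Qed.
Let dom_uy i : dom m m (fun z => uy_ z 0 i).
Proof.
move: i; apply: ord3P; rewrite /uy_; under eq_fun do rewrite vec3E; apply: half';
  by [apply: domPm; first [exact: domP0|exact: domP1|exact: domP2]
     |apply: domMm; first [exact: domM0|exact: domM1|exact: domM2]].
Qed.
Let dom_wedge (v : R3 -> 'rV[R]_3) : (forall i, dom m m (fun z => v z 0 i)) ->
  forall i, dom m m (fun z => wedge e (u_ z) (v z) 0 i).
Proof.
move=> hv; have v0 := hv 0; have v1 := hv 1; have v2 := hv 2%:R.
have u0 := dom_u 0; have u1 := dom_u 1; have u2 := dom_u 2%:R.
apply: ord3P; [under eq_fun do rewrite wedge_0|under eq_fun do rewrite wedge_1|under eq_fun do rewrite wedge_2]; domk.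
Qed.

Lemma dom_jacobian : dom m m (fun z => inner e (u_ z) (wedge e (ux_ z) (uy_ z))).
Proof.
under eq_fun do rewrite jacobian.
have h1 := dom_G; have h2 := weaken0 dom_D.
have h : dom kp kp (fun z => k * (G_ z * D_ z)) by domk.
by apply: dom_weaken (domM h (domM (@dom_inv_xi R) (@dom_inv_zt R))); rewrite /m; lra.
Qed.

Let lineP (f g : R3 -> R) := forall p y, p.2 != 0 -> y != 0 ->
    is_derive y 1 (fun y => f (along_P (p, y))) (g (along_P (p, y))) /\
    {for y, continuous (fun y => g (along_P (p, y)))}.
Let lineM (f g : R3 -> R) := forall p y, p.2 != 0 -> y != 0 ->
    is_derive y 1 (fun y => f (along_M (p, y))) (g (along_M (p, y))) /\
    {for y, continuous (fun y => g (along_M (p, y)))}.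

(** Integration by parts along both families of null lines; s = 1 gives the
    derivative in x and s = -1 the one in y. *)
Let weak_half (f gP gM rho D : R3 -> R) (a s : R) :
  dom kp kp (fun z => f z - a) -> dom (-1 + kp) (0 + kp) gP -> dom (0 + kp) (-1 + kp) gM ->
  lineP f gP -> lineM f gM -> test_function rho ->
  (forall z, D z = ('D_eP rho z + s * 'D_eM rho z) / 2) ->
  (\int[mu3 R]_z (f z * D z)%:E = - \int[mu3 R]_z ((gP z + s * gM z) / 2 * rho z)%:E)%E.
Proof.
move=> df dP dM lP lM tr eD.
have tP := test_derive eP tr; have tM := test_derive eM tr.
have q1 : -1 < -1 + kp by move: kp0; lra.
have q2 : -1 < 0 + kp by move: kp0; lra.
have f0 : dom 0 0 f.
  rewrite (_ : f = fun z => (f z - a) + a); last by apply/funext => z; rewrite subrK.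
  by apply: domD; [exact: weaken0|exact: dom_cst].
have z1 : -1 < 0 :> R by lra.
have iP := test_integrable z1 z1 f0 tP; have iM := test_integrable z1 z1 f0 tM.
have jP := test_integrable q1 q2 dP tr; have jM := test_integrable q2 q1 dM tr.
have iE (h : T3 -> R) : (mu3 R).-integrable setT (fun z => (h z)%:E) ->
    (\int[mu3 R]_z (h z)%:E)%E = (\int[mu3 R]_z h z)%:E by exact: integral_EFin.
have := ibp_P kp0 k1 q1 q2 df dP lP tr; rewrite (iE _ iP) (iE _ jP) -EFinN => -[eqP].
have := ibp_M k1 kp0 q2 q1 df dM lM tr; rewrite (iE _ iM) (iE _ jM) -EFinN => -[eqM].
have := integral_lin2 2^-1 (s / 2) iP iM; have := integral_lin2 2^-1 (s / 2) jP jM.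
rewrite eqP eqM => e1 e2.
transitivity (\int[mu3 R]_z (2^-1 * (f z * 'D_eP rho z) + s / 2 * (f z * 'D_eM rho z))%:E)%E.
  by apply: eq_integral => z _; rewrite eD; congr EFin; field.
transitivity (- \int[mu3 R]_z (2^-1 * (gP z * rho z) + s / 2 * (gM z * rho z))%:E)%E.
  by rewrite e1 e2 -EFinN; congr EFin; ring.
by congr (- _)%E; apply: eq_integral => z _; congr EFin; field.
Qed.

Let weak_x (f gP gM rho : R3 -> R) (a : R) :
  dom kp kp (fun z => f z - a) -> dom (-1 + kp) (0 + kp) gP -> dom (0 + kp) (-1 + kp) gM ->
  lineP f gP -> lineM f gM -> test_function rho ->
  (\int[mu3 R]_z (f z * 'D_(ex R) rho z)%:E = - \int[mu3 R]_z ((gP z + gM z) / 2 * rho z)%:E)%E.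
Proof.
move=> df dP dM lP lM tr; rewrite (weak_half (s := 1) df dP dM lP lM tr).
  by congr (- _)%E; apply: eq_integral => z _; rewrite mul1r.
by move=> z; rewrite mul1r; exact: derive_ex tr.1.
Qed.
Let weak_y (f gP gM rho : R3 -> R) (a : R) :
  dom kp kp (fun z => f z - a) -> dom (-1 + kp) (0 + kp) gP -> dom (0 + kp) (-1 + kp) gM ->
  lineP f gP -> lineM f gM -> test_function rho ->
  (\int[mu3 R]_z (f z * 'D_(ey R) rho z)%:E = - \int[mu3 R]_z ((gP z - gM z) / 2 * rho z)%:E)%E.
Proof.
move=> df dP dM lP lM tr; rewrite (weak_half (s := -1) df dP dM lP lM tr).
  by congr (- _)%E; apply: eq_integral => z _; rewrite mulN1r.
by move=> z; rewrite mulN1r; exact: derive_ey tr.1.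
Qed.

Let dirP := direction_P.
Let dirM := direction_M.
Let dom_u0 : dom kp kp (fun z => H_ z - 1).
Proof.
have h := dom_F; have -> : (fun z => H_ z - 1) = fun z => - ep * F_ z; last by domk.
by apply/funext => z; rewrite -[F_ z]/(ep * (1 - H_ z)) mulrA mulNr sgvM; ring.
Qed.
Let dom_u1 : dom kp kp (fun z => G_ z * C_ z - 0).
Proof. by have h := dom_G; have h2 := dom0_C; under eq_fun do rewrite subr0; domk. Qed.
Let dom_u2 : dom kp kp (fun z => G_ z * N_ z - 0).
Proof. by have h := dom_G; have h2 := dom0_N; under eq_fun do rewrite subr0; domk. Qed.

Let lP0 : lineP H_ (uX0 1 ixi).
Proof. by move=> p y p0 y0; split; [exact: (line_H dirP p0 y0)|exact: (line_uX0_continuous dirP p0 y0)]. Qed.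
Let lM0 : lineM H_ (uX0 (-1) izt).
Proof. by move=> p y p0 y0; split; [exact: (line_H dirM p0 y0)|exact: (line_uX0_continuous dirM p0 y0)]. Qed.
Let lP1 : lineP (fun z => G_ z * C_ z) (uX1 1 ixi).
Proof. by move=> p y p0 y0; split; [exact: (line_u1 dirP p0 y0)|exact: (line_uX1_continuous dirP p0 y0)]. Qed.
Let lM1 : lineM (fun z => G_ z * C_ z) (uX1 (-1) izt).
Proof. by move=> p y p0 y0; split; [exact: (line_u1 dirM p0 y0)|exact: (line_uX1_continuous dirM p0 y0)]. Qed.
Let lP2 : lineP (fun z => G_ z * N_ z) (uX2 1 ixi).
Proof. by move=> p y p0 y0; split; [exact: (line_u2 dirP p0 y0)|exact: (line_uX2_continuous dirP p0 y0)]. Qed.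
Let lM2 : lineM (fun z => G_ z * N_ z) (uX2 (-1) izt).
Proof. by move=> p y p0 y0; split; [exact: (line_u2 dirM p0 y0)|exact: (line_uX2_continuous dirM p0 y0)]. Qed.

Lemma weak_derivative_x : weak_derivative (ex R) u_ ux_.
Proof.
apply: ord3P => rho tr; rewrite /u_ /ux_; under eq_integral do rewrite vec3E;
  under [in RHS]eq_integral do rewrite vec3E.
- exact: weak_x dom_u0 domP0 domM0 lP0 lM0 tr.
- exact: weak_x dom_u1 domP1 domM1 lP1 lM1 tr.
exact: weak_x dom_u2 domP2 domM2 lP2 lM2 tr.
Qed.
Lemma weak_derivative_y : weak_derivative (ey R) u_ uy_.
Proof.
apply: ord3P => rho tr; rewrite /u_ /uy_; under eq_integral do rewrite vec3E;
  under [in RHS]eq_integral do rewrite vec3E.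
- exact: weak_y dom_u0 domP0 domM0 lP0 lM0 tr.
- exact: weak_y dom_u1 domP1 domM1 lP1 lM1 tr.
exact: weak_y dom_u2 domP2 domM2 lP2 lM2 tr.
Qed.

(** One component of the first equation: A and A' are the fluxes, integrated
    by parts along the null lines opposite to them, and f, the component of u, is
    integrated by parts in time. *)
Let component (f ut A gA A' gA' rho : R3 -> R) :
  dom 0 0 f -> dom 0 0 ut -> dom (-1 + kp) (0 + kp) A -> dom m m gA -> dom (0 + kp) (-1 + kp) A' -> dom m m gA' ->
  (forall p y, is_derive y 1 (fun y => f (along_t (p, y))) (ut (along_t (p, y))) /\
    {for y, continuous (fun y => ut (along_t (p, y)))}) ->
  lineM A gA -> lineP A' gA' ->
  (forall z, xi z != 0 -> zt z != 0 -> gA z + gA' z = 2 * ut z) ->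
  test_function rho ->
  (mu3 R).-integrable setT (fun z => (f z * 'D_(et R) rho z - 2^-1 * (A z * 'D_eM rho z) - 2^-1 * (A' z * 'D_eP rho z))%:E) /\
  (\int[mu3 R]_z (f z * 'D_(et R) rho z - 2^-1 * (A z * 'D_eM rho z) - 2^-1 * (A' z * 'D_eP rho z))%:E = 0)%E.
Proof.
move=> df dut dA dgA dA' dgA' lt lM lP bal tr.
have tP := test_derive eP tr; have tM := test_derive eM tr; have tt := test_derive (et R) tr.
have q1 : -1 < -1 + kp by move: kp0; lra.
have q2 : -1 < 0 + kp by move: kp0; lra.
have q3 : 0 < 0 + kp by rewrite add0r.
have z1 : -1 < 0 :> R by lra.
have dAc : dom (-1 + kp) (0 + kp) (fun z => A z - 0) by under eq_fun do rewrite subr0.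
have dAc' : dom (0 + kp) (-1 + kp) (fun z => A' z - 0) by under eq_fun do rewrite subr0.
have ex0 := ibp_t z1 z1 z1 z1 df dut lt tr.
have ex1 := ibp_M q1 q3 m1 m1 dAc dgA lM tr.
have ex2 := ibp_P q3 q1 m1 m1 dAc' dgA' lP tr.
have i0 := test_integrable z1 z1 df tt; have i1 := test_integrable q1 q2 dA tM.
have i2 := test_integrable q2 q1 dA' tP.
split.
  exact: (integrableB measurableT (integrableB measurableT i0 (integrableZl measurableT 2^-1 i1))
    (integrableZl measurableT 2^-1 i2)).
have := integral_balance (a0 := 1) (a1 := - 2^-1) (a2 := - 2^-1) i0 i1 i2
  (test_integrable z1 z1 dut tr) (test_integrable m1 m1 dgA tr) (test_integrable m1 m1 dgA' tr) ex0 ex1 ex2.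
move=> E; apply: etrans (E _); first by apply: eq_integral => z _; congr EFin; ring.
move=> z x0 z0; have -> : gA' z = 2 * ut z - gA z by rewrite -(bal z x0 z0); ring.
by field.
Qed.

(** Rewriting x- and y-derivatives in null directions, each flux is paired
    with a single null derivative of the test function. *)
Let divergence_form z (vx vy vt : 'rV[R]_3) (vP vM : 'I_3 -> R) :
  (forall i, vx 0 i = (vP i + vM i) / 2) -> (forall i, vy 0 i = (vP i - vM i) / 2) ->
  inner e (wedge e (u_ z) (uy_ z)) vy - inner e (wedge e (u_ z) (ux_ z)) vx
    + inner e (u_ z) vt - phi_ z * (inner e (uy_ z) vx - inner e (ux_ z) vy) =
  ep * (H_ z * vt 0 0 - 2^-1 * (A0 1 ixi z * vM 0) - 2^-1 * (A0 (-1) izt z * vP 0))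
  + 1 * (G_ z * C_ z * vt 0 1 - 2^-1 * (A1 1 ixi z * vM 1) - 2^-1 * (A1 (-1) izt z * vP 1))
  + 1 * (G_ z * N_ z * vt 0 2%:R - 2^-1 * (A2 1 ixi z * vM 2%:R) - 2^-1 * (A2 (-1) izt z * vP 2%:R)).
Proof.
move=> hx hy; rewrite !innerE !wedge_0 !wedge_1 !wedge_2 !hx !hy.
rewrite /u_ /ux_ /uy_ !vec3E /uX0 /uX1 /uX2 /A0 /A1 /A2.
move: (relG z) (CN z).
move: (vP 0) (vP 1) (vP 2%:R) (vM 0) (vM 1) (vM 2%:R) (vt 0 0) (vt 0 1) (vt 0 2%:R)
  => a0 a1 a2 b0 b1 b2 t0 t1 t2.
move: (G_ z) (H_ z) (K_ z) (D_ z) (C_ z) (N_ z) (phi_ z) (xi z)^-1 (zt z)^-1 => G H K D C N f w w'.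
by have [-> | ->] := ep_case => r1 r2; field: r1 r2.
Qed.

Lemma first_equation psi : test_function psi ->
  (\int[mu3 R]_z
     (inner e (wedge e (u_ z) (uy_ z)) ('D_(ey R) psi z)
      - inner e (wedge e (u_ z) (ux_ z)) ('D_(ex R) psi z)
      + inner e (u_ z) ('D_(et R) psi z)
      - phi_ z * (inner e (uy_ z) ('D_(ex R) psi z)
                 - inner e (ux_ z) ('D_(ey R) psi z)))%:E = 0)%E.
Proof.
move=> tpsi; have tr i := test_vec i tpsi.
have dxi := @dom_inv_xi R; have dzt := @dom_inv_zt R.
have weakm f : dom (-1 + 0 + kp) (0 + -1 + kp) f -> dom m m f by apply: dom_weaken; rewrite /m; lra.
have weakm' f : dom (0 + -1 + kp) (-1 + 0 + kp) f -> dom m m f by apply: dom_weaken; rewrite /m; lra.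
have c0 : forall p y, is_derive y 1 (fun y => H_ (along_t (p, y))) (cst 0 (along_t (p, y))) /\
    {for y, continuous (fun y => cst (0 : R) (along_t (p, y)))}.
  by move=> p y; split; [exact: (dC y (H_ (along_t (p, 0))))|exact: cst_continuous].
have c1 : forall p y, is_derive y 1 (fun y => G_ (along_t (p, y)) * C_ (along_t (p, y)))
    (- (mu * (G_ (along_t (p, y)) * N_ (along_t (p, y))))) /\
    {for y, continuous (fun y => - (mu * (G_ (along_t (p, y)) * N_ (along_t (p, y)))))}.
  move=> p y; split; first exact: along_t_u1.
  by have h := along_t_u2 p y; eapply is_derive_continuous; repeat der1.
have c2 : forall p y, is_derive y 1 (fun y => G_ (along_t (p, y)) * N_ (along_t (p, y)))
    (mu * (G_ (along_t (p, y)) * C_ (along_t (p, y)))) /\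
    {for y, continuous (fun y => mu * (G_ (along_t (p, y)) * C_ (along_t (p, y))))}.
  move=> p y; split; first exact: along_t_u2.
  by have h := along_t_u1 p y; eapply is_derive_continuous; repeat der1.
have h1 := weaken0 dom_G; have h2 := dom0_C; have h3 := dom0_N.
have d1 : dom 0 0 (fun z => G_ z * C_ z) by dom0.
have d2 : dom 0 0 (fun z => G_ z * N_ z) by dom0.
have e1 : dom 0 0 (fun z => - (mu * (G_ z * N_ z))) by dom0.
have e2 : dom 0 0 (fun z => mu * (G_ z * C_ z)) by dom0.
have lM0' : lineM (A0 1 ixi) (dA0 1 ixi izt).
  have := fun p y (p0 : p.2 != 0) (y0 : y != 0) => conj (line_A0 dirM p0 y0) (line_dA0_continuous dirM p0 y0).
  by rewrite opprK.
have lM1' : lineM (A1 1 ixi) (dA1 1 ixi izt).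
  have := fun p y (p0 : p.2 != 0) (y0 : y != 0) => conj (line_A1 dirM p0 y0) (line_dA1_continuous dirM p0 y0).
  by rewrite opprK.
have lM2' : lineM (A2 1 ixi) (dA2 1 ixi izt).
  have := fun p y (p0 : p.2 != 0) (y0 : y != 0) => conj (line_A2 dirM p0 y0) (line_dA2_continuous dirM p0 y0).
  by rewrite opprK.
have lP0' : lineP (A0 (-1) izt) (dA0 (-1) izt ixi).
  by move=> p y p0 y0; split; [exact: (line_A0 dirP p0 y0)|exact: (line_dA0_continuous dirP p0 y0)].
have lP1' : lineP (A1 (-1) izt) (dA1 (-1) izt ixi).
  by move=> p y p0 y0; split; [exact: (line_A1 dirP p0 y0)|exact: (line_dA1_continuous dirP p0 y0)].
have lP2' : lineP (A2 (-1) izt) (dA2 (-1) izt ixi).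
  by move=> p y p0 y0; split; [exact: (line_A2 dirP p0 y0)|exact: (line_dA2_continuous dirP p0 y0)].
have b0 z : xi z != 0 -> zt z != 0 -> dA0 1 ixi izt z + dA0 (-1) izt ixi z = 2 * cst 0 z.
  by move=> x0 z0; rewrite balance0// mulr0.
have [i0 j0] := component dom_H (dom_cst 0) (dom_A0 dxi 1) (weakm _ (dom_dA0 dxi dzt 1)) (dom_A0 dzt (-1))
  (weakm' _ (dom_dA0 dzt dxi (-1))) c0 lM0' lP0' b0 (tr 0).
have [i1 j1] := component d1 e1 (dom_A1 dxi 1) (weakm _ (dom_dA1 dxi dzt 1)) (dom_A1 dzt (-1))
  (weakm' _ (dom_dA1 dzt dxi (-1))) c1 lM1' lP1' balance1 (tr 1).
have [i2 j2] := component d2 e2 (dom_A2 dxi 1) (weakm _ (dom_dA2 dxi dzt 1)) (dom_A2 dzt (-1))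
  (weakm' _ (dom_dA2 dzt dxi (-1))) c2 lM2' lP2' balance2 (tr 2%:R).
have := integral_lin3_eq0 ep 1 1 i0 i1 i2 j0 j1 j2.
apply: etrans; apply: eq_integral => z _; congr EFin.
have sp := tpsi.1.
have hx i : 'D_(ex R) psi (z : R3) 0 i =
    ('D_eP (fun q : R3 => psi q 0 i) z + 'D_eM (fun q : R3 => psi q 0 i) z) / 2.
  by rewrite derive_vec//; exact: (derive_ex z (tr i).1).
have hy i : 'D_(ey R) psi (z : R3) 0 i =
    ('D_eP (fun q : R3 => psi q 0 i) z - 'D_eM (fun q : R3 => psi q 0 i) z) / 2.
  by rewrite derive_vec//; exact: (derive_ey z (tr i).1).
rewrite (divergence_form (z : R3) ('D_(et R) psi (z : R3)) hx hy).
by rewrite !(derive_vec _ _ _ sp).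
Qed.

(** The operator is the product of the two null derivatives. The logarithms of
    |x - y| and |x + y| are constant on one family of null lines each; Ph_ is
    integrated by parts once along each family. *)
Lemma second_equation (rho : R3 -> R) : test_function rho ->
  (\int[mu3 R]_z
     (('D_(ex R) ('D_(ex R) rho) z - 'D_(ey R) ('D_(ey R) rho) z) * phi_ z
      + 2 * rho z * inner e (u_ z) (wedge e (ux_ z) (uy_ z)))%:E = 0)%E.
Proof.
move=> tr; have tM := test_derive eM tr; have tP := test_derive eP tr.
pose W := 'D_eP ('D_eM rho); have tW : test_function W := test_derive eP tM.
have z1 : -1 < 0 :> R by lra.
have lx := @dom_ln_xi R; have lz := @dom_ln_zt R.
have ez : (\int[mu3 R]_z (ln `|zt z| * W z)%:E = 0)%E.
  by apply: (ibp_P_const z1 z1 lz) => // p y; rewrite !zt_P.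
have ex : (\int[mu3 R]_z (ln `|xi z| * W z)%:E = 0)%E.
  (* The two null derivatives commute, and ln|xi| is constant on the lines
     along which the outer one is then taken. *)
  rewrite -(ibp_M_const z1 z1 lx _ tP); last by move=> p y; rewrite !xi_M.
  by apply: eq_integral => z _; rewrite /W (deriveC_direction z eM eP tr.1).
pose f z := (xi z)^-1 * (- 2 * k * F_ z); pose g z := (xi z)^-1 * ((zt z)^-1 * (- 2 * k * (G_ z * D_ z))).
have h1 := dom_F; have h2 := dom_G; have h3 := weaken0 dom_D.
have df : dom (-1 + kp) (0 + kp) f by apply: (domM (@dom_inv_xi R)); domk.
have dg : dom m m g.
  have h : dom (-1 + (0 + kp)) (0 + (-1 + kp)) g.
    by apply: (domM (@dom_inv_xi R)); apply: (domM (@dom_inv_zt R)); domk.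
  by apply: dom_weaken h; rewrite /m; lra.
have q1 : -1 < -1 + kp by move: kp0; lra.
have q2 : 0 < 0 + kp by rewrite add0r.
have lPh : lineP Ph_ f.
  move=> p y p0 y0; split; first exact: (line_Ph dirP p0 y0).
  have h4 := dir_w dirP p y0; have h5 := line_F dirP p0 y0.
  by rewrite /f; eapply is_derive_continuous; repeat der1.
have lf : lineM f g.
  move=> p y p0 y0; have h4 := dir_w dirM p y0; have h5 := line_F dirM p0 y0; have h6 := dir_w' dirM p y.
  have h7 := line_G dirM p0 y0; have h8 := line_D dirM p0 y0.
  split; first by rewrite /f /g; der; ring.
  by rewrite /g; eapply is_derive_continuous; repeat der1.
have dPh0 : dom kp kp (fun z => Ph_ z - 0) by under eq_fun do rewrite subr0; exact: dom_Ph.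
have df0 : dom (-1 + kp) (0 + kp) (fun z => f z - 0) by under eq_fun do rewrite subr0.
have q3 : -1 < 0 + kp by move: kp0; lra.
have e1 := ibp_P kp0 k1 q1 q3 dPh0 df lPh tM.
have e2 := ibp_M q1 q2 m1 m1 df0 dg lf tr.
have iz := test_integrable z1 z1 lz tW; have ix := test_integrable z1 z1 lx tW.
have iPh := test_integrable k1 k1 dom_Ph tW; have iJ := test_integrable m1 m1 dom_jacobian tr.
have ig := test_integrable m1 m1 dg tr.
pose X2 z := 1 * (Ph_ z * W z) + 2 * (inner e (u_ z) (wedge e (ux_ z) (uy_ z)) * rho z).
have i2 : (mu3 R).-integrable setT (EFin \o X2).
  exact: integrableD (integrableZl measurableT 1 iPh) (integrableZl measurableT 2 iJ).
have e3 : (\int[mu3 R]_z (X2 z)%:E = 0)%E.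
  have e4 : (\int[mu3 R]_z (Ph_ z * W z)%:E = \int[mu3 R]_z (g z * rho z)%:E)%E by rewrite e1 e2 oppeK.
  rewrite -[RHS](@integral0 _ _ _ (mu3 R) setT).
  have -> : (\int[mu3 R]_z (X2 z)%:E = \int[mu3 R]_z (1 * (g z * rho z) +
      2 * (inner e (u_ z) (wedge e (ux_ z) (uy_ z)) * rho z))%:E)%E.
    by rewrite !integral_lin2// /Rintegral e4.
  by apply: eq_integral => z _; congr EFin; rewrite jacobian /g; ring.
have := integral_lin3_eq0 ((c + b) / 2) ((b - c) / 2) 1 ix iz i2 ex ez e3.
apply: etrans; apply: eq_integral => z _; congr EFin; rewrite (wave_operator z tr.1) -/(W z) /X2.
by rewrite /phi_ /alpha /tau; field.
Qed.

Lemma ansatz_weak_solution : weak_solution e u_ phi_.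
Proof.
split; first by apply: aeW => z; exact: u_target.
have z1 : -1 < 0 :> R by lra.
have L i (v : R3 -> 'rV[R]_3) : (forall i, dom m m (fun z => v z 0 i)) -> L1loc (fun z => v z 0 i).
  by move=> h; exact: (dom_L1loc m1 m1 (h i)).
have dphi (v : R3 -> 'rV[R]_3) : (forall i, dom m m (fun z => v z 0 i)) ->
    forall i, dom m m (fun z => (phi_ z *: v z) 0 i).
  move=> h i; have h1 := h i; have h2 := dom0_phi.
  by under eq_fun do rewrite mxE; domk.
split; first by move=> i; exact: (dom_L1loc z1 z1 (dom_u i)).
split; first exact: (dom_L1loc z1 z1 dom0_phi).
exists ux_, uy_; split.
- by split; [exact: weak_derivative_x|exact: weak_derivative_y].
- by split=> i; apply: L => // j; apply: dom_wedge.
- by split=> [i|i|]; [apply: L => // j; exact: dphi..|exact: (dom_L1loc m1 m1 dom_jacobian)].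
- exact: first_equation.
exact: second_equation.
Qed.
End Ansatz.

(** * The radial part of phi *)

Section Potential.
Context {R : realType} (e : sign).
Notation leb := (@lebesgue_measure R).
Notation mR := (measurableTypeR R).

Lemma Fint_FF (s : R) : Fint e s = FF e s.
Proof.
have F0 : FF e (0 : R) = 0 by rewrite /FF dGamma0 subrr mulr0.
have D (x : R) : is_derive x 1 (FF e) (Gamma e x) /\ {for x, continuous (@Gamma R e)}.
  by split; [exact: is_derive_FF|exact: is_derive_continuous (is_derive_Gamma e x)].
rewrite /Fint; case: ltgtP => s0.
- by rewrite (ftc_closed s0 (fun x _ => D x)) F0 subr0.
- by rewrite (ftc_closed s0 (fun x _ => D x)) F0 sub0r opprK.
- by rewrite -s0 set_itv1 /Rintegral integral_set1 F0.
Qed.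

Variables (mu k b c : R).
Hypothesis K0 : 0 < kap2 k b c.
Notation kap := (Num.sqrt (kap2 k b c)).

(** The integrand is O(a^(kap - 1)), hence integrable at 0, and - Ph (ln a) is
    its primitive that vanishes at 0. *)
Lemma integral_potential sg S Sd B Ph (a : R) : profile e mu k b c sg S Sd B Ph -> 0 < a ->
  \int[leb]_(x in `[0, a]) (2 * k / x * Fint e (radial S x)) = - Ph (ln a).
Proof.
move=> P a0; under [LHS]eq_Rintegral do rewrite Fint_FF.
pose h x := 2 * k / x * FF e (radial S x).
have radS (x : R) : 0 < x -> radial S x = S (ln x) by move=> x0; rewrite /radial leNgt x0.
have k0 := kap_gt0 K0.
have [C hC] := profile_S_bound P.
have C0 : 0 <= C by have := le_trans (normr_ge0 (S 0)) (hC 0); rewrite mulr0 expR0 mulr1.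
have cS : continuous S by move=> t; exact: is_derive_continuous (profile_S P t).
have mS : measurable_fun [set: mR] (radial S : mR -> mR).
  apply: measurable_fun_ifT => //; first exact: measurable_fun_ler.
  apply: (@measurableT_comp _ _ _ _ _ _ (S : mR -> mR)); last exact: measurable_ln.
  exact: continuous_measurable_fun.
have mF : measurable_fun [set: mR] (FF e : mR -> mR).
  by apply: continuous_measurable_fun => x; exact: is_derive_continuous (is_derive_FF e x).
have mh : measurable_fun [set: mR] (h : mR -> mR).
  apply: (measurable_funM _ (measurableT_comp mF mS)); apply: measurable_funM => //.
  exact: measurable_inv.
have bh (x : R) : 0 <= x -> `|h x| <= `|2 * k| * (9 * C) * wgt (kap - 1) x.
  rewrite le_eqVlt => /predU1P[<-|x0].
    by rewrite /h invr0 mulr0 mul0r normr0 !mulr_ge0 ?wgt_ge0.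
  have -> : wgt (kap - 1) x = expR (kap * ln x) * x^-1.
    by rewrite /wgt gtr0_norm// mulrBl mul1r expRB lnK// posrE.
  have s1 := profile_le1 P (ln x).
  have /andP[F0 F1] := FF_bounds e s1.
  rewrite /h radS// 2!normrM normfV (gtr0_norm x0) (ger0_norm F0) -!mulrA ler_wpM2l//.
  rewrite mulrC !mulrA ler_pM2r ?invr_gt0//; apply: (le_trans F1); rewrite -mulrA ler_wpM2l//.
  rewrite -[S _ ^+ 2]real_normK ?num_real// expr2; have := hC (ln x); have := normr_ge0 (S (ln x)); nra.
have ih : leb.-integrable `[0, a] (EFin \o h).
  pose w x := `|2 * k| * (9 * C) * wgt_on (kap - 1) a x.
  have iw : leb.-integrable setT (EFin \o w).
    by apply: (integrableZl measurableT (`|2 * k| * (9 * C)) (integrable_wgt_on _ a0)); lra.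
  have iw' : leb.-integrable `[0, a] (EFin \o w) by exact: integrableS iw.
  apply: (le_integrable _ _ _ iw') => //.
    by apply/measurable_EFinP; exact: measurable_funTS mh.
  move=> x /=; rewrite in_itv/= => /andP[x0 xa]; rewrite lee_fin /w /wgt_on indicE mem_set ?mulr1; last first.
    by rewrite /= in_itv /= xa (le_trans _ x0)// oppr_le0 ltW.
  by rewrite (le_trans (bh _ x0))// ler_norm.
have lPh : - Ph (ln x) @[x --> 0^'+] --> (0 : R).
  have [D hD] := profile_Ph_bound P.
  have D0 : 0 <= D by have := le_trans (normr_ge0 (Ph 0)) (hD 0); rewrite mulr0 expR0 mulr1.
  apply/cvgrPdist_lt => d d0; near=> x.
  have x0 : 0 < x by near: x; exact: nbhs_right_gt.
  have xd : x < expR (ln (d / (D + 1)) / kap) by near: x; apply: nbhs_right_lt; exact: expR_gt0.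
  rewrite sub0r opprK (le_lt_trans (hD _))//.
  have : expR (kap * ln x) < d / (D + 1).
    rewrite -[ltRHS]lnK ?posrE ?divr_gt0 ?ltr_wpDl// ltr_expR mulrC -ltr_pdivlMr//.
    by rewrite -ltr_expR lnK// posrE.
  rewrite ltr_pdivlMr ?ltr_wpDl//; have := expR_gt0 (kap * ln x); nra.
rewrite (ftc_singular_left a0 ih _ lPh) ?subr0// => x /andP[x0 _].
have x1 : x != 0 by rewrite gt_eqF.
have hl : is_derive x 1 (@ln R) x^-1 := is_derive1_ln x0.
split.
  rewrite /h radS//; have hP := is_derive_chain (profile_Ph P (ln x)) hl.
  by apply: (is_derive_eq (dN hP)); ring.
apply: (is_derive_continuous (a := - 2 * k / x ^+ 2 * FF e (S (ln x)) + 2 * k / x * (Gamma e (S (ln x)) * (Sd (ln x) / x)))).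
apply: (@near_eq_is_derive R _ _ (fun x : R => 2 * k / x * FF e (S (ln x)) : R)).
  by have := near_gt x0; apply: filterS => y y0; rewrite /h radS.
have hF := is_derive_chain (is_derive_FF e _) (is_derive_chain (profile_S P (ln x)) hl).
have hV := dV x1 (dI x).
by der; field.
Unshelve. all: by end_near. Qed.
End Potential.

(** * Hyperbolic coordinates, equivariance and nontriviality *)

Section HyperbolicCoordinates.
Context {R : realType}.
Implicit Types (t x y : R) (z : R * R * R).

Definition is_hor (X : axis) : bool := if X is hor then true else false.

Let sqr_lt (x y : R) : `|y| < `|x| -> y * y < x * x.
Proof.
move=> yx; rewrite -!expr2 -[y ^+ 2]real_normK ?num_real// -[x ^+ 2]real_normK ?num_real//.
by rewrite ltr_sqr ?nnegrE.
Qed.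

Lemma cone_null X sg t x y : cone X sg (x, y) ->
  let z := (t, x, y) in [/\ xi z != 0, zt z != 0 & horizontal z = is_hor X].
Proof.
have prod : xi (t, x, y) * zt (t, x, y) = x * x - y * y by rewrite /xi /zt /=; ring.
case: X => -[/= /sqr_lt h _].
  have p0 : 0 < xi (t, x, y) * zt (t, x, y) by rewrite prod; lra.
  have := gt_eqF p0; rewrite mulf_eq0 => /norP[? ?]; split => //.
have p0 : xi (t, x, y) * zt (t, x, y) < 0 by rewrite prod; lra.
have := lt_eqF p0; rewrite mulf_eq0 => /norP[? ?]; split => //.
exact: lt_gtF.
Qed.

Lemma hyp_radius_gt0 t x y : xi (t, x, y) != 0 -> zt (t, x, y) != 0 -> 0 < hyp_radius x y.
Proof.
move=> x0 z0; rewrite /hyp_radius sqrtr_gt0 normr_gt0.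
by rewrite (_ : _ - _ = xi (t, x, y) * zt (t, x, y)); [rewrite mulf_neq0|rewrite /xi /zt /=; ring].
Qed.

Lemma ln_hyp_radius t x y : xi (t, x, y) != 0 -> zt (t, x, y) != 0 ->
  ln (hyp_radius x y) = tau (t, x, y).
Proof.
move=> x0 z0; have r0 := hyp_radius_gt0 x0 z0.
have : hyp_radius x y ^+ 2 = `|xi (t, x, y)| * `|zt (t, x, y)|.
  rewrite sqr_sqrtr// -normrM; congr (`| _ |); rewrite /xi /zt /=; ring.
move=> /(congr1 (@ln R)); rewrite lnXn// lnM ?posrE ?normr_gt0// /tau => <-.
by rewrite -[ln _ *+ 2]mulr_natr; field.
Qed.

Lemma hyp_angleE t x y : xi (t, x, y) != 0 -> zt (t, x, y) != 0 -> hyp_angle x y = alpha (t, x, y).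
Proof.
by move=> x0 z0; rewrite /hyp_angle ln_div ?posrE ?normr_gt0// mulrC.
Qed.

Variables (t0 al0 : R).

(** A boost multiplies the null coordinates by e^al0 and e^(- al0): it
    preserves a and the type of the cone, and adds al0 to alpha. *)
Lemma xi_boost z : xi (boost t0 al0 z) = xi z * expR al0.
Proof. by case: z => -[t x] y; rewrite /boost /xi /= /cosh /sinh; field. Qed.
Lemma zt_boost z : zt (boost t0 al0 z) = zt z * expR (- al0).
Proof. by case: z => -[t x] y; rewrite /boost /zt /= /cosh /sinh; field. Qed.

Let ln_mul_exp (s r : R) : s != 0 -> ln `|s * expR r| = ln `|s| + r.
Proof.
move=> s0; rewrite normrM (gtr0_norm (expR_gt0 r)) lnM ?posrE ?normr_gt0 ?expR_gt0//.
by rewrite expRK.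
Qed.

Lemma tau_boost z : xi z != 0 -> zt z != 0 -> tau (boost t0 al0 z) = tau z.
Proof. by move=> x0 z0; rewrite /tau xi_boost zt_boost !ln_mul_exp//; lra. Qed.
Lemma alpha_boost z : xi z != 0 -> zt z != 0 -> alpha (boost t0 al0 z) = alpha z + al0.
Proof. by move=> x0 z0; rewrite /alpha xi_boost zt_boost !ln_mul_exp//; lra. Qed.
Lemma sel_boost F z : xi z != 0 -> zt z != 0 -> sel F (boost t0 al0 z) = sel F z.
Proof.
move=> x0 z0; rewrite /sel tau_boost//; congr (F _ _).
by rewrite /horizontal xi_boost zt_boost mulrACA -expRD subrr expR0 mulr1.
Qed.
End HyperbolicCoordinates.

Section AnsatzProperties.
Context {R : realType} (e : sign).
Variables (mu k b c : R).
Variables S B Ph : bool -> R -> R.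
Notation leb := (@lebesgue_measure R).
Notation mR := (measurableTypeR R).
Notation T3 := (mR * mR * mR)%type.
Notation u := (u_ e mu k c S B).
Notation phi := (phi_ b c Ph).

Let Gamma_neq0 (s : R) : `|s| <= 1 -> s != 0 -> Gamma e s != 0.
Proof.
have pos0 (r : R) : r <= 1 -> 0 < r -> 0 < Gamma e r.
  by move=> r1 r0; have := @Gamma_ge _ e r; rewrite ltW// r1 => /(_ isT); lra.
rewrite ler_norml => /andP[s1 s2]; case: ltgtP => // s0 _; last by rewrite gt_eqF// pos0.
by rewrite -oppr_eq0 -GammaN gt_eqF// pos0//; lra.
Qed.

Let far_axis (r x y : R) : 0 < r -> 2 * r <= x <= 3 * r -> 0 <= y <= r ->
  [/\ 0 < `|x + y| <= 4 * r, 0 < `|x - y| <= 4 * r & 0 < (x + y) * (x - y)].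
Proof.
move=> r0 /andP[a1 a2] /andP[a3 a4]; have p1 : 0 < x + y by lra.
have p2 : 0 < x - y by lra.
by rewrite !gtr0_norm// mulr_gt0//; split => //; lra.
Qed.

Lemma ansatz_equivariant : equivariant mu k c u phi.
Proof.
move=> t0 al0; apply: (@filterS _ _ (ae_filter_ringOfSetsType (mu3 R)) _ _ _ ae_off_cone) => z [x0 z0].
split; last by rewrite /phi_ alpha_boost// tau_boost// /Ph_ sel_boost//; ring.
have th : th_ mu k c B (boost t0 al0 z) = th_ mu k c B z + (mu * t0 + k * al0).
  rewrite /th_ sel_boost// tau_boost// alpha_boost//.
  by case: z {x0 z0} => -[t x] y /=; ring.
rewrite /Defs.rot /u_ !vec3E /C_ /N_ th cosD sinD /H_ /G_ !sel_boost//.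
by congr vec3; ring.
Qed.

(** If u were (1, 0, 0) almost everywhere, s would vanish somewhere on the box
    below, which has positive measure and on which ln a <= T. *)
Lemma ansatz_nontrivial h (T : R) : (forall t, `|S h t| <= 1) -> (forall t : R, t <= T -> S h t != 0) ->
  nontrivial u.
Proof.
move=> S1 S0 [N [mN N0 uN]].
have r0 : 0 < expR T / 4 by rewrite divr_gt0 ?expR_gt0.
(* On the box both null coordinates are bounded by 4 r = e^T. *)
pose r := expR T / 4.
pose far := (`[2 * r, 3 * r]%classic : set mR); pose near0 := (`[0, r]%classic : set mR).
pose A := if h then far else near0; pose A' := if h then near0 else far.
have mA : measurable A by rewrite /A; case: (h); exact: measurable_itv.
have mA' : measurable A' by rewrite /A'; case: (h); exact: measurable_itv.
pose box : set T3 := (near0 `*` A) `*` A'.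
have li (a a' : R) : a < a' -> leb `[a, a'] = (a' - a)%:E.
  by move=> aa; rewrite lebesgue_measure_itv /= lte_fin aa -EFinB.
have lf : leb far = r%:E by rewrite li; [congr EFin; ring|rewrite /r; lra].
have ln0 : leb near0 = r%:E by rewrite li// subr0.
have lA : leb A = r%:E by rewrite /A; case: (h).
have lA' : leb A' = r%:E by rewrite /A'; case: (h).
have mbox : (mu3 R box = (r * r * r)%:E)%E.
  have h1 := @product_measure1E _ _ _ _ R (leb2 R) leb (near0 `*` A) A' (measurableX (measurable_itv _) mA) mA'.
  have h2 := @product_measure1E _ _ _ _ R leb leb near0 A (measurable_itv _) mA.
  have h3 : leb2 R (near0 `*` A) = (r * r)%:E by apply: (etrans h2); apply: (etrans (congr2 mule ln0 lA)).
  by apply: (etrans h1); apply: (etrans (congr2 mule h3 lA')).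
have boxN : box `<=` N.
  move=> [[t x] y] [[/= _ Ax] A'y]; apply: uN => /= uE.
  have [hz tz] : horizontal (t, x, y) = h /\ tau (t, x, y) <= T.
    have [h1 h2 h3] : [/\ 0 < `|xi (t, x, y)| <= 4 * r, 0 < `|zt (t, x, y)| <= 4 * r &
        horizontal (t, x, y) = h].
      move: Ax A'y; rewrite /A /A' /far /near0 /horizontal /xi /zt /= => Ax A'y.
      case: (h) Ax A'y; rewrite /= !in_itv /= => xr yr; first exact: far_axis.
      have [h1 h2 h3] := far_axis r0 yr xr; split; [by rewrite addrC|by rewrite distrC|].
      by apply: lt_gtF; rewrite -oppr_gt0 -mulrN opprB addrC.
    split => //; have r4 : 4 * r = expR T by rewrite /r; field.
    have lnT (s : R) : 0 < s <= 4 * r -> ln s <= T.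
      by move=> /andP[s0 s1]; rewrite -[T]expRK ler_ln ?posrE ?expR_gt0// -r4.
    by have := lnT _ h1; have := lnT _ h2; rewrite /tau; lra.
  have : H_ e S (t, x, y) = 1 by have := congr1 (fun v : 'rV[R]_3 => v 0 0) uE; rewrite /u_ !vec3E.
  have := relG e S (t, x, y); rewrite /G_ /H_ /sel hz => g hH.
  move: g; rewrite hH expr1n subrr mulr0 => /eqP; rewrite mulf_eq0 orbb => /eqP.
  by apply/eqP/Gamma_neq0 => //; exact: S0.
have mB : measurable box by apply: measurableX => //; apply: measurableX => //; exact: measurable_itv.
have : (r * r * r)%:E = 0 :> \bar R by apply: (etrans (esym mbox)); exact: subset_measure0 mB mN boxN N0.
move=> -[] /eqP.
have rp : 0 < r := r0.
have p3 : 0 < r * r * r by apply: mulr_gt0 => //; exact: mulr_gt0.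
by rewrite (gt_eqF p3).
Qed.
End AnsatzProperties.

(** * Existence of the equivariant standing waves *)

Theorem theorem1 (R : realType) (N : sign) (mu k c : R)
    (hmu : mu != 0) (hk : k != 0) (hc : c != 0)
    (b : R) (hb : c ^+ 2 < - 4 * (k ^+ 2 + b * k)) :
  exists (s beta : axis -> sign -> R -> R)
         (u : R * R * R -> 'rV[R]_3) (phi : R * R * R -> R),
    [/\ weak_solution N u phi, equivariant mu k c u phi & nontrivial u] /\
    (forall (X : axis) (e : sign) (t x y : R), cone X e (x, y) ->
       let a := hyp_radius x y in
       let alpha := hyp_angle x y in
       let theta := beta X e a + k * alpha + mu * t in
       u (t, x, y) = vec3 (derive1 (Gamma N) (s X e a))
                          (Gamma N (s X e a) * cos theta)
                          (Gamma N (s X e a) * sin theta) /\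
       phi (t, x, y) = c * alpha + b * ln a
         - \int[lebesgue_measure]_(a' in `[0, a])
             (2 * k / a' * Fint N (s X e a'))) /\
    (forall (X : axis) (e : sign), s X e 0 = 0) /\
    (forall (X : axis) (a : R), 0 <= a ->
       s X minus a = s X plus a /\ beta X minus a = beta X plus a) /\
    (forall (X : axis) (e : sign),
       smooth_pos (s X e) /\ smooth_pos (beta X e)) /\
    (let kappa := Num.sqrt (- (k ^+ 2 + b * k) - c ^+ 2 / 4) in
     forall (X : axis) (e : sign),
       locally_Ckappa kappa (s X e) /\
       locally_Ckappa_mod_log kappa c (beta X e)).

Proof.
have K0 : 0 < kap2 k b c by rewrite /kap2; lra.
have [S [Sd [B [Ph [HP [h [T hT]]]]]]] : exists S Sd B Ph : bool -> R -> R,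
    (forall h, profile N mu k b c (cone_sign h) (S h) (Sd h) (B h) (Ph h)) /\
    exists h (T : R), forall t, t <= T -> S h t != 0.
  (* The cones in which the force is restoring. *)
  pose h0 := mu < 0.
  have sg : (cone_sign h0 : R) * mu < 0.
    rewrite /cone_sign /h0; have [m0|m0|m0] := ltgtP mu 0; first by rewrite mul1r.
      by rewrite mulN1r oppr_lt0.
    by rewrite m0 eqxx in hmu.
  have [S [Sd [B [Ph [P [T hT]]]]]] := profile_small N K0 sg.
  pose glue (f : R -> R) h := if h == h0 then f else fun=> 0.
  exists (glue S), (glue Sd), (glue B), (glue Ph); split.
    by move=> h; rewrite /glue; case: eqP => [->|_] //; exact: profile_zero.
  by exists h0, T; rewrite /glue eqxx.
pose s X (_ : sign) := radial (S (is_hor X)).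
pose beta X (_ : sign) := phase c (B (is_hor X)).
exists s, beta, (u_ N mu k c S B), (phi_ b c Ph).
split; [|split; [|split; [|split; [|split]]]].
- split; [exact: (ansatz_weak_solution K0 HP)|exact: ansatz_equivariant|].
  by apply: (ansatz_nontrivial (h := h) (T := T)) => // t; exact: profile_le1 (HP h) t.
- move=> X e t x y hz a al theta.
  have [x0 z0 hX] := cone_null t hz.
  have a0 : 0 < a := hyp_radius_gt0 x0 z0.
  have la : ln a = tau (t, x, y) := ln_hyp_radius x0 z0.
  have lal : al = alpha (t, x, y) := hyp_angleE x0 z0.
  have sE : s X e a = sel S (t, x, y) by rewrite /s /radial leNgt a0 /= la /sel hX.
  have thE : theta = th_ mu k c B (t, x, y).
    by rewrite /theta /beta /phase /radial leNgt a0 /= la lal /th_ /sel hX.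
  split.
    by rewrite derive1_Gamma sE thE.
  by rewrite (integral_potential K0 (HP (is_hor X)) a0) /phi_ -la -lal opprK /Ph_ /sel hX -la.
- by move=> X e; rewrite /s /radial lexx.
- by [].
- move=> X e; split; first exact: (profile_regular_s K0 (HP _)).1.
  exact: (profile_regular_beta K0 (HP _)).1.
move=> kappa X e; split; first exact: (profile_regular_s K0 (HP _)).2.
exact: (profile_regular_beta K0 (HP _)).2.
Qed.
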